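(* Let $1\le\theta<2$, $m=\tfrac12$, $\varepsilon=m-\omega\in(0,\varepsilon_0)$, and let $(f,g)=(f,g)(\varepsilon)$ and $e_1,e_2$ be the solutions and remainders described in the context. Then there exist $C(\varepsilon)>0$ and $\sigma(\varepsilon)>0$ such that $$|e_j(r)|+|\partial_r e_j(r)|\le C e^{-\sigma r},\qquad j=1,2.$$ Moreover, the solutions $(f,g)$ are classical solutions of the system $$f'+\frac{2}{r}f=\big(|g^2-f^2|^{\theta}-(m-\omega)\big)g,\qquad g'=\big(|g^2-f^2|^{\theta}-(m+\omega)\big)f,$$ and $$f,g\in\bigcap_{2\le p<+\infty}W^{2,p}_r .$$
   Context: $W^{k,p}_r=W^{k,p}_r(\mathbb{R}^3)$ denotes the Sobolev space of radial functions on $\mathbb{R}^3$; radial functions are written as functions of $r=|x|$, and $'=\partial_r=d/dr$. $Q(x)=Q(|x|)$ is the ground state: the unique positive radial solution of $-\Delta Q+Q=|Q|^{2\theta}Q$ in $\mathbb{R}^3$, which is smooth and, together with its derivatives, decays exponentially at infinity. The solutions and remainders: for $1\le\theta<2$ there exist $\varepsilon_0=\varepsilon_0(\theta)>0$ and a unique solution $(f,g)(\varepsilon)\in\mathcal{C}((0,\varepsilon_0),W^{1,4}_r(\mathbb{R}^3,\mathbb{R}^2))$ of the system displayed in the claim (with $\omega=m-\varepsilon$) satisfying $$f(r)=\varepsilon^{\frac{\theta+1}{2\theta}}\big(-Q'(\sqrt{\varepsilon}\,r)+e_2(\sqrt{\varepsilon}\,r)\big),\qquad g(r)=\varepsilon^{\frac{1}{2\theta}}\big(Q(\sqrt{\varepsilon}\,r)+e_1(\sqrt{\varepsilon}\,r)\big),$$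 with $\|e_j\|_{W^{1,4}_r}\le C\varepsilon$ for some $C=C(\theta)>0$, $j=1,2$. The pair $(f,g)$ and the radial functions $e_1,e_2$ (depending on $\varepsilon$) in the claim are these.
   Formalization: W^{2,p}_r is read as f, ∂_r f, ∂_r² f in L^p(R^3): with the full Hessian the claim fails for f when p≥3, since f(r)~cr with c≠0 near 0 gives a Hessian of size 1/|x|. Also the threshold ε_0 is taken at most 2m=1, so that ω lies in (-m,m). *)

(* Defs.v *)
From HB Require Import structures.
From mathcomp Require Import all_boot all_order all_algebra.
From mathcomp Require Import all_classical all_reals all_analysis.

Set Implicit Arguments.
Unset Strict Implicit.
Unset Printing Implicit Defensive.

Import Order.TTheory GRing.Theory Num.Theory.
Import numFieldNormedType.Exports.

Local Open Scope classical_set_scope.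
Local Open Scope ring_scope.

Section EuclideanSpace.
Context {R : realType}.
Implicit Types (phi : R * R * R -> R) (x : R * R * R) (i : 'I_3).

Definition coord3 i x : R :=
  match val i with 0%N => x.1.1 | 1%N => x.1.2 | _ => x.2 end.

Definition basis3 i : R * R * R :=
  ((val i == 0%N)%:R, (val i == 1%N)%:R, (val i == 2%N)%:R).

(* The norm `|x| that the library puts on R * R * R is the sup norm; radial
   functions need the Euclidean one. *)
Definition enorm3 x : R := Num.sqrt (\sum_(i < 3) coord3 i x ^+ 2).

Definition pderiv3 i phi : R * R * R -> R := fun x => 'D_(basis3 i) phi x.

Definition pderivs3 (s : seq 'I_3) phi : R * R * R -> R := foldr pderiv3 phi s.

Definition laplacian3 phi x : R := \sum_(i < 3) pderiv3 i (pderiv3 i phi) x.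

Definition smooth3 phi : Prop :=
  forall (s : seq 'I_3) x, differentiable (pderivs3 s phi) x.

Definition test_function3 phi : Prop :=
  [/\ forall x, differentiable phi x,
      forall i, continuous (pderiv3 i phi)
    & exists2 K : set (R * R * R), compact K & forall x, ~ K x -> phi x = 0].

Definition leb3 : {measure set (measurableTypeR R * measurableTypeR R
                                 * measurableTypeR R) -> \bar R} :=
  ((@lebesgue_measure R \x @lebesgue_measure R) \x @lebesgue_measure R)%E.

End EuclideanSpace.

Section RadialSobolev.
Context {R : realType}.
Implicit Types (u v : R -> R) (p : R).

(* A radial function on R^3 is represented by its profile u; only the values
   of u at r > 0 matter, and only up to a null set. *)
Definition radial u : R * R * R -> R := fun x => u (enorm3 x).

Definition radial_ae_eq u v : Prop :=
  {ae @lebesgue_measure R, forall r : R, 0 < r -> u r = v r}.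

Definition radial_Lp p u : Prop := radial u \in Lfun leb3 p%:E.

Definition radial_loc_integrable u : Prop :=
  forall K : set (R * R * R), compact K ->
    leb3.-integrable K (EFin \o radial u).

(* v = \partial_r u : the distributional gradient on the whole of R^3 of the
   radial function u(|x|) is v(|x|) x / |x|.  Testing against compactly
   supported C^1 functions is equivalent, by mollification, to testing against
   smooth ones. *)
Definition weak_radial_derivative u v : Prop :=
  [/\ radial_loc_integrable u, radial_loc_integrable v
    & forall (phi : R * R * R -> R) (i : 'I_3), test_function3 phi ->
        (\int[leb3]_x (radial u x * pderiv3 i phi x) =
         - \int[leb3]_x (radial v x * (coord3 i x / enorm3 x) * phi x))%R].

(* Determined up to radial_ae_eq when the weak derivative exists; the zero
   function otherwise. *)
Definition rderiv u : R -> R :=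
  xget (cst 0) [set v | weak_radial_derivative u v].

(* W^{k,p}_r(R^3), with the derivatives of a radial function being its radial
   derivatives \partial_r^j.  For k = 1 this is the space of radial elements
   of W^{1,p}(R^3).  For k = 2 it does not ask for u'/r in L^p, unlike the full
   Hessian of u(|x|): a profile with u(r) ~ c r at the origin, c <> 0, has a
   Hessian of size 1/|x|, which is in L^p near 0 only for p < 3. *)
Fixpoint radial_Sobolev (k : nat) p u : Prop :=
  match k with
  | 0%N => radial_Lp p u
  | k'.+1 => [/\ radial_Lp p u,
                 exists v, weak_radial_derivative u v
               & radial_Sobolev k' p (rderiv u)]
  end.

(* A norm on radial_Sobolev k p; meaningless outside this space, where rderiv
   may take its default value. *)
Definition radial_Sobolev_norm (k : nat) p u : \bar R :=
  (\sum_(j < k.+1) 'N[leb3]_(p%:E)[EFin \o radial (iter j rderiv u)])%E.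

End RadialSobolev.

Section SolitaryWaves.
Context {R : realType}.

(* Q is the profile of the ground state. *)
Definition ground_state (theta : R) (Q : R -> R) : Prop :=
  [/\ forall x, 0 < radial Q x,
      smooth3 (radial Q),
      forall x, - laplacian3 (radial Q) x + radial Q x =
                `|radial Q x| `^ (2 * theta) * radial Q x
    & forall s : seq 'I_3, exists C sigma : R, [/\ 0 < C, 0 < sigma
        & forall x, `|pderivs3 s (radial Q) x| <= C * expR (- sigma * enorm3 x)]].

Definition soler_system (theta m omega : R) (f g f' g' : R -> R) (r : R) : Prop :=
  f' r + 2 / r * f r =
    (`|g r ^+ 2 - f r ^+ 2| `^ theta - (m - omega)) * g r /\
  g' r = (`|g r ^+ 2 - f r ^+ 2| `^ theta - (m + omega)) * f r.

Definition weak_solution (theta m omega : R) (f g : R -> R) : Prop :=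
  {ae @lebesgue_measure R, forall r : R, 0 < r ->
     soler_system theta m omega f g (rderiv f) (rderiv g) r}.

Definition classical_solution (theta m omega : R) (f g : R -> R) : Prop :=
  forall r : R, 0 < r ->
    [/\ derivable f r 1 /\ derivable g r 1,
        {for r, continuous (derive1 f)} /\ {for r, continuous (derive1 g)}
      & soler_system theta m omega f g (derive1 f) (derive1 g) r].

Definition exp_decay (C sigma : R) (e : R -> R) : Prop :=
  forall r : R, 0 < r ->
    derivable e r 1 /\ `|e r| + `|derive1 e r| <= C * expR (- sigma * r).

(* The family eps |-> (f eps, g eps) bifurcating from the ground state Q as
   omega = m - eps tends to m, with remainders e1 eps and e2 eps. *)
Definition solitary_family (theta m eps0 : R) (Q : R -> R)
    (f g e1 e2 : R -> R -> R) : Prop :=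
  [/\ forall eps : R, 0 < eps < eps0 ->
        [/\ radial_Sobolev 1 4 (f eps), radial_Sobolev 1 4 (g eps),
            (radial_Sobolev_norm 1 4 (f t \- f eps)) @[t --> eps] --> 0%E
          & (radial_Sobolev_norm 1 4 (g t \- g eps)) @[t --> eps] --> 0%E],
      forall eps : R, 0 < eps < eps0 ->
        weak_solution theta m (m - eps) (f eps) (g eps),
      forall eps : R, 0 < eps < eps0 ->
        radial_ae_eq (f eps) (fun r => eps `^ ((theta + 1) / (2 * theta)) *
          (- derive1 Q (Num.sqrt eps * r) + e2 eps (Num.sqrt eps * r))) /\
        radial_ae_eq (g eps) (fun r => eps `^ (1 / (2 * theta)) *
          (Q (Num.sqrt eps * r) + e1 eps (Num.sqrt eps * r)))
    & exists2 C : R, 0 < C & forall eps : R, 0 < eps < eps0 ->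
        [/\ radial_Sobolev 1 4 (e1 eps), radial_Sobolev 1 4 (e2 eps),
            (radial_Sobolev_norm 1 4 (e1 eps) <= (C * eps)%:E)%E
          & (radial_Sobolev_norm 1 4 (e2 eps) <= (C * eps)%:E)%E]].

End SolitaryWaves.

(* Main.v *)
(* Proof idea.  Testing the weak derivative in R^3 against phi(x) = x_i xi(|x|^2)
   turns it into a weak derivative on the half-line, and then the Lebesgue
   differentiation theorem shows that f and g have representatives F and G that
   are primitives of their weak derivatives.  Since the right-hand side of the
   system is continuous in (r, F, G), F and G are C^1 and solve it classically.

   At infinity, the L^4 bounds on (F, G) and its derivative give (F, G) -> 0; the
   system is then a small perturbation of F' = - eps G - 2 F / r,
   G' = - (1 - eps) F, which is hyperbolic, hence the exponential decay.  At the
   origin, the L^4 bound on the derivative gives boundedness, and integrating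
   (r^2 F)' = r^2 h, with h = (|g^2 - f^2|^theta - eps) G, gives F = O(r) and
   3 F / r - h = O(r).  So F'' = h' - 2 (h - 3 F / r) / r is bounded, and F', F'',
   G', G'' all decay exponentially.

   It remains to see that F'' and G'' are the weak derivatives of F' and G' on R^3.
   As |.|^theta is only Lipschitz when theta = 1, it is replaced by
   (x^2 + 1/n)^(theta/2): for C^1 profiles with bounded derivative the weak
   derivative on R^3 follows from Fubini's theorem and the fundamental theorem of
   calculus on lines, and weak derivatives pass to bounded pointwise limits. *)
Require Import Defs.
From HB Require Import structures.
From mathcomp Require Import all_boot all_order all_algebra.
From mathcomp Require Import all_classical all_reals all_analysis.
From mathcomp Require Import measurable_realfun ring lra.
Import Order.TTheory GRing.Theory Num.Theory.
Import numFieldNormedType.Exports.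
Local Open Scope classical_set_scope.
Local Open Scope ring_scope.

Set Implicit Arguments.
Unset Strict Implicit.
Unset Printing Implicit Defensive.

(** * Calculus on the real line *)

(** Profiles are known only for r > 0 and up to null sets, and [rderiv] is a choice among weak
    derivatives; every regular representative has to be tied to that choice first, which rests on
    uniqueness of the weak derivative. Integration over spheres is avoided: the volume of a ball
    scales like r^3, and this determines the image of Lebesgue measure under the norm, hence the
    weight of polar coordinates. Boundedness at the origin uses that 4 exceeds the dimension 3: |F'|
    <= r^2 F'^4 + r^(-2/3), and the last power is integrable at 0. The L^4 bounds enter the
    asymptotic arguments only through bounded primitives, so that these arguments become
    differential inequalities. For the second derivatives, the derivatives of the regularised powers
    converge at every point, also at 0, where they all vanish; hence nothing has to be known about
    the set where g^2 = f^2. Finally, boundedness near 0 together with exponential decay puts a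
    function in L^p for all finite p >= 1 at once. *)

Section one_variable_calculus.
Context {R : realType}.
Implicit Types (f g df dg : R -> R) (a b x : R).

Lemma is_derive1D f g x u v : is_derive x 1 f u -> is_derive x 1 g v ->
  is_derive x 1 (fun t => f t + g t) (u + v).
Proof. by move=> fu gv; exact: is_deriveD. Qed.

Lemma is_derive1B f g x u v : is_derive x 1 f u -> is_derive x 1 g v ->
  is_derive x 1 (fun t => f t - g t) (u - v).
Proof. by move=> fu gv; exact: is_deriveB. Qed.

Lemma is_derive1N f x u : is_derive x 1 f u ->
  is_derive x 1 (fun t => - f t) (- u).
Proof. by move=> fu; exact: is_deriveN. Qed.

Lemma is_derive1M f g x u v : is_derive x 1 f u -> is_derive x 1 g v ->
  is_derive x 1 (fun t => f t * g t) (u * g x + f x * v).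
Proof.
move=> fu gv; have := is_deriveM fu gv => /is_derive_eq; apply.
by rewrite /GRing.scale/= addrC mulrC.
Qed.

Lemma is_derive1Z (k : R) f x u : is_derive x 1 f u ->
  is_derive x 1 (fun t => k * f t) (k * u).
Proof. by move=> fu; exact: (@is_deriveZ _ _ _ f k). Qed.

Lemma is_derive1X f n x u : is_derive x 1 f u ->
  is_derive x 1 (fun t => f t ^+ n) (n%:R * f x ^+ n.-1 * u).
Proof.
by move=> fu; have := is_deriveX n fu; rewrite exprfctE => /is_derive_eq; apply.
Qed.

Lemma is_derive1V f x u : f x != 0 -> is_derive x 1 f u ->
  is_derive x 1 (fun t => (f t)^-1) (- (f x) ^- 2 * u).
Proof. by move=> fx fu; have /is_derive_eq := is_deriveV fx fu; apply. Qed.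

Lemma is_derive1_continuous f x u : is_derive x 1 f u -> {for x, continuous f}.
Proof. by move=> [fu _]; exact/differentiable_continuous/derivable1_diffP. Qed.

Lemma derive1_is_derive f x u : is_derive x 1 f u -> derive1 f x = u.
Proof. by move=> [_ <-]; rewrite derive1E. Qed.

Lemma is_derive1_near f g x u : (\forall t \near x, f t = g t) ->
  is_derive x 1 f u -> is_derive x 1 g u.
Proof.
exact: near_eq_is_derive.
Qed.

Lemma within_is_derive f df a b :
  (forall x, a <= x <= b -> is_derive x 1 f (df x)) ->
  {within `[a, b], continuous f}.
Proof.
move=> fd; apply: derivable_within_continuous => x; rewrite in_itv/= => xab.
by have [] := fd _ xab.
Qed.

Lemma is_derive_ge0_le f df a b : a <= b ->
  (forall x, a <= x <= b -> is_derive x 1 f (df x)) ->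
  (forall x, a <= x <= b -> 0 <= df x) -> f a <= f b.
Proof.
move=> ab fd df0.
have [x||c] := @MVT_segment _ f df a b ab.
- by rewrite in_itv/= => /andP[ax xb]; apply: fd; rewrite !ltW.
- exact: within_is_derive fd.
rewrite in_itv/= => cab fE.
by rewrite -subr_ge0 fE mulr_ge0 ?df0// subr_ge0.
Qed.

Lemma is_derive_le f df g dg a b : a <= b ->
  (forall x, a <= x <= b -> is_derive x 1 f (df x)) ->
  (forall x, a <= x <= b -> is_derive x 1 g (dg x)) ->
  (forall x, a <= x <= b -> df x <= dg x) -> f b - f a <= g b - g a.
Proof.
move=> ab fd gd dfg.
have : g a - f a <= g b - f b.
  apply: (@is_derive_ge0_le (fun t => g t - f t) (fun t => dg t - df t)) => //.
  - by move=> x xab; apply: is_derive1B; [exact: gd|exact: fd].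
  - by move=> x xab; rewrite subr_ge0 dfg.
by lra.
Qed.

Lemma is_derive_lipschitz f df M a b : a <= b ->
  (forall x, a <= x <= b -> is_derive x 1 f (df x)) ->
  (forall x, a <= x <= b -> `|df x| <= M) -> `|f b - f a| <= M * (b - a).
Proof.
move=> ab fd dfM.
have gd x : is_derive x (1 : R) (fun t : R => M * t) (M * 1).
  exact: is_derive1Z.
rewrite ler_norml; apply/andP; split.
- have := @is_derive_le (fun t => - f t) (fun t => - df t) _ _ _ _ ab _
    (fun x _ => gd x).
  have H : - f b - - f a <= M * b - M * a -> - (M * (b - a)) <= f b - f a.
    lra.
  move=> K; apply/H/K => x xab; first exact/is_derive1N/fd.
  by rewrite mulr1 lerNl; have := dfM _ xab; rewrite ler_norml => /andP[].
- rewrite mulrBr; apply: (@is_derive_le f df (fun t => M * t) (fun=> M * 1)) => //.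
  by move=> x xab; rewrite mulr1 (le_trans (ler_norm _))// dfM.
Qed.

Lemma integral_is_derive f df a b : a <= b ->
  (forall x, a <= x <= b -> is_derive x 1 f (df x)) ->
  {within `[a, b], continuous df} ->
  (\int[lebesgue_measure]_(x in `[a, b]) (df x)%:E = (f b - f a)%:E)%E.
Proof.
rewrite le_eqVlt => /predU1P[->|ab] fd cdf.
  by rewrite set_itv1 integral_set1 subrr.
have aab : a <= a <= b by rewrite lexx ltW.
have bab : a <= b <= b by rewrite lexx ltW.
rewrite (@continuous_FTC2 _ df f)//.
- split.
  + move=> x; rewrite in_itv/= => /andP[ax xb].
    by have [] : is_derive x 1 f (df x) by apply: fd; rewrite !ltW.
  + apply: cvg_at_right_filter; exact: (is_derive1_continuous (fd _ aab)).
  + apply: cvg_at_left_filter; exact: (is_derive1_continuous (fd _ bab)).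
- move=> x; rewrite in_itv/= => /andP[ax xb].
  by apply: derive1_is_derive; apply: fd; rewrite !ltW.
Qed.

(** Since t|t| is C^1 on the whole line, the volume of balls and the cut-offs can be given by single
    formulas, without cases on the sign of the variable. *)
Lemma is_derive_mulr_norm x : is_derive x 1 (fun t : R => t * `|t|) (2 * `|x|).
Proof.
have [->|x0] := eqVneq x 0.
  (* At 0 the difference quotient of t|t| is |t| itself, a continuous slope function. *)
  rewrite normr0 mulr0; apply/is_derive1_caratheodory; exists (@Num.norm R R).
  split; [by move=> z; rewrite mul0r !subr0 mulrC| |by rewrite normr0].
  exact: norm_continuous.
have [{}x0|{}x0] : 0 < x \/ x < 0 by move: x0; rewrite neq_lt => /orP[]; [right|left].
- rewrite gtr0_norm//; apply: (@is_derive1_near (fun t => t * t)).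
    by near=> t; rewrite [`|t|]gtr0_norm//; near: t; exact: lt_nbhsr.
  apply: is_derive_eq (is_derive1M (is_derive_id _ _) (is_derive_id _ _)) _.
  by lra.
- rewrite ltr0_norm//; apply: (@is_derive1_near (fun t => t * - t)).
    by near=> t; rewrite [`|t|]ltr0_norm//; near: t; exact: lt_nbhsl.
  apply: is_derive_eq
    (is_derive1M (is_derive_id _ _) (is_derive1N (is_derive_id _ _))) _.
  by lra.
Unshelve. all: by end_near. Qed.

End one_variable_calculus.

(** * Integration of radial functions *)

Lemma enorm3E (R : realType) (x : R * R * R) :
  enorm3 x = Num.sqrt (x.1.1 ^+ 2 + x.1.2 ^+ 2 + x.2 ^+ 2).
Proof. by rewrite /enorm3 !big_ord_recr/= big_ord0 add0r. Qed.

Lemma enorm3_ge0 (R : realType) (x : R * R * R) : 0 <= enorm3 x.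
Proof. exact: sqrtr_ge0. Qed.

Lemma sqr_enorm3 (R : realType) (x : R * R * R) :
  enorm3 x ^+ 2 = x.1.1 ^+ 2 + x.1.2 ^+ 2 + x.2 ^+ 2.
Proof. by rewrite enorm3E sqr_sqrtr// !addr_ge0// sqr_ge0. Qed.

(** The image of Lebesgue measure under x -> c x, multiplied by c, agrees with Lebesgue measure on
    the intervals ]a, b]; uniqueness does the rest. *)
Lemma lebesgue_measure_scale (R : realType) (c : R) (A : set R) : 0 < c ->
  measurable A ->
  lebesgue_measure ((fun x => c * x) @^-1` A) = (c^-1%:E * lebesgue_measure A)%E.
Proof.
move=> c0 mA.
have mf : measurable_fun setT (fun x : R => c * x) by exact: mulrl_measurable.
pose c' := NngNum (ltW c0).
pose m' : {measure set (measurableTypeR R) -> \bar R} :=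
  mscale c' (pushforward (@lebesgue_measure R)
    (fun x : measurableTypeR R => c * x : measurableTypeR R)).
have E : lebesgue_measure A = m' mf A.
  apply: lebesgue_measure_unique => // X [[a b]] _ <-.
  rewrite /m' /= /mscale /= /pushforward.
  rewrite (_ : _ @^-1` _ = `]a / c, b / c]%classic); last first.
    apply/seteqP; split => y /=; rewrite !in_itv/= ltr_pdivrMr//
      ler_pdivlMr// mulrC//.
  rewrite !lebesgue_measure_itv/= !lte_fin ltr_pM2r ?invr_gt0//.
  case: ifPn => // ab; last by rewrite mule0.
  rewrite -!EFinD -EFinM; congr EFin; field; exact: lt0r_neq0.
rewrite E /m' /= /mscale /= /pushforward muleA -EFinM mulVf ?mul1e//.
exact: lt0r_neq0.
Qed.

(** The image measure divided by k1 k2 has the right value on rectangles, so it is the product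
    measure by uniqueness. *)
Lemma product_measure_scale d1 d2 (T1 : measurableType d1)
    (T2 : measurableType d2) (R : realType)
    (m1 : {sigma_finite_measure set T1 -> \bar R})
    (m2 : {sigma_finite_measure set T2 -> \bar R})
    (s1 : T1 -> T1) (s2 : T2 -> T2) (k1 k2 : R) (A : set (T1 * T2)) :
  0 < k1 -> 0 < k2 -> measurable_fun setT s1 -> measurable_fun setT s2 ->
  (forall A, measurable A -> m1 (s1 @^-1` A) = (k1%:E * m1 A)%E) ->
  (forall A, measurable A -> m2 (s2 @^-1` A) = (k2%:E * m2 A)%E) ->
  measurable A ->
  (m1 \x m2)%E ((fun x => (s1 x.1, s2 x.2)) @^-1` A) =
    ((k1 * k2)%:E * (m1 \x m2) A)%E.
Proof.
move=> k10 k20 ms1 ms2 sm1 sm2 mA.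
have k0 : 0 < k1 * k2 by exact: mulr_gt0.
have ms : measurable_fun setT (fun x : T1 * T2 => (s1 x.1, s2 x.2)).
  by apply/measurable_fun_pair => /=; exact: measurableT_comp.
have k'0 : 0 <= (k1 * k2)^-1 by rewrite invr_ge0 ltW.
have kE (a b : \bar R) :
    (((k1 * k2)^-1)%:E * ((k1%:E * a) * (k2%:E * b)) = a * b)%E.
  rewrite [X in (_ * X)%E](_ : _ = (k1 * k2)%:E * (a * b))%E.
    by rewrite muleA -EFinM mulVf ?mul1e// lt0r_neq0.
  by rewrite EFinM muleACA.
pose m' : {measure set (T1 * T2) -> \bar R} :=
  mscale (NngNum k'0) (pushforward (m1 \x m2)%E
    (fun x : T1 * T2 => (s1 x.1, s2 x.2))).
have E : (m1 \x m2)%E A = m' ms A.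
  apply: product_measure_unique => // X Y mX mY.
  rewrite /m' /= /mscale /= /pushforward.
  rewrite (_ : _ @^-1` _ = (s1 @^-1` X) `*` (s2 @^-1` Y))//.
  rewrite product_measure1E.
  - transitivity (((k1 * k2)^-1)%:E * ((k1%:E * m1 X) * (k2%:E * m2 Y)))%E.
      by rewrite -(sm1 _ mX) -(sm2 _ mY).
    exact: kE.
  - by rewrite -[_ @^-1` _]setTI; exact: ms1.
  - by rewrite -[_ @^-1` _]setTI; exact: ms2.
rewrite E /m' /= /mscale /= /pushforward muleA -EFinM divff ?mul1e//.
exact: lt0r_neq0.
Qed.

(** The measure [leb3] is a nested product, so uniqueness of the product and Fubini's theorem need
    its first factor, itself a product, to be sigma-finite. Increasing covers of the factors give a
    cover by the squares of a common index. *)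
Lemma product_measure_sigma_finite d1 d2 (T1 : measurableType d1)
    (T2 : measurableType d2) (R : realType)
    (m1 : {sigma_finite_measure set T1 -> \bar R})
    (m2 : {sigma_finite_measure set T2 -> \bar R}) :
  sigma_finite setT (m1 \x m2)%E.
Proof.
have /sigma_finiteP[F [TF ndF Foo]] := sigma_finiteT m1.
have /sigma_finiteP[G [TG ndG Goo]] := sigma_finiteT m2.
exists (fun n => F n `*` G n); last first.
  move=> k; have [? ?] := Foo k; have [? ?] := Goo k.
  split; first exact: measurableX.
  by rewrite product_measure1E// lte_mul_pinfty// ge0_fin_numE.
apply/seteqP; split => // -[x y] _.
have [n _ Fnx] : (\bigcup_n F n) x by rewrite -TF.
have [k _ Gky] : (\bigcup_n G n) y by rewrite -TG.
exists (maxn n k) => //; split => /=.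
- by move: x Fnx; exact/subsetPset/ndF/leq_maxl.
- by move: y Gky; exact/subsetPset/ndG/leq_maxr.
Qed.

(* The product [leb1 \x leb1] is named because the canonical key
   [product_measure1] is already taken for [SigmaFiniteMeasure] by products of
   finite measures. *)
Definition leb2 {R : realType} :
    set (measurableTypeR R * measurableTypeR R) -> \bar R :=
  (@lebesgue_measure R \x @lebesgue_measure R)%E.

HB.instance Definition _ (R : realType) := Measure.on (@leb2 R).
HB.instance Definition _ (R : realType) :=
  Measure_isSigmaFinite.Build _ _ _ (@leb2 R)
    (product_measure_sigma_finite (@lebesgue_measure R) (@lebesgue_measure R)).

(** This reduces the volume of every ball of positive radius to that of the unit ball. *)
Lemma leb3_scale (R : realType) (c : R)
  (A : set (measurableTypeR R * measurableTypeR R * measurableTypeR R)) :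
  0 < c -> measurable A ->
  leb3 ((fun x => ((c * x.1.1, c * x.1.2), c * x.2)) @^-1` A) =
    ((c^-1 ^+ 3)%:E * leb3 A)%E.
Proof.
move=> c0 mA; have c'0 : 0 < c^-1 by rewrite invr_gt0.
pose s := (fun x : measurableTypeR R => c * x : measurableTypeR R).
have ms : measurable_fun setT s by exact: mulrl_measurable.
have sE (B : set (measurableTypeR R)) : measurable B ->
    lebesgue_measure (s @^-1` B) = (c^-1%:E * lebesgue_measure B)%E.
  by move=> mB; exact: lebesgue_measure_scale.
pose s2 := (fun x : measurableTypeR R * measurableTypeR R => (s x.1, s x.2)).
have ms2 : measurable_fun setT s2.
  by apply/measurable_fun_pair => /=; exact: measurableT_comp.
rewrite /leb3 !exprS expr0 mulr1 mulrA.
apply: (@product_measure_scale _ _ _ _ _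
  (@leb2 R) (@lebesgue_measure R) s2 s)
  => //; first exact: mulr_gt0.
move=> B mB; exact: (@product_measure_scale _ _ _ _ _
  (@lebesgue_measure R) (@lebesgue_measure R) s s).
Qed.

(** * Measures with a density *)

Section density_measure.
Context d (T : measurableType d) (R : realType).
Variables (mu : {measure set T -> \bar R}) (w : T -> R).
Hypotheses (mw : measurable_fun setT w) (w0 : forall x, 0 <= w x).

Definition density_measure & measurable_fun setT w & (forall x, 0 <= w x) :=
  fun A : set T => (\int[mu]_(x in A) (w x)%:E)%E.

Local Notation nu := (density_measure mw w0).

Let nu0 : nu set0 = 0%E. Proof. exact: integral_set0. Qed.

Let nu_ge0 A : (0 <= nu A)%E.
Proof. by apply: integral_ge0 => x _; rewrite lee_fin. Qed.

Let nu_sigma_additive : semi_sigma_additive nu.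
Proof.
move=> /= F mF tF mUF; rewrite /density_measure; apply: cvg_toP.
  apply: ereal_nondecreasing_is_cvgn => m n mn.
  apply: lee_sum_nneg_natr => // k _ _; apply: integral_ge0 => /= x Fkx.
  by rewrite lee_fin.
rewrite ge0_integral_bigcup//=.
- exact/measurable_funTS/measurableT_comp.
- by move=> x _; rewrite lee_fin.
Qed.

HB.instance Definition _ := isMeasure.Build _ _ _ nu
  nu0 nu_ge0 nu_sigma_additive.

Import HBNNSimple.

(** By monotone convergence both sides are limits along the same increasing simple functions; on a
    single level set the identity is the definition of the measure. *)
Lemma ge0_integral_density (f : T -> \bar R) (D : set T) : (forall x, 0 <= f x)%E ->
    measurable D -> measurable_fun D f ->
  (\int[nu]_(x in D) f x = \int[mu]_(x in D) (f x * (w x)%:E))%E.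
Proof.
move=> f0 mD mf; pose h := nnsfun_approx mD mf.
have mwD : measurable_fun D (EFin \o w).
  exact/measurable_funTS/measurableT_comp.
have fE x : D x -> f x = lim ((EFin \o h n) x @[n --> \oo])%E.
  by move=> Dx; apply/esym/cvg_lim => //; exact: cvg_nnsfun_approx.
have -> : (\int[nu]_(x in D) f x =
    lim (\int[nu]_(x in D) (EFin \o h n) x @[n --> \oo]))%E.
  under eq_integral => x /[!inE] /fE -> //.
  apply: monotone_convergence => //.
  - move=> n; apply/measurable_EFinP.
    by apply: (measurable_funS measurableT) => //; exact/measurable_funP.
  - by move=> n x Dx //=; rewrite lee_fin.
  - by move=> x Dx a b ab; rewrite lee_fin; exact/lefP/nd_nnsfun_approx.
have -> : (\int[mu]_(x in D) (f x * (w x)%:E) =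
    lim (\int[mu]_(x in D) ((EFin \o h n) \* (EFin \o w)) x @[n --> \oo]))%E.
  have fg x : D x ->
      (f x * (w x)%:E = lim (((EFin \o h n) \* (EFin \o w)) x @[n --> \oo]))%E.
    by move=> Dx; apply/esym/cvg_lim => //; apply: cvgeZr => //;
      exact: cvg_nnsfun_approx.
  under eq_integral => x /[!inE] /fg -> //.
  apply: monotone_convergence => [//| | |].
  - move=> n; apply/emeasurable_funM => //; apply/measurable_funTS.
    exact/measurable_EFinP.
  - by move=> n x Dx /=; rewrite mule_ge0 ?lee_fin.
  - by move=> x Dx a b ab/=; rewrite lee_wpmul2r ?lee_fin//;
      exact/lefP/nd_nnsfun_approx.
suff suf n : (\int[mu]_(x in D) ((EFin \o h n) x * (w x)%:E) =
    \int[nu]_(x in D) (EFin \o h n) x)%E.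
  by under [in RHS]eq_fun do rewrite suf.
transitivity (\int[nu]_(x in D)
   (\sum_(y \in range (h n)) (y * \1_(h n @^-1` [set y]) x)%:E))%E; last first.
  by apply: eq_integral => t tD; rewrite /= fimfunE -fsumEFin.
have indich m r : measurable_fun D (fun x => (r * \1_(h m @^-1` [set r]) x)%:E).
  by apply: (measurable_comp measurableT) => //; exact: measurable_funM.
rewrite ge0_integral_fsum//; last by move=> m y Dy; exact: nnfun_muleindic_ge0.
transitivity (\int[mu]_(x in D) (\sum_(y \in range (h n))
    (y * \1_(h n @^-1` [set y]) x)%:E * (w x)%:E))%E.
  under [RHS]eq_integral => x xD.
    rewrite -ge0_mule_fsuml => [|y]; last exact: nnfun_muleindic_ge0.
    rewrite fsumEFin // -(fimfunE _ x); over.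
  by [].
rewrite ge0_integral_fsum//; last 2 first.
  - by move=> y; apply: emeasurable_funM.
  - move=> m y Dy; apply: mule_ge0; last by rewrite lee_fin.
    by rewrite EFinM; exact: nnfun_muleindic_ge0.
apply: eq_fsbigr => r rhn.
under [RHS]eq_integral do rewrite EFinM.
rewrite integralZl_indic_nnsfun => //.
under eq_integral do rewrite EFinM -muleA.
have mhr : measurable (h n @^-1` [set r]) by exact: measurable_sfunP.
have r0 : 0 <= r by move: rhn; rewrite inE => -[x _ <-].
rewrite ge0_integralZl//.
- congr (_ * _)%E; rewrite integral_indic// /= /density_measure.
  under eq_integral do rewrite muleC.
  rewrite (eq_integral ((EFin \o w) \_ (h n @^-1` [set r]))); last first.
    by move=> x _; rewrite epatch_indic.
  by rewrite -integral_mkcondr setIC.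
- by apply: emeasurable_funM => //; exact/measurable_EFinP/measurable_indic.
- by move=> x _; rewrite mule_ge0 ?lee_fin.
Qed.

End density_measure.

(** Measurability refers to the product sigma-algebra, openness to the product topology. They meet
    because an open set is a countable union of boxes with rational centres and radii 1/(n+1). *)
Lemma open3_measurable (R : realType) (U : set (R * R * R)) : open U ->
  measurable (U : set (measurableTypeR R * measurableTypeR R * measurableTypeR R)).
Proof.
move=> oU.
pose box (q : rat * rat * rat * nat) : set (R * R * R) :=
  ball (ratr q.1.1.1 : R) q.2.+1%:R^-1 `*` ball (ratr q.1.1.2 : R) q.2.+1%:R^-1
  `*` ball (ratr q.1.2 : R) q.2.+1%:R^-1.
have -> : U = \bigcup_(q in [set q | box q `<=` U]) box q.
  apply/seteqP; split; last by move=> x [q /= qU qx]; exact: qU.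
  move=> x Ux; have /nbhs_ballP[e /= e0 xeU] := open_nbhs_nbhs (conj oU Ux).
  (* A box of radius h that contains x lies within distance 2 h of x, so 2/(n+1) < e keeps it inside
     U. *)
  pose n := Num.bound (2 / e).
  have ne : n.+1%:R^-1 + n.+1%:R^-1 < e.
    have -> : n.+1%:R^-1 + n.+1%:R^-1 = 2 / n.+1%:R :> R.
      by rewrite mulr_natl mulr2n.
    rewrite ltr_pdivrMr// mulrC -ltr_pdivrMr//.
    rewrite (lt_le_trans (archi_boundP _))//; first by rewrite divr_ge0// ltW.
    by rewrite ler_nat leqnSn.
  have pick (t : R) : exists q : rat, ball (ratr q : R) n.+1%:R^-1 t.
    have : t - n.+1%:R^-1 < t + n.+1%:R^-1.
      by rewrite ltrBlDr -addrA ltrDl addr_gt0// invr_gt0.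
    move=> /rat_in_itvoo[q]; rewrite in_itv/= => /andP[q1 q2].
    exists q; rewrite /ball/= ltr_norml.
    by move: q1 q2; move: (n.+1%:R^-1) (ratr q) => h r q1 q2; lra.
  have [q1 Hq1] := pick x.1.1; have [q2 Hq2] := pick x.1.2.
  have [q3 Hq3] := pick x.2.
  exists (q1, q2, q3, n) => //= y [[/= y1 y2] y3].
  apply: xeU.
  by split; [split|]; apply: le_ball (ltW ne) _ _;
    apply: ball_triangle; try (apply: ball_sym; eassumption); eassumption.
rewrite bigcup_mkcond; apply: countable_bigcupT_measurable => [|q].
  exact: countableP.
case: ifP => // _; rewrite /box.
by do 2?apply: measurableX => //; exact: measurable_ball.
Qed.

Lemma continuous3_measurable (R : realType) (phi : R * R * R -> R) :
  continuous phi ->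
  measurable_fun setT
    (phi : measurableTypeR R * measurableTypeR R * measurableTypeR R -> R).
Proof.
move=> cphi; apply: (measurability _ (RGenOInfty.measurableE R)) => //.
move=> /= _ [_ [a ->] <-]; rewrite setTI; apply: open3_measurable.
by apply: open_comp => [x _|]; [exact: cphi|exact: interval_open].
Qed.

Lemma enorm3_continuous (R : realType) : continuous (@enorm3 R).
Proof.
move=> x; rewrite (_ : enorm3 = (@Num.sqrt R) \o
    (fun x : R * R * R => x.1.1 ^+ 2 + x.1.2 ^+ 2 + x.2 ^+ 2)); last first.
  by apply/funext => y; rewrite enorm3E.
apply: continuous_comp; last exact: sqrt_continuous.
have c1 : {for x, continuous (fun x : R * R * R => x.1.1)}.
  by apply: (@continuous_comp _ _ _ fst fst); exact: cvg_fst.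
have c2 : {for x, continuous (fun x : R * R * R => x.1.2)}.
  by apply: (@continuous_comp _ _ _ fst snd); [exact: cvg_fst|exact: cvg_snd].
have c3 : {for x, continuous (fun x : R * R * R => x.2)} by exact: cvg_snd.
have sq (h : R * R * R -> R) : {for x, continuous h} ->
    {for x, continuous (fun y => h y ^+ 2)}.
  move=> ch; apply: (@continuous_comp _ _ _ h (fun t : R => t ^+ 2)) => //.
  exact: exprn_continuous.
by apply: cvgD; [apply: cvgD|]; exact: sq.
Qed.

Lemma measurable_enorm3 (R : realType) :
  measurable_fun setT (@enorm3 R :
    measurableTypeR R * measurableTypeR R * measurableTypeR R -> R).
Proof. by apply: continuous3_measurable; exact: enorm3_continuous. Qed.

Lemma enorm3_scale (R : realType) (c : R) (x : R * R * R) : 0 <= c ->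
  enorm3 (c * x.1.1, c * x.1.2, c * x.2) = c * enorm3 x.
Proof.
move=> c0; rewrite !enorm3E/= !exprMn -!mulrDr sqrtrM ?sqr_ge0//.
by rewrite sqrtr_sqr ger0_norm.
Qed.

Lemma finite_itv_measure_unique (R : realType)
    (mu nu : {measure set (measurableTypeR R) -> \bar R}) :
  (forall a b : R, a < b -> (mu `]a, b]%classic < +oo)%E) ->
  (forall a b : R, a < b -> mu `]a, b]%classic = nu `]a, b]%classic) ->
  forall A, measurable A -> mu A = nu A.
Proof.
move=> mu_fin munu A mA.
have n0 (n : nat) : - (n.+1%:R : R) < n.+1%:R by rewrite gtrN.
have H := @measure_unique _ R (measurableTypeR R) (@ocitv R)
  (fun n => `](- n.+1%:R)%R, n.+1%:R]%classic).
apply: H => //.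
- exact: ocitvI.
- by move=> n; exists (- n.+1%:R, n.+1%:R).
- apply/seteqP; split => // x _; exists (Num.bound `|x|) => //=.
  have xb : `|x| < (Num.bound `|x|).+1%:R.
    by rewrite (lt_le_trans (archi_boundP _))// ler_nat leqnSn.
  by rewrite in_itv/=; move: xb; rewrite ltr_norml => /andP[-> /ltW ->].
- move=> _ [[a b]] _ <-; have [ab|ba] := ltP a b; first exact: munu.
  by rewrite set_itv_ge ?measure0//= bnd_simp -leNgt.
- by move=> n; exact: mu_fin.
Qed.

(** * Polar coordinates for radial functions *)

Section polar_coordinates.
Context {R : realType}.
Local Notation T3 :=
  (measurableTypeR R * measurableTypeR R * measurableTypeR R)%type.

Let B (r : R) : set T3 := [set x | enorm3 x <= r].

Let mB r : measurable (B r).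
Proof.
rewrite (_ : B r = @enorm3 R @^-1` `]-oo, r]).
  by rewrite -[X in measurable X]setTI; exact: measurable_enorm3.
by apply/seteqP; split => x /=; rewrite in_itv.
Qed.

Let leb3_box (I J K : interval R) :
  leb3 (([set` I] `*` [set` J]) `*` [set` K] : set T3) =
  (lebesgue_measure [set` I] * lebesgue_measure [set` J] *
   lebesgue_measure [set` K])%E.
Proof.
transitivity (leb2 ([set` I] `*` [set` J]) * lebesgue_measure [set` K])%E.
  apply: (@product_measure1E _ _ _ _ _ (@leb2 R) (@lebesgue_measure R)) => //.
  exact: measurableX.
by congr (_ * _)%E; exact: product_measure1E.
Qed.

(** Equal to 4 pi / 3, but kept as a symbol: the proof relies on its being finite and positive. *)
Definition ball3_measure : R := fine (leb3 (B 1)).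

Lemma ball3_measure_fin : leb3 (B 1) = ball3_measure%:E.
Proof.
rewrite fineK// ge0_fin_numE//.
apply: (@le_lt_trans _ _ (leb3 ((`[-1, 1] `*` `[-1, 1]) `*` `[-1, 1]: set T3))).
  apply: le_measure; rewrite ?inE//; first by do 2?apply: measurableX.
  move=> x; rewrite /B/= => x1; have {x1} : enorm3 x ^+ 2 <= 1.
    by rewrite expr_le1// enorm3_ge0.
  rewrite sqr_enorm3 !in_itv/= => x1.
  have := sqr_ge0 x.1.1; have := sqr_ge0 x.1.2; have := sqr_ge0 x.2.
  by split; [split|]; apply/andP; split; nra.
by rewrite leb3_box !lebesgue_measure_itv/= !lte_fin ifT ?ltry//; lra.
Qed.

Lemma ball3_measure_gt0 : 0 < ball3_measure.
Proof.
rewrite -lte_fin -ball3_measure_fin.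
apply: (@lt_le_trans _ _ (leb3 ((`[0, 2^-1] `*` `[0, 2^-1]) `*` `[0, 2^-1]: set T3))).
  by rewrite leb3_box !lebesgue_measure_itv/= !lte_fin ifT ?lte_fin//; lra.
apply: le_measure; rewrite ?inE//; first by do 2?apply: measurableX.
move=> x /= [[]]; rewrite !in_itv/= => /andP[? ?] /andP[? ?] /andP[? ?].
rewrite /B/= -(@expr_le1 _ 2)// ?enorm3_ge0// sqr_enorm3; nra.
Qed.

(** The volume of the ball of radius r for r >= 0; for r < 0 the two cubic terms cancel and the
    value is 0, as it should be for an empty ball. *)
Let beta (r : R) := ball3_measure * ((r ^+ 3 + r * (r * `|r|)) / 2).

(** The derivative of [beta]: the area of the sphere of radius r, continued by 0 to negative r. *)
Definition radial_weight (r : R) : R :=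
  3 * ball3_measure * ((r ^+ 2 + r * `|r|) / 2).

Lemma radial_weightE r : 0 <= r -> radial_weight r = 3 * ball3_measure * r ^+ 2.
Proof. by move=> r0; rewrite /radial_weight ger0_norm//; lra. Qed.

Lemma radial_weight_ge0 r : 0 <= radial_weight r.
Proof.
rewrite mulr_ge0 ?mulr_ge0 ?(ltW ball3_measure_gt0)//.
by have [r0|r0] := leP 0 r; [rewrite ger0_norm//|rewrite ltr0_norm//]; nra.
Qed.

Lemma radial_weight_continuous : continuous radial_weight.
Proof.
move=> r; apply: cvgM; first exact: cvg_cst.
apply: cvgM; last exact: cvg_cst.
apply: cvgD; first exact: exprn_continuous.
by apply: cvgM => //; exact: norm_continuous.
Qed.

Lemma measurable_radial_weight : measurable_fun setT radial_weight.
Proof. by apply: continuous_measurable_fun; exact: radial_weight_continuous. Qed.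

Let is_derive_beta (r : R) : is_derive r 1 beta (radial_weight r).
Proof.
have d1 := is_derive1X 3 (is_derive_id r (1 : R)).
have d2 := is_derive1M (is_derive_id r (1 : R)) (is_derive_mulr_norm r).
have := is_derive1Z ball3_measure (is_derive1M (is_derive1D d1 d2)
   (is_derive_cst (2^-1 : R) r 1)) => /is_derive_eq; apply.
by rewrite /radial_weight/=; ring.
Qed.

Let leb3_B r : leb3 (B r) = (beta r)%:E.
Proof.
have [r0|r0|->] := ltgtP r 0.
- rewrite (_ : B r = set0) ?measure0; last first.
    apply/seteqP; split => // x; rewrite /B/= => xr.
    by have := le_lt_trans xr r0; rewrite ltNge enorm3_ge0.
  by rewrite /beta ltr0_norm//; congr EFin; ring.
- have /= := @leb3_scale R r^-1 (B 1) _ (mB 1).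
  rewrite invr_gt0 r0 invrK => /(_ isT); rewrite ball3_measure_fin.
  rewrite (_ : _ @^-1` _ = B r).
    by move=> ->; rewrite /beta gtr0_norm// -EFinM; congr EFin; lra.
  by apply/seteqP; split => x;
    rewrite /B/= enorm3_scale ?invr_ge0 ?(ltW r0)// ler_pdivrMl// mulr1.
- have -> : beta 0 = 0 by rewrite /beta; ring.
  apply/eqP; rewrite eq_le measure_ge0 andbT.
  (* The ball of radius 0 is the origin; the box around it is null because its first side is
     degenerate. *)
  apply: (@le_trans _ _ (leb3 ((`[0, 0] `*` `[0, 1]) `*` `[0, 1]: set T3))).
    apply: le_measure; rewrite ?inE//; first by do 2?apply: measurableX.
    move=> x; rewrite /B/= => x0; have {x0} : enorm3 x ^+ 2 = 0.
      by apply/eqP; rewrite sqrf_eq0 eq_le x0 enorm3_ge0.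
    rewrite sqr_enorm3 !in_itv/= => x0.
    have := sqr_ge0 x.1.1; have := sqr_ge0 x.1.2; have := sqr_ge0 x.2.
    by split; [split|]; apply/andP; split; nra.
  by rewrite leb3_box !lebesgue_measure_itv/= !lte_fin ltxx !mul0e.
Qed.

Let mw := measurable_radial_weight.

(** Both sides are measures in A that give ]a, b] the mass [beta b - beta a]: on the left as the
    volume of a shell, on the right by the fundamental theorem of calculus. No angular variable is
    involved. *)
Lemma enorm3_pushforward (A : set R) : measurable A ->
  leb3 (@enorm3 R @^-1` A) =
  (\int[lebesgue_measure]_(r in A) (radial_weight r)%:E)%E.
Proof.
move=> mA.
pose m1 : {measure set (measurableTypeR R) -> \bar R} :=
  pushforward (@leb3 R) (@enorm3 R : T3 -> measurableTypeR R).
have me : measurable_fun setT (@enorm3 R : T3 -> measurableTypeR R).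
  exact: measurable_enorm3.
pose m2 : {measure set (measurableTypeR R) -> \bar R} :=
  density_measure (@lebesgue_measure R) mw radial_weight_ge0.
have m2E a b : a < b -> m2 `]a, b]%classic = (beta b - beta a)%:E.
  move=> ab; rewrite /m2/= /density_measure integral_itv_obnd_cbnd.
    apply: integral_is_derive => //; first exact: ltW.
    by apply: continuous_subspaceT; exact: radial_weight_continuous.
  exact/measurable_EFinP/measurable_funTS.
have m1E a b : a < b ->
    leb3 (@enorm3 R @^-1` `]a, b]) = (beta b - beta a)%:E.
  move=> ab; rewrite (_ : _ @^-1` _ = B b `\` B a); last first.
    apply/seteqP; split => x; rewrite /B/= in_itv/=.
      by move=> /andP[ax xb]; split => //; apply/negP; rewrite -ltNge.
    by move=> [-> /negP]; rewrite -ltNge => ->.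
  rewrite measureD//; last by rewrite [X in (X < _)%E]leb3_B ltry.
  rewrite setIidr; first by rewrite EFinB; congr (_ - _)%E; exact: leb3_B.
  by move=> x /le_trans; apply; exact: ltW.
suff : m1 me A = m2 A by [].
apply: finite_itv_measure_unique => // a b ab; last by rewrite [LHS]m1E// m2E.
by rewrite [X in (X < _)%E]m1E// ltry.
Qed.

Lemma ge0_integral_radial (f : R -> \bar R) : (forall r, 0 <= f r)%E ->
  measurable_fun setT f ->
  (\int[leb3]_x f (enorm3 x) =
   \int[lebesgue_measure]_r (f r * (radial_weight r)%:E))%E.
Proof.
move=> f0 mf.
have me : measurable_fun setT (@enorm3 R : T3 -> measurableTypeR R).
  exact: measurable_enorm3.
rewrite -(ge0_integral_density lebesgue_measure mw radial_weight_ge0)//.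
transitivity (\int[pushforward (@leb3 R)
    (@enorm3 R : T3 -> measurableTypeR R)]_r f r)%E.
  by rewrite ge0_integral_pushforward.
by apply: eq_measure_integral => //= A mA _; exact: enorm3_pushforward.
Qed.

End polar_coordinates.

(** * Profiles and their radial extensions *)

Section radial_profiles.
Context {R : realType}.
Implicit Types (u v : R -> R) (P : R -> Prop).
Local Notation T3 :=
  (measurableTypeR R * measurableTypeR R * measurableTypeR R)%type.
Local Notation leb := (@lebesgue_measure R).
Local Notation Rpos := (`]0, +oo[%classic : set R).

Lemma ae_enorm3 P : {ae leb, forall r, 0 < r -> P r} ->
  {ae (@leb3 R), forall x, P (enorm3 x)}.
Proof.
move=> [N [mN N0 PN]].
have me : measurable_fun setT (@enorm3 R : T3 -> measurableTypeR R).
  exact: measurable_enorm3.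
(* The point 0 joins the exceptional set because the hypothesis says nothing there. *)
have mN0 : measurable (N `|` [set 0]) by apply: measurableU.
exists (@enorm3 R @^-1` (N `|` [set 0])); split.
- by rewrite -[X in measurable X]setTI; exact: me.
- rewrite enorm3_pushforward// null_set_integral//.
    apply/measurable_EFinP/measurable_funTS; exact: measurable_radial_weight.
  by apply: null_set_setU => //; exact: lebesgue_measure_set1.
- move=> x /= nP; have [e0|e0] := eqVneq (enorm3 x) 0; first by right.
  left; apply: PN => /= Pr; apply: nP; apply: Pr.
  by rewrite lt_neqAle eq_sym e0 enorm3_ge0.
Qed.

Lemma radial_ae_eq_leb3 u v : radial_ae_eq u v ->
  {ae (@leb3 R), forall x, radial u x = radial v x}.
Proof. exact: (@ae_enorm3 (fun r => u r = v r)). Qed.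

Lemma measurable_radial u : measurable_fun Rpos u ->
  measurable_fun setT (radial u : T3 -> R).
Proof.
(* The norm takes no negative value, so freezing the profile at [u 0] on ]-oo, 0] leaves its radial
   extension unchanged and makes it measurable on the whole line. *)
move=> mu; pose u' r := if 0 < r then u r else u 0.
have mu' : measurable_fun setT u'.
  rewrite (_ : setT = `]0, +oo[ `|` `]-oo, 0] :> set R); last first.
    apply/seteqP; split => // r _ /=; rewrite !in_itv/= andbT.
    by have [|] := ltP 0 r; [left|right].
  apply/measurable_funU => //; split.
    apply: eq_measurable_fun mu => r; rewrite inE/= in_itv/= andbT /u' => r0.
    by rewrite r0.
  apply: (eq_measurable_fun (cst (u 0))) => // r; rewrite inE/= in_itv/= /u'.
  by rewrite leNgt => /negbTE ->.
rewrite (_ : radial u = u' \o @enorm3 R).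
  by apply: measurableT_comp => //; exact: measurable_enorm3.
apply/funext => x; rewrite /radial/= /u'; case: ifPn => // /negP e0.
congr u; apply/eqP; rewrite eq_le enorm3_ge0 andbT leNgt; exact/negP.
Qed.

Lemma enorm3_axis (r : R) : enorm3 (r, 0, 0) = `|r|.
Proof. by rewrite enorm3E/= !expr0n/= !addr0 sqrtr_sqr. Qed.

(** The converse direction: [radial u] is restricted to the first axis along the measurable map r ->
    (r, 0, 0). *)
Lemma measurable_profile u : measurable_fun setT (radial u : T3 -> R) ->
  measurable_fun setT (fun r : R => u `|r|).
Proof.
move=> mu; pose i := fun r : measurableTypeR R => (r, 0, 0) : T3.
have mi : measurable_fun setT i.
  by apply/measurable_fun_pair => //; apply/measurable_fun_pair.
rewrite (_ : (fun r => _) = radial u \o i); first exact: measurableT_comp.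
by apply/funext => r; rewrite /= /radial enorm3_axis.
Qed.

Lemma measurable_profile_pos u : measurable_fun setT (radial u : T3 -> R) ->
  measurable_fun Rpos u.
Proof.
move=> /measurable_profile mu.
apply: (eq_measurable_fun (fun r : R => u `|r|)); last exact: measurable_funTS.
by move=> r; rewrite inE/= in_itv/= andbT => r0; rewrite gtr0_norm.
Qed.

Definition cube3 (n : R) : set T3 := (`[- n, n] `*` `[- n, n]) `*` `[- n, n].

Lemma cube3_compact n : compact (cube3 n : set (R * R * R)).
Proof.
by apply: compact_setX; [apply: compact_setX|]; exact: segment_compact.
Qed.

Lemma measurable_cube3 n : measurable (cube3 n).
Proof. by do 2?apply: measurableX. Qed.

Lemma enorm3_cube3 n (x : R * R * R) : enorm3 x <= n -> cube3 n x.
Proof.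
move=> xn; have n0 : 0 <= n by apply: le_trans xn; exact: enorm3_ge0.
have {xn} : enorm3 x ^+ 2 <= n ^+ 2.
  by rewrite ler_pXn2r// ?nnegrE ?enorm3_ge0.
rewrite sqr_enorm3 => xn.
have := sqr_ge0 x.1.1; have := sqr_ge0 x.1.2; have := sqr_ge0 x.2.
by split; [split|]; rewrite /= in_itv/=; apply/andP; split; nra.
Qed.

Lemma radial_loc_integrable_measurable u : radial_loc_integrable u ->
  measurable_fun setT (radial u : T3 -> R).
Proof.
move=> ui.
have -> : [set: T3] = \bigcup_n cube3 n%:R.
  apply/seteqP; split => // x _; exists (Num.bound (enorm3 x)) => //.
  by apply: enorm3_cube3; apply/ltW/archi_boundP; exact: enorm3_ge0.
apply/measurable_fun_bigcup => [n|n]; first exact: measurable_cube3.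
by apply/measurable_EFinP; exact: (measurable_int _ (ui _ (@cube3_compact n%:R))).
Qed.

Let ge0_integral_radial_pos (f : R -> \bar R) : (forall r, 0 <= f r)%E ->
  measurable_fun setT f ->
  (\int[leb3]_x f (enorm3 x) =
   \int[leb]_(r in `]0%R, +oo[) (f r * (radial_weight r)%:E))%E.
Proof.
move=> f0 mf; rewrite ge0_integral_radial// [RHS]integral_mkcond.
apply: eq_integral => r _; rewrite patchE; case: ifPn => //.
rewrite notin_setE/= in_itv/= andbT => /negP; rewrite -leNgt => r0.
rewrite /radial_weight ler0_norm// (_ : _ + _ = 0) ?mul0r ?mulr0 ?mule0//.
by ring.
Qed.

Lemma integral_radial u : measurable_fun setT (radial u : T3 -> R) ->
  (\int[leb3]_x (radial u x)%:E =
   \int[leb]_(r in `]0%R, +oo[) (u r * radial_weight r)%:E)%E.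
Proof.
move=> mu; pose u' (r : R) : R := u `|r|%R.
have mf : measurable_fun setT (EFin \o u').
  by apply/measurable_EFinP; exact: measurable_profile.
rewrite integralE [RHS]integralE; congr (_ - _)%E.
- transitivity (\int[@leb3 R]_x ((EFin \o u')^\+ (enorm3 x)))%E.
    by apply: eq_integral => x _; rewrite !funeposE/= /u' ger0_norm// enorm3_ge0.
  rewrite ge0_integral_radial_pos//; last exact: measurable_funepos.
  apply: eq_integral => r; rewrite inE/= in_itv/= andbT => r0.
  transitivity (Num.max (u r) 0 * radial_weight r)%:E.
    by rewrite funeposE/= /u' gtr0_norm// -EFin_max -EFinM.
  by rewrite maxr_pMl ?radial_weight_ge0// mul0r funeposE -EFin_max.
- transitivity (\int[@leb3 R]_x ((EFin \o u')^\- (enorm3 x)))%E.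
    by apply: eq_integral => x _; rewrite !funenegE/= /u' ger0_norm// enorm3_ge0.
  rewrite ge0_integral_radial_pos//; last exact: measurable_funeneg.
  apply: eq_integral => r; rewrite inE/= in_itv/= andbT => r0.
  transitivity (Num.max (- u r) 0 * radial_weight r)%:E.
    by rewrite funenegE/= /u' gtr0_norm// -EFin_max -EFinM.
  by rewrite maxr_pMl ?radial_weight_ge0// mul0r mulNr funenegE -EFinN -EFin_max.
Qed.

Lemma Rintegral_radial u : measurable_fun setT (radial u : T3 -> R) ->
  \int[leb3]_x radial u x =
  \int[leb]_(r in `]0, +oo[) (u r * radial_weight r).
Proof. by move=> mu; rewrite /Rintegral integral_radial. Qed.

(** On [a, b] the weight is at least its value at a, so integrability over a cube of R^3 descends to
    the interval. The weight degenerates at the origin, hence the condition on a. *)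
Lemma radial_loc_integrable_itv u a b : 0 < a -> radial_loc_integrable u ->
  leb.-integrable `[a, b] (EFin \o u).
Proof.
move=> a0 ui; have mu := radial_loc_integrable_measurable ui.
have mupos := measurable_profile_pos mu.
have ab_sub : `[a, b] `<=` `]0, +oo[.
  by move=> r /=; rewrite !in_itv/= andbT => /andP[ar _]; exact: lt_le_trans ar.
have mab : measurable_fun `[a, b] u by exact: measurable_funS mupos.
apply/integrableP; split; first exact/measurable_EFinP.
pose c := radial_weight a.
have c0 : 0 < c.
  by rewrite /c radial_weightE ?(ltW a0)// !mulr_gt0// ?ball3_measure_gt0// exprn_gt0.
pose U := (fun r => `|u r|) \_ `[a, b].
have mU : measurable_fun setT (radial U : T3 -> R).
  apply: measurable_radial; apply: measurable_funTS.
  apply/(measurable_restrictT _ _).1 => //.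
  exact: measurableT_comp.
have : (\int[leb]_(r in `]0%R, +oo[) (U r * radial_weight r)%:E < +oo)%E.
  rewrite -integral_radial//.
  have /integrableP[_] := ui _ (@cube3_compact b).
  apply: le_lt_trans; rewrite [leRHS]integral_mkcond.
  apply: ge0_le_integral => //.
  - by move=> x _; rewrite lee_fin /radial /U patchE; case: ifP.
  - exact/measurable_EFinP.
  - apply/(measurable_restrictT _ _).1; first exact: measurable_cube3.
    apply/measurable_EFinP/measurable_funTS.
    exact: measurableT_comp.
  - move=> x _; rewrite !patchE; case: ifPn => xb.
      rewrite /radial /U patchE /=; case: ifP => // _.
      by rewrite lee_fin; exact: normr_ge0.
    rewrite lee_fin /radial /U patchE; case: ifPn => //.
    rewrite inE/= in_itv/= => /andP[_ xb']; move: xb; rewrite notin_setE.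
    by move=> /(_ (enorm3_cube3 xb')).
move=> Uoo; suff : (c%:E * \int[leb]_(r in `[a, b]) `|(EFin \o u) r| < +oo)%E.
  move=> cI; rewrite ltNge leye_eq; apply/negP => /eqP I.
  by move: cI; rewrite I gt0_muley ?lte_fin// ltxx.
apply: le_lt_trans Uoo; rewrite -ge0_integralZl//; last 2 first.
- by do 2 apply: measurableT_comp => //.
- by rewrite lee_fin ltW.
have mUw : measurable_fun Rpos (fun r => (U r * radial_weight r)%:E).
  apply/measurable_EFinP/measurable_funM.
    exact: measurable_profile_pos.
  by apply: measurable_funTS; exact: measurable_radial_weight.
have Uw0 r : (0 <= (U r * radial_weight r)%:E)%E.
  rewrite lee_fin mulr_ge0 ?radial_weight_ge0// /U patchE.
  by case: ifP.
apply: (@le_trans _ _ (\int[leb]_(r in `[a, b]) (U r * radial_weight r)%:E)%E).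
  apply: ge0_le_integral => //.
  - by move=> r _; rewrite mule_ge0 ?lee_fin ?(ltW c0).
  - by apply: measurable_funeM; do 2 apply: measurableT_comp => //.
  - exact: measurable_funS mUw.
  - move=> r rab; rewrite /U patchE mem_set//= lee_fin mulrC ler_wpM2l//.
    move: rab; rewrite /= in_itv/= => /andP[ar _].
    rewrite /c !radial_weightE ?(le_trans (ltW a0))// ?(ltW a0)//.
    rewrite ler_wpM2l ?mulr_ge0 ?(ltW ball3_measure_gt0)//.
    by rewrite ler_pXn2r// nnegrE ?(le_trans (ltW a0))// ltW.
by apply: ge0_subset_integral.
Qed.

End radial_profiles.

(** * Weak derivatives on the half-line *)

Section test_functions.
Context {R : realType}.
Implicit Types (i j : 'I_3) (x : R * R * R).
Local Notation T3 :=
  (measurableTypeR R * measurableTypeR R * measurableTypeR R)%type.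

Lemma is_derive_line (V W : normedModType R) (f : V -> W) (x v : V) (t : R) a :
  is_derive t 1 (fun s : R => f (s *: v + x)) a <->
  is_derive (t *: v + x) v f a.
Proof.
pose D1 h := h^-1 *: (((fun s : R => f (s *: v + x)) \o shift t) (h *: 1) -
  f (t *: v + x)).
pose D2 (h : R) := h^-1 *: ((f \o shift (t *: v + x)) (h *: v) - f (t *: v + x)).
have E : D1 = D2.
  apply/funext => h; rewrite /D1 /D2 /= /shift.
  by rewrite scaler1 scalerDl addrA.
split=> -[d1 d2].
- apply: DeriveDef; first by move: d1; rewrite /derivable -/D1 E.
  by move: d2; rewrite /derive -/D1 E.
- apply: DeriveDef; first by move: d1; rewrite /derivable -/D2 -E.
  by move: d2; rewrite /derive -/D2 -E.
Qed.

Lemma coord3_line i j (h : R) x :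
  coord3 j (h *: basis3 i + x) = h * (i == j)%:R + coord3 j x.
Proof.
case: i j => [[|[|[|//]]] ?] [[|[|[|//]]] ?];
  by rewrite /coord3 /basis3/= /GRing.scale/=.
Qed.

Lemma enorm3_sum x : enorm3 x ^+ 2 = \sum_(i < 3) coord3 i x ^+ 2.
Proof. by rewrite sqr_sqrtr// sumr_ge0// => i _; rewrite sqr_ge0. Qed.

Lemma enorm3_line i (h : R) x :
  enorm3 (h *: basis3 i + x) ^+ 2 =
  enorm3 x ^+ 2 + 2 * h * coord3 i x + h ^+ 2.
Proof.
rewrite !enorm3_sum !big_ord_recr/= !big_ord0 !coord3_line.
by case: i => [[|[|[|//]]] ?]; rewrite /coord3/=; ring.
Qed.

Lemma coord3_continuous i : continuous (@coord3 R i).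
Proof.
move=> x; case: i => [[|[|[|//]]] ?]; rewrite /coord3/=.
- by apply: (@continuous_comp _ _ _ fst fst); exact: cvg_fst.
- by apply: (@continuous_comp _ _ _ fst snd); [exact: cvg_fst|exact: cvg_snd].
- exact: cvg_snd.
Qed.

Lemma coord3_differentiable i x : differentiable (@coord3 R i) x.
Proof.
have cfst (U V : normedModType R) : continuous (@fst U V).
  by move=> y; exact: cvg_fst.
have csnd (U V : normedModType R) : continuous (@snd U V).
  by move=> y; exact: cvg_snd.
have d1 (y : R * R * R) : differentiable (@fst (R * R)%type R) y.
  exact/linear_differentiable/cfst.
have d2 (y : R * R * R) : differentiable (@snd (R * R)%type R) y.
  exact/linear_differentiable/csnd.
have d3 (y : R * R) : differentiable (@fst R R) y.
  exact/linear_differentiable/cfst.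
have d4 (y : R * R) : differentiable (@snd R R) y.
  exact/linear_differentiable/csnd.
case: i => [[|[|[|//]]] ?].
- exact: (@differentiable_comp _ _ _ _ fst fst).
- exact: (@differentiable_comp _ _ _ _ fst snd).
- exact: d2.
Qed.

Lemma sqr_enorm3_differentiable x :
  differentiable (fun y : R * R * R => enorm3 y ^+ 2) x.
Proof.
rewrite (_ : (fun y => _) = \sum_(i < 3) (@coord3 R i * @coord3 R i)).
  by apply: differentiable_sum => i; apply: differentiableM;
    exact: coord3_differentiable.
by apply/funext => y; rewrite enorm3_sum fct_sumE.
Qed.

Lemma coord3_le_enorm3 i x : `|coord3 i x| <= enorm3 x.
Proof.
rewrite -(@ler_pXn2r _ 2) ?nnegrE ?enorm3_ge0// enorm3_sum.
by rewrite (bigD1 i)//= -normrX ger0_norm ?sqr_ge0// lerDl sumr_ge0// => k _;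
  rewrite sqr_ge0.
Qed.

Variables (xi dxi : R -> R) (n : R).
Hypotheses (xid : forall s : R, is_derive s 1 xi (dxi s)) (cdxi : continuous dxi).
Hypothesis xi0 : forall s, n ^+ 2 < s -> xi s = 0.

(** Composing with |x|^2 rather than |x| keeps the test function C^1 at the origin. *)
Let phi i x := coord3 i x * xi (enorm3 x ^+ 2).

Let phi_derive i j x : pderiv3 j (phi i) x =
  (j == i)%:R * xi (enorm3 x ^+ 2) +
  coord3 i x * (dxi (enorm3 x ^+ 2) * (2 * coord3 j x)).
Proof.
suff : is_derive x (basis3 j) (phi i) ((j == i)%:R * xi (enorm3 x ^+ 2) +
  coord3 i x * (dxi (enorm3 x ^+ 2) * (2 * coord3 j x))) by case.
have := @is_derive_line _ _ (phi i) x (basis3 j) 0.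
move=> /(_ ((j == i)%:R * xi (enorm3 x ^+ 2) +
  coord3 i x * (dxi (enorm3 x ^+ 2) * (2 * coord3 j x)))).
rewrite scale0r add0r => -[+ _]; apply.
rewrite (_ : (fun s => _) = fun s => (s * (j == i)%:R + coord3 i x) *
  xi (enorm3 x ^+ 2 + 2 * coord3 j x * s + s ^+ 2)); last first.
  by apply/funext => s; rewrite /phi coord3_line enorm3_line; congr (_ * xi _); ring.
have d1 : is_derive (0 : R) 1 (fun s : R => s * (j == i)%:R + coord3 i x)
    ((j == i)%:R).
  have /is_derive_eq := (is_derive1D (is_derive1M (is_derive_id (0 : R) (1 : R))
    (is_derive_cst ((j == i)%:R : R) 0 (1 : R)))
    (is_derive_cst (coord3 i x) 0 (1 : R))).
  by apply; rewrite mul1r mulr0 !addr0.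
have d2 : is_derive (0 : R) 1
    (fun s : R => enorm3 x ^+ 2 + 2 * coord3 j x * s + s ^+ 2)
    (2 * coord3 j x).
  have /is_derive_eq := (is_derive1D (is_derive1D (is_derive_cst (enorm3 x ^+ 2) 0 (1 : R))
   (is_derive1Z (2 * coord3 j x) (is_derive_id (0 : R) (1 : R))))
   (is_derive1X 2 (is_derive_id (0 : R) (1 : R)))).
  by apply; rewrite /= add0r !mulr1 expr1 mulr0 addr0.
have d3 := is_derive1_comp (xid _) d2.
have /is_derive_eq := is_derive1M d1 d3; apply.
rewrite /= mulr0 expr0n/= !addr0 mul0r add0r.
by ring.
Qed.

(** Only the diagonal derivatives are recorded: summed over i they give 3 xi(s) + 2 s xi'(s) with s
    = |x|^2, the divergence of the field x xi(|x|^2). *)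
Lemma radial_test_function i : test_function3 (phi i) /\
  forall x, pderiv3 i (phi i) x =
    xi (enorm3 x ^+ 2) + 2 * coord3 i x ^+ 2 * dxi (enorm3 x ^+ 2).
Proof.
split; last first.
  by move=> x; rewrite phi_derive eqxx mul1r; ring.
have dxiN x : differentiable (fun y : R * R * R => xi (enorm3 y ^+ 2)) x.
  apply: (@differentiable_comp _ _ _ _ (fun y : R * R * R => enorm3 y ^+ 2) xi).
    exact: sqr_enorm3_differentiable.
  by apply/derivable1_diffP; case: (xid (enorm3 x ^+ 2)).
have cN : continuous (fun y : R * R * R => enorm3 y ^+ 2).
  by move=> x; exact/differentiable_continuous/sqr_enorm3_differentiable.
have cdxiN : continuous (fun y : R * R * R => dxi (enorm3 y ^+ 2)).
  move=> x; apply: (@continuous_comp _ _ _ (fun y : R * R * R => enorm3 y ^+ 2) dxi).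
    exact: cN.
  exact: cdxi.
split.
- by move=> x; apply: differentiableM => //; exact: coord3_differentiable.
- move=> j; rewrite (_ : pderiv3 j (phi i) = fun x => (j == i)%:R * xi (enorm3 x ^+ 2) +
    coord3 i x * (dxi (enorm3 x ^+ 2) * (2 * coord3 j x))); last first.
    by apply/funext => x; rewrite phi_derive.
  move=> x; apply: cvgD.
    by apply: cvgM; [exact: cvg_cst|exact: differentiable_continuous].
  apply: cvgM; first exact: coord3_continuous.
  apply: cvgM; first exact: cdxiN.
  by apply: cvgM; [exact: cvg_cst|exact: coord3_continuous].
- exists (cube3 `|n|); first exact: cube3_compact.
  move=> x xn; rewrite /phi xi0 ?mulr0// ltNge; apply/negP => xn'.
  apply: xn; apply: enorm3_cube3.
  rewrite -(@ler_pXn2r _ 2) ?nnegrE ?enorm3_ge0//.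
  by rewrite -normrX ger0_norm// sqr_ge0.
Qed.

End test_functions.

Lemma integrable_loc_mul (R : realType) (u : R -> R) (g : R * R * R -> R)
    (M n : R) : radial_loc_integrable u ->
  measurable_fun setT
    (g : measurableTypeR R * measurableTypeR R * measurableTypeR R -> R) ->
  (forall x, `|g x| <= M) -> (forall x, ~ cube3 n x -> g x = 0) ->
  (@leb3 R).-integrable setT (fun x => (radial u x * g x)%:E).
Proof.
move=> ui mg gM g0.
have mu := radial_loc_integrable_measurable ui.
have := ui _ (@cube3_compact _ n) => uin.
have {}uin := integrable_norm uin.
have mc := @measurable_cube3 R n.
have H : (@leb3 R).-integrable (cube3 n) (fun x => (M * `|radial u x|)%:E).
  exact: (integrableZl mc M uin).
apply/integrableP; split.
  by apply/measurable_EFinP; exact: measurable_funM.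
have /integrableP[_] := (integrable_mkcond _ mc).1 H.
apply: le_lt_trans; apply: ge0_le_integral => //.
- by do 2 apply: measurableT_comp => //; exact: measurable_funM.
- apply: measurableT_comp => //; apply/(measurable_restrictT _ _).1 => //.
  by apply/measurable_EFinP/measurable_funM => //; apply/measurable_funTS/measurableT_comp.
- move=> x _; rewrite patchE; case: ifPn => xn.
    rewrite /= lee_fin normrM mulrC.
    apply: le_trans (ler_norm _).
    by apply: ler_wpM2r => //; exact: gM.
  by rewrite g0 ?mulr0 ?normr0// => /mem_set; exact/negP.
Qed.

(** * Bounds and supports of test functions *)

Section test_function_bounds.
Context {R : realType}.
Local Notation T3 :=
  (measurableTypeR R * measurableTypeR R * measurableTypeR R)%type.

Lemma cube3P (n : R) (x : R * R * R) :
  cube3 n x <-> [/\ `|x.1.1| <= n, `|x.1.2| <= n & `|x.2| <= n].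
Proof.
rewrite /cube3/= !in_itv/= !ler_norml; split.
  by move=> [[]]; split.
by move=> []; split.
Qed.

Lemma compact_sub_cube3 (K : set (R * R * R)) : compact K ->
  exists2 n, 0 <= n & K `<=` cube3 n.
Proof.
move=> /compact_bounded[M [Mr MK]]; exists (`|M| + 1).
  by rewrite addr_ge0.
move=> x Kx; have := MK (`|M| + 1).
rewrite (le_lt_trans (ler_norm M)) ?ltrDl// => /(_ isT x Kx) /= xM.
apply/cube3P; move: xM; rewrite !prod_normE/= !ge_max => /andP[/andP[]].
by split.
Qed.

Lemma open_notin_cube3 (n : R) : open (~` (cube3 n : set (R * R * R))).
Proof.
apply: closed_openC; apply: compact_closed; last exact: cube3_compact.
by apply: norm_hausdorff.
Qed.

Lemma continuous3_bounded (g : R * R * R -> R) (n : R) : continuous g ->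
  (forall x, ~ cube3 n x -> g x = 0) ->
  exists2 M, 0 <= M & forall x, `|g x| <= M.
Proof.
move=> cg g0.
have /compact_bounded[M [Mr Mg]] : compact (g @` (cube3 n : set (R * R * R))).
  by apply: continuous_compact (@cube3_compact _ n); exact: continuous_subspaceT.
exists (`|M| + 1); first by rewrite addr_ge0.
move=> x; have [xn|xn] := pselect (cube3 n x); last first.
  by rewrite g0// normr0 addr_ge0.
apply: Mg; last by exists x.
by rewrite (le_lt_trans (ler_norm M))// ltrDl.
Qed.

Lemma test_function3_bounds (phi : R * R * R -> R) : test_function3 phi ->
  exists n M, [/\ 0 <= n, forall x, `|phi x| <= M,
    forall i x, `|pderiv3 i phi x| <= M,
    forall x, ~ cube3 n x -> phi x = 0 &
    forall i x, ~ cube3 n x -> pderiv3 i phi x = 0].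
Proof.
move=> [dphi cphi [K cK K0]].
have [n n0 Kn] := compact_sub_cube3 cK; exists n.
have phi0 x : ~ cube3 n x -> phi x = 0.
  by move=> xn; apply: K0 => /Kn.
have dphi0 i x : ~ cube3 n x -> pderiv3 i phi x = 0.
  move=> xn.
  (* The complement of the cube is open, so phi vanishes in a neighbourhood of x and its derivatives
     vanish at x. *)
  have /near_eq_is_derive : \near x, cst (0 : R) x = phi x.
    near=> y; rewrite /cst phi0//; near: y.
    exact: (open_nbhs_nbhs (conj (@open_notin_cube3 n) xn)).
  by move=> /(_ (basis3 i) 0 (is_derive_cst _ _ _))[].
have cphi' : continuous phi by move=> x; exact: differentiable_continuous.
have [M M0 phiM] := continuous3_bounded cphi' phi0.
have [M1 M10 phiM1] := continuous3_bounded (cphi ord0) (dphi0 ord0).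
have [M2 M20 phiM2] := continuous3_bounded (cphi 1) (dphi0 1).
have [M3 M30 phiM3] := continuous3_bounded (cphi ord_max) (dphi0 ord_max).
exists (M + M1 + M2 + M3); split => //.
  by move=> x; rewrite (le_trans (phiM x))//; lra.
move=> i x; have [->|[->|->]] : i = ord0 \/ (i = 1 \/ i = ord_max).
    case: i => [[|[|[|//]]] ?]; [left|right;left|right;right]; exact/val_inj.
- by rewrite (le_trans (phiM1 x))//; lra.
- by rewrite (le_trans (phiM2 x))//; lra.
- by rewrite (le_trans (phiM3 x))//; lra.
Unshelve. all: by end_near. Qed.

Lemma direction3_le1 (i : 'I_3) (x : R * R * R) : `|coord3 i x / enorm3 x| <= 1.
Proof.
rewrite normrM normfV (ger0_norm (enorm3_ge0 x)).
(* At the origin the quotient is 0, because the inverse of 0 is 0. *)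
have [e0|e0] := eqVneq (enorm3 x) 0; first by rewrite e0 invr0 mulr0.
rewrite ler_pdivrMr ?mul1r ?coord3_le_enorm3//.
by rewrite lt_neqAle eq_sym e0 enorm3_ge0.
Qed.

Lemma measurable_direction3 (i : 'I_3) :
  measurable_fun setT ((fun x => coord3 i x / enorm3 x) : T3 -> R).
Proof.
apply: measurable_funM.
  by apply: continuous3_measurable; exact: coord3_continuous.
have : measurable_fun setT (radial GRing.inv : T3 -> R).
  apply: measurable_radial; apply: open_continuous_measurable_fun.
    exact: interval_open.
  move=> r; rewrite inE/= in_itv/= andbT => r0.
  by apply: inv_continuous; rewrite gt_eqF.
by [].
Qed.

End test_function_bounds.

Lemma Rintegral_sum d (T : measurableType d) (R : realType)
    (mu : {measure set T -> \bar R}) n (f : 'I_n -> T -> R) :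
  (forall i, mu.-integrable setT (fun x => (f i x)%:E)) ->
  mu.-integrable setT (fun x => (\sum_(i < n) f i x)%:E) /\
  \int[mu]_x (\sum_(i < n) f i x) = \sum_(i < n) \int[mu]_x f i x.
Proof.
elim: n f => [|n IH] f fi.
  split; first by under eq_fun do rewrite big_ord0; exact: integrable0.
  under eq_Rintegral do rewrite big_ord0.
  by rewrite big_ord0 Rintegral_cst// mul0r.
have [IHi IHe] := IH (fun i => f (widen_ord (leqnSn n) i)) (fun i => fi _).
split.
  under eq_fun do rewrite big_ord_recr/= EFinD.
  exact: (integrableD measurableT IHi (fi ord_max)).
under eq_Rintegral do rewrite big_ord_recr/=.
rewrite big_ord_recr/= -IHe.
exact: (RintegralD measurableT IHi (fi ord_max)).
Qed.

(** * From the weak gradient on R^3 to the half-line *)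

Section weak_derivative_on_half_line.
Context {R : realType}.
Local Notation T3 :=
  (measurableTypeR R * measurableTypeR R * measurableTypeR R)%type.
Local Notation leb := (@lebesgue_measure R).
Local Notation Rpos := (`]0, +oo[%classic : set R).
Variables (u v zeta dzeta : R -> R) (a b : R).
Hypotheses (a0 : 0 < a) (zetad : forall r : R, is_derive r 1 zeta (dzeta r)).
Hypotheses (cdzeta : continuous dzeta).
Hypothesis zeta0 : forall r, r < a \/ b < r -> zeta r = 0.
Hypothesis uv : weak_radial_derivative u v.

Let k : R := 3 * ball3_measure.

Let k0 : 0 < k. Proof. by rewrite /k mulr_gt0// ball3_measure_gt0. Qed.

Let dzeta0 r : r < a -> dzeta r = 0.
Proof.
move=> ra; have H : is_derive r 1 zeta 0.
  apply: (@is_derive1_near _ (cst 0)).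
  by near=> t; rewrite zeta0//; left; near: t; exact: lt_nbhsl.
by rewrite -(derive1_is_derive (zetad r)) (derive1_is_derive H).
Unshelve. all: by end_near. Qed.

Let czeta : continuous zeta.
Proof. by move=> r; exact: is_derive1_continuous (zetad r). Qed.

(* With this xi, div (x xi(|x|^2)) = zeta'(r) / (k r^2), where k r^2 is the
   area of the sphere of radius r. *)
Let xi s : R := zeta (Num.sqrt s) / (k * Num.sqrt s ^+ 3).
(** The derivative of [xi] at s = t^2, expressed through t. *)
Let D t : R := dzeta t / (2 * k * t ^+ 4) - 3 * zeta t / (2 * k * t ^+ 5).
Let dxi s : R := D (Num.sqrt s).

Let sqrt_lta s : s < a ^+ 2 -> Num.sqrt s < a.
Proof.
move=> sa; rewrite -[ltRHS](ger0_norm (ltW a0)) -sqrtr_sqr ltr_sqrt//.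
by rewrite exprn_gt0.
Qed.

Let dxi0 s : s < a ^+ 2 -> dxi s = 0.
Proof.
move/sqrt_lta => st; rewrite /dxi /D dzeta0// zeta0; last by left.
by rewrite mulr0 !mul0r subrr.
Qed.

Let xi_derive (s : R) : is_derive s 1 xi (dxi s).
Proof.
(* Below a^2 everything vanishes identically, so the singularities of the square root and of the
   quotient at 0 are never met. *)
have [sa|sa] := ltP s (a ^+ 2).
  rewrite dxi0//.
  apply: (@is_derive1_near _ (cst 0)); near=> t.
  rewrite /xi zeta0 ?mul0r//; left; apply: sqrt_lta; near: t; exact: lt_nbhsl.
have s0 : 0 < s by rewrite (lt_le_trans _ sa)// exprn_gt0.
have t0 : 0 < Num.sqrt s by rewrite sqrtr_gt0.
have d1 := is_derive1_comp (zetad (Num.sqrt s)) (is_derive1_sqrt s0).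
have d2 := is_derive1Z k (is_derive1X 3 (is_derive1_sqrt s0)).
have n0 : k * Num.sqrt s ^+ 3 != 0 by rewrite mulf_neq0 ?expf_neq0 ?gt_eqF.
have /is_derive_eq := is_derive1M d1
  (@is_derive1V _ (fun t => k * Num.sqrt t ^+ 3) _ _ n0 d2); apply.
by rewrite /dxi /D /=; field; rewrite !gt_eqF.
Unshelve. all: by end_near. Qed.

Let cdxi : continuous dxi.
Proof.
move=> s; have [sa|sa] := ltP s (a ^+ 2).
  suff /is_derive1_continuous : is_derive s 1 dxi 0 by [].
  apply: (@is_derive1_near _ (cst 0)); near=> t.
  by rewrite /cst dxi0//; near: t; exact: lt_nbhsl.
have s0 : 0 < s by rewrite (lt_le_trans _ sa)// exprn_gt0.
apply: (@continuous_comp _ _ _ (@Num.sqrt R) D).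
  exact: sqrt_continuous.
have t0 : 0 < Num.sqrt s by rewrite sqrtr_gt0.
have V n : {for Num.sqrt s, continuous (fun t : R => (2 * k * t ^+ n)^-1)}.
  have nz : 2 * k * Num.sqrt s ^+ n != 0.
    by apply: lt0r_neq0; apply: mulr_gt0; [exact: mulr_gt0|exact: exprn_gt0].
  have c : {for Num.sqrt s, continuous (fun t : R => 2 * k * t ^+ n)}.
    by apply: cvgM; [exact: cvg_cst|exact: exprn_continuous].
  exact: (cvgV nz c).
apply: cvgB; apply: cvgM; try exact: V; first exact: cdzeta.
by apply: cvgM; [exact: cvg_cst|exact: czeta].
Unshelve. all: by end_near. Qed.

Let xi0 s : b ^+ 2 < s -> xi s = 0.
Proof.
move=> bs; rewrite /xi zeta0 ?mul0r//; right.
have s0 : 0 < s by rewrite (le_lt_trans _ bs)// sqr_ge0.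
rewrite (le_lt_trans (ler_norm b))// -sqrtr_sqr ltr_sqrt//.
Qed.

Let phi i (x : R * R * R) := coord3 i x * xi (enorm3 x ^+ 2).

Let phiP i := @radial_test_function R xi dxi b xi_derive cdxi xi0 i.

Let phi_integrable (w : R -> R) (g : R * R * R -> R) i :
  radial_loc_integrable w ->
  measurable_fun setT (g : T3 -> R) -> (forall x, `|g x| <= 1) ->
  (@leb3 R).-integrable setT (fun x => (radial w x * (g x * phi i x))%:E) /\
  (@leb3 R).-integrable setT (fun x => (radial w x * pderiv3 i (phi i) x)%:E).
Proof.
move=> wi mg g1; have [tf _] := phiP i.
have [n [M [n0 pM dpM p0 dp0]]] := test_function3_bounds tf.
have [d c _] := tf.
have cphi : continuous (phi i) by move=> x; exact: differentiable_continuous.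
split; apply: (@integrable_loc_mul _ _ _ M n) => //.
- by apply: measurable_funM => //; exact: continuous3_measurable.
- by move=> x; rewrite normrM -[leRHS]mul1r; apply: ler_pM => //; exact: pM.
- by move=> x xn; rewrite /phi p0 ?mulr0.
- exact: continuous3_measurable.
- exact: dp0.
Qed.

(** Summing the three test identities makes both integrands radial. In polar coordinates the weight
    k r^2 then cancels the normalisation of [xi]: the factors become dzeta on the left and zeta on
    the right. *)
Lemma weak_radial_derivative_half_line :
  \int[leb]_(r in Rpos) (u r * dzeta r) =
  - \int[leb]_(r in Rpos) (v r * zeta r).
Proof.
have [ui vi E] := uv.
have Ei i : \int[leb3]_x (radial u x * pderiv3 i (phi i) x) =
    - \int[leb3]_x (radial v x * ((coord3 i x / enorm3 x) * phi i x)).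
  rewrite E; last by have [] := phiP i.
  by congr (- _); apply: eq_Rintegral => x _; rewrite -(mulrA (radial v x)).
have m1 : measurable_fun setT (cst 1 : T3 -> R) by [].
have n1 (x : R * R * R) : `|cst 1 x : R| <= 1 by rewrite /cst normr1.
have i1 i := (@phi_integrable u (cst 1) i ui m1 n1).2.
have i2 i := (phi_integrable i vi (@measurable_direction3 R i) (direction3_le1 i)).1.
pose U r := u r * (3 * xi (r ^+ 2) + 2 * r ^+ 2 * dxi (r ^+ 2)).
pose V r := v r * (r * xi (r ^+ 2)).
have UE : radial U = fun x => \sum_(i < 3) (radial u x * pderiv3 i (phi i) x).
  apply/funext => x; rewrite -mulr_sumr; congr (_ * _).
  under eq_bigr do rewrite (phiP _).2.
  rewrite big_split/= sumr_const card_ord -mulr_suml -mulr_sumr -enorm3_sum.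
  by rewrite mulr_natl.
have VE : radial V = fun x => \sum_(i < 3) (radial v x * ((coord3 i x / enorm3 x) * phi i x)).
  apply/funext => x; rewrite -mulr_sumr; congr (_ * _).
  transitivity (\sum_(i < 3) (coord3 i x ^+ 2 * (xi (enorm3 x ^+ 2) / enorm3 x))).
    rewrite -mulr_suml -enorm3_sum.
    have [e0|e0] := eqVneq (enorm3 x) 0; first by rewrite e0 !mul0r expr0n/= mul0r.
    by field.
  by apply: eq_bigr => i _; rewrite /phi; ring.
have [iU intU] := Rintegral_sum i1; have [iV intV] := Rintegral_sum i2.
have mU : measurable_fun setT (radial U : T3 -> R).
  by apply/measurable_EFinP; rewrite UE; exact: measurable_int iU.
have mV : measurable_fun setT (radial V : T3 -> R).
  by apply/measurable_EFinP; rewrite VE; exact: measurable_int iV.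
have : \int[leb3]_x radial U x = - \int[leb3]_x radial V x.
  by rewrite UE VE intU intV -sumrN; apply: eq_bigr => i _.
rewrite !Rintegral_radial// => UV.
transitivity (\int[leb]_(r in Rpos) (U r * radial_weight r)).
  apply: eq_Rintegral => r; rewrite inE/= in_itv/= andbT => r0.
  rewrite radial_weightE ?(ltW r0)// /U /xi /dxi /D sqrtr_sqr gtr0_norm//.
  by rewrite -/k; field; rewrite !gt_eqF.
rewrite UV; congr (- _).
apply: eq_Rintegral => r; rewrite inE/= in_itv/= andbT => r0.
rewrite radial_weightE ?(ltW r0)// /V /xi sqrtr_sqr gtr0_norm//.
by rewrite -/k; field; rewrite !gt_eqF.
Qed.

End weak_derivative_on_half_line.

Section real_integrable.
Context d (T : measurableType d) (R : realType) (mu : {measure set T -> \bar R}).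
Variables (D : set T) (mD : measurable D).
Implicit Types f g : T -> R.

Lemma integrable_scale (k : R) f : mu.-integrable D (EFin \o f) ->
  mu.-integrable D (EFin \o (fun x => k * f x)).
Proof. by move=> fi; exact: (integrableZl mD k fi). Qed.

Lemma integrable_add f g : mu.-integrable D (EFin \o f) ->
  mu.-integrable D (EFin \o g) -> mu.-integrable D (EFin \o (fun x => f x + g x)).
Proof. by move=> fi gi; exact: (integrableD mD fi gi). Qed.

Lemma integrable_sub f g : mu.-integrable D (EFin \o f) ->
  mu.-integrable D (EFin \o g) -> mu.-integrable D (EFin \o (fun x => f x - g x)).
Proof. by move=> fi gi; exact: (integrableB mD fi gi). Qed.

Lemma integrable_mulr_bounded f g (M : R) : mu.-integrable D (EFin \o f) ->
  measurable_fun D g -> (forall x, `|g x| <= M) ->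
  mu.-integrable D (EFin \o (fun x => f x * g x)).
Proof.
move=> fi mg gM; have := @integrableMl _ _ _ mu D mD (EFin \o f) g fi mg; apply.
exists M; split; first exact: num_real.
by move=> x Mx r _ /=; rewrite (le_trans (gM r))// ltW.
Qed.

End real_integrable.

(** * Cut-offs and approximate identities *)

Section tents.
Context {R : realType}.
Local Notation leb := (@lebesgue_measure R).
Implicit Types (t r a b c : R) (u v : R -> R).

(** The hat function max(0, 1 - |t|), written as a second difference of |t|; its primitive is then a
    second difference of t|t|. *)
Definition tent t : R := (`|t + 1| - 2 * `|t| + `|t - 1|) / 2.

(* A C^1 primitive of [tent], with values -1/2 on ]-oo, -1] and 1/2 on [1, +oo[:
   ramp (n (r - a)) - ramp (n (r - b)) is a C^1 cutoff to [a, b]. *)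
Definition ramp t : R :=
  ((t + 1) * `|t + 1| - 2 * (t * `|t|) + (t - 1) * `|t - 1|) / 4.

Lemma ramp_derive t : is_derive t 1 ramp (tent t).
Proof.
have D (k : R) : is_derive t 1 (fun s : R => (s + k) * `|s + k|) (2 * `|t + k|).
  have d0 : is_derive t 1 (fun s : R => s + k) 1.
    have := is_derive1D (is_derive_id t (1 : R)) (is_derive_cst k t (1 : R)).
    by rewrite addr0.
  by have /is_derive_eq := @is_derive1_comp _ (fun s : R => s * `|s|) (fun s : R => s + k) _ _ _
    (is_derive_mulr_norm (t + k)) d0;
    apply; rewrite mulr1.
have /is_derive_eq := is_derive1Z 4^-1 (is_derive1D (is_derive1B (D 1)
  (is_derive1Z 2 (is_derive_mulr_norm t))) (D (-1))).
rewrite (_ : (fun s => 4^-1 * _) = ramp); last first.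
  by apply/funext => s; rewrite /ramp mulrC.
by apply; rewrite /tent; field.
Qed.

Lemma tent_continuous : continuous tent.
Proof.
move=> t; have c k : {for t, continuous (fun s : R => `|s + k|)}.
  apply: (@continuous_comp _ _ _ (fun s : R => s + k) Num.norm).
    by apply: cvgD; [exact: cvg_id|exact: cvg_cst].
  exact: norm_continuous.
apply: cvgM; last exact: cvg_cst.
apply: cvgD; last exact: c.
apply: cvgB; first exact: c.
by apply: cvgM; [exact: cvg_cst|exact: norm_continuous].
Qed.

Lemma tent_ge0 t : 0 <= tent t.
Proof.
rewrite /tent; case: (ger0P (t + 1)); case: (ger0P t); case: (ger0P (t - 1)); lra.
Qed.

Lemma tent_le1 t : tent t <= 1.
Proof.
rewrite /tent; case: (ger0P (t + 1)); case: (ger0P t); case: (ger0P (t - 1)); lra.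
Qed.

Lemma tent_out t : 1 <= `|t| -> tent t = 0.
Proof.
rewrite /tent; case: (ger0P (t + 1)); case: (ger0P t); case: (ger0P (t - 1)); lra.
Qed.

Lemma ramp_ge1 t : 1 <= t -> ramp t = 2^-1.
Proof. by move=> t1; rewrite /ramp !ger0_norm; [field|lra..]. Qed.

Lemma ramp_leN1 t : t <= -1 -> ramp t = - 2^-1.
Proof. by move=> t1; rewrite /ramp !ler0_norm; [field|lra..]. Qed.

Lemma ramp_nondecreasing t1 t2 : t1 <= t2 -> ramp t1 <= ramp t2.
Proof.
move=> t12; apply: (is_derive_ge0_le t12) => x _; first exact: ramp_derive.
exact: tent_ge0.
Qed.

Lemma ramp0 : ramp 0 = 0.
Proof.
rewrite /ramp !(add0r, normrN, normr1, mul0r, mulr0, subr0, mulN1r, mul1r).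
by rewrite subrr mul0r.
Qed.

Lemma ramp_bound t : - 2^-1 <= ramp t <= 2^-1.
Proof.
apply/andP; split.
  rewrite -(@ramp_leN1 (Num.min t (-1))) ?ge_min ?lexx ?orbT//.
  by rewrite ramp_nondecreasing// ge_min lexx.
rewrite -(@ramp_ge1 (Num.max t 1)) ?le_max ?lexx ?orbT//.
by rewrite ramp_nondecreasing// le_max lexx.
Qed.

Lemma ramp_scale_derive (n c r : R) :
  is_derive r 1 (fun s => ramp (n * (s - c))) (n * tent (n * (r - c))).
Proof.
have d0 : is_derive r 1 (fun s : R => n * (s - c)) n.
  have /is_derive_eq := is_derive1Z n
    (is_derive1B (is_derive_id r (1 : R)) (is_derive_cst c r (1 : R))); apply.
  by rewrite subr0 mulr1.
by have /is_derive_eq := @is_derive1_comp _ ramp (fun s : R => n * (s - c)) _ _ _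
    (ramp_derive (n * (r - c))) d0;
  apply; rewrite mulrC.
Qed.

Lemma tent_scale_continuous (n c : R) :
  continuous (fun r => n * tent (n * (r - c))).
Proof.
move=> r; apply: cvgM; first exact: cvg_cst.
apply: (@continuous_comp _ _ _ (fun r => n * (r - c)) tent).
  apply: cvgM; first exact: cvg_cst.
  by apply: cvgB; [exact: cvg_id|exact: cvg_cst].
exact: tent_continuous.
Qed.

(** The scaled tent has mass 1, is at most N = n + 1 and lives on the ball of radius 1/N around c.
    The error is therefore at most twice the mean of |u - u(c)| over that ball, which tends to 0 at
    a Lebesgue point. *)
Lemma tent_integral_cvg u al be c : al < c < be ->
  leb.-integrable `[al, be] (EFin \o u) -> lebesgue_pt (u \_ `[al, be]) c ->
  \int[leb]_(r in `[al, be]) (u r * (n.+1%:R * tent (n.+1%:R * (r - c))))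
    @[n --> \oo] --> u c.
Proof.
move=> /andP[alc cbe] ui; set g := u \_ _; set I := `[al, be]%classic => Lc.
have mI : measurable (I : set (measurableTypeR R)) by exact: measurable_itv.
have h0 n : 0 < n.+1%:R^-1 :> R by rewrite invr_gt0.
have Ic : I c by rewrite /I /= in_itv/= !ltW.
have hcvg : (fun n => n.+1%:R^-1 : R) @ \oo --> (0 : R).
  exact: cvg_harmonic.
have {}Lc : (davg g c n.+1%:R^-1) @[n --> \oo] --> 0%E.
  apply: cvg_comp Lc => P [e /= e0 eP].
  have /cvgrPdist_lt /(_ _ e0) := hcvg; apply: filterS => n /= nP.
  by apply: eP => //=; rewrite distrC; rewrite distrC in nP.
move: Lc => /fine_cvgP[fin /cvgrPdist_le Lc].
have Nlt d : 0 < d -> \forall n \near \oo, n.+1%:R^-1 < d :> R.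
  move=> d0; have /cvgrPdist_lt /(_ _ d0) := hcvg; apply: filterS => n'.
  by rewrite sub0r normrN gtr0_norm.
apply/cvgrPdist_le => e e0; near=> n.
have Nal : n.+1%:R^-1 < c - al by near: n; apply: Nlt; rewrite subr_gt0.
have Nbe : n.+1%:R^-1 < be - c by near: n; apply: Nlt; rewrite subr_gt0.
have fn : davg g c n.+1%:R^-1 \is a fin_num by near: n.
have fe : `|0 - fine (davg g c n.+1%:R^-1)| <= e / 2.
  by near: n; apply: Lc; rewrite divr_gt0.
set N : R := n.+1%:R; have N0 : 0 < N by rewrite ltr0n.
pose k r := N * tent (N * (r - c)).
have k0 r : 0 <= k r by rewrite mulr_ge0 ?tent_ge0// ltW.
have kN r : `|k r| <= N by rewrite ger0_norm// ler_piMr ?tent_le1// ltW.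
have ck : continuous k by exact: tent_scale_continuous.
have ki : leb.-integrable I (EFin \o k).
  apply: continuous_compact_integrable; first exact: segment_compact.
  exact: continuous_subspaceT.
have ball_sub : ball c N^-1 `<=` I.
  move=> r; rewrite /ball/= ltr_distlC => /andP[r1 r2].
  have H1 : al <= r by rewrite ltW// (lt_trans _ r1)// ltrBrDr -ltrBrDl.
  have H2 : r <= be by rewrite ltW// (lt_trans r2)// -ltrBrDl.
  by rewrite /I /= in_itv/= H1.
have tN r : 1 <= N * `|r - c| -> k r = 0.
  by move=> H; rewrite /k tent_out ?mulr0// normrM gtr0_norm.
have kint : \int[leb]_(r in I) k r = 1.
  have [ralc rcbe] : 1 <= N * (c - al) /\ 1 <= N * (be - c).
    by rewrite -!ler_pdivrMl// !mulr1 !(ltW Nal, ltW Nbe).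
  have albe : al <= be by rewrite (le_trans (ltW alc))// ltW.
  have H := @integral_is_derive _ (fun s => ramp (N * (s - c))) k al be albe
    (fun x _ => ramp_scale_derive N c x) (continuous_subspaceT ck).
  rewrite /Rintegral H/= ramp_ge1// ramp_leN1; last by lra.
  by field.
have mk : measurable_fun (I : set (measurableTypeR R)) k.
  by apply: measurable_funTS; exact: continuous_measurable_fun.
have uki := integrable_mulr_bounded mI ui mk kN.
pose w r := (u r - u c) * k r.
have ucki : leb.-integrable I (EFin \o (fun r => u c * k r)).
  exact: integrable_scale.
have wE : \int[leb]_(r in I) w r = \int[leb]_(r in I) (u r * k r) - u c.
  rewrite -[X in _ - X]mulr1 -kint -RintegralZl// -RintegralB//.
  by apply: eq_Rintegral => r _; rewrite /w mulrBl.
have wi : leb.-integrable I (EFin \o w).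
  rewrite (_ : w = (fun r => u r * k r - u c * k r)).
    exact: integrable_sub.
  by apply/funext => r; rewrite /w mulrBl.
rewrite distrC -wE -lee_fin.
have le1 : ((`|\int[leb]_(r in I) w r|)%:E <= \int[leb]_(r in I) `|w r|%:E)%E.
  rewrite EFin_normr_Rintegral//; apply: le_abse_integral => //.
  exact: measurable_int wi.
apply: (le_trans le1).
have -> : (\int[leb]_(r in I) `|w r|%:E = \int[leb]_(r in ball c N^-1) `|w r|%:E)%E.
  rewrite integral_mkcond [RHS]integral_mkcond; apply: eq_integral => r _.
  rewrite /patch; case: ifPn => rI; case: ifPn => rb //.
    rewrite /w tN ?mulr0 ?normr0//.
    by move: rb; rewrite notin_setE /ball/= => /negP; rewrite -leNgt distrC -ler_pdivrMl// mulr1.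
  by move: rI; rewrite notin_setE; move: rb; rewrite inE => /ball_sub.
have mb : measurable (ball c N^-1 : set (measurableTypeR R)) by exact: measurable_ball.
pose z r : R := `|g r - g c|.
have mz : measurable_fun (setT : set (measurableTypeR R)) z.
  apply: measurableT_comp => //; apply: measurable_funB => //.
  apply: (measurable_restrictT _ mI).1.
  by apply/measurable_EFinP; exact: measurable_int ui.
have le2 : (\int[leb]_(r in ball c N^-1) `|w r|%:E <=
  \int[leb]_(r in ball c N^-1) (N%:E * (z r)%:E))%E.
  apply: ge0_le_integral => //.
  - apply/measurable_EFinP/measurableT_comp => //.
    apply: measurable_funS mI ball_sub _.
    by apply/measurable_EFinP; exact: measurable_int wi.
  - apply/measurable_EFinP; apply: measurable_funM => //.
    exact: measurable_funTS.
  - move=> r rb; rewrite -EFinM lee_fin /w /z normrM mulrC.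
    have rI := ball_sub _ rb.
    by rewrite /g /patch !mem_set// ler_wpM2r.
apply: (le_trans le2).
rewrite ge0_integralZl_EFin//; last 2 first.
- by move=> r _; rewrite lee_fin /z normr_ge0.
- by apply/measurable_EFinP; exact: measurable_funTS.
have -> : (N%:E * \int[leb]_(r in ball c N^-1) (z r)%:E = 2%:E * davg g c N^-1)%E.
  rewrite /davg /iavg lebesgue_measure_ball ?invr_ge0 ?ltW//.
  rewrite inver mulrn_eq0/= invr_eq0 gt_eqF// muleA -EFinM.
  by congr (_%:E * _)%E; field; rewrite gt_eqF.
move: fe; rewrite sub0r normrN -/N => fe.
rewrite -(fineK fn) -EFinM lee_fin.
by have := ler_norm (fine (davg g c N^-1)); lra.
Unshelve. all: by end_near. Qed.

End tents.

Lemma Rintegral_dominated_cvg d (T : measurableType d) (R : realType)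
    (mu : {measure set T -> \bar R}) (D : set T) (f_ : nat -> T -> R) (f g : T -> R) :
  measurable D -> (forall n, measurable_fun D (f_ n)) ->
  (forall x, D x -> f_ n x @[n --> \oo] --> f x) ->
  mu.-integrable D (EFin \o g) -> (forall n x, D x -> `|f_ n x| <= g x) ->
  mu.-integrable D (EFin \o f) /\
  \int[mu]_(x in D) f_ n x @[n --> \oo] --> \int[mu]_(x in D) f x.
Proof.
move=> mD mf_ f_f gi f_g.
have mf : measurable_fun D f by exact: (measurable_fun_cvg mf_ f_f).
have [] := @dominated_convergence _ _ _ mu D mD (fun n => EFin \o f_ n) (EFin \o f)
  (EFin \o g).
- by move=> n; apply/measurable_EFinP.
- exact/measurable_EFinP.
- by apply: aeW => x Dx; apply: cvg_EFin; [exact: nearW|exact: f_f].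
- exact: gi.
- by apply: aeW => x n Dx; rewrite /= lee_fin f_g.
move=> fi _ H; split => //.
have E : (\int[mu]_(x in D) (f x)%:E = (\int[mu]_(x in D) f x)%:E)%E.
  by rewrite /Rintegral fineK// integrable_fin_num.
by move: H; rewrite E => /fine_cvgP[_].
Qed.

Lemma Rintegral_sub_support d (T : measurableType d) (R : realType)
    (mu : {measure set T -> \bar R}) (A B : set T) (f : T -> R) :
  A `<=` B -> (forall x, B x -> ~ A x -> f x = 0) ->
  \int[mu]_(x in B) f x = \int[mu]_(x in A) f x.
Proof.
move=> AB f0; rewrite Rintegral_mkcond [RHS]Rintegral_mkcond.
apply: eq_Rintegral => x _; rewrite /patch; case: ifPn => xB; case: ifPn => xA //.
  by rewrite f0//; [exact: set_mem|move/mem_set; rewrite (negbTE xA)].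
by move: xB; rewrite (mem_set (AB _ (set_mem xA))).
Qed.

(** * Continuous representatives and uniqueness of the weak derivative *)

Section weak_derivative_primitive.
Context {R : realType}.
Local Notation leb := (@lebesgue_measure R).
Local Notation MR := (measurableTypeR R).
Local Notation Rpos := (`]0, +oo[%classic : set R).
Implicit Types (a b c r t : R) (u v : R -> R).

Lemma Rintegral_itv_add v a b c : a <= b <= c ->
  leb.-integrable `[a, c] (EFin \o v) ->
  \int[leb]_(r in `[a, c]) v r =
  \int[leb]_(r in `[a, b]) v r + \int[leb]_(r in `[b, c]) v r.
Proof.
move=> /andP[ab bc] vi.
have H := @Rintegral_itvB _ v (BLeft a) (BRight c) b vi.
rewrite !bnd_simp in H; have {}H := H ab bc.
have -> : \int[leb]_(r in `[b, c]) v r = \int[leb]_(r in `]b, c]) v r.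
  rewrite Rintegral_itv_obnd_cbnd//.
  apply: integrableS vi => // r /=; rewrite !in_itv/= => /andP[br ->].
  by rewrite andbT (le_trans ab)// ltW.
by rewrite -H addrC subrK.
Qed.

Lemma Rintegral_itv_oo_cc v a b : leb.-integrable `[a, b] (EFin \o v) ->
  \int[leb]_(r in `]a, b[) v r = \int[leb]_(r in `[a, b]) v r.
Proof.
move=> vi; rewrite Rintegral_itv_obnd_cbnd; last first.
  apply: integrableS vi => // r /=; rewrite !in_itv/= => /andP[ar rb].
  by rewrite !ltW.
rewrite Rintegral_itv_bndo_bndc//.
apply: integrableS vi => // r /=; rewrite !in_itv/= => /andP[-> rb].
by rewrite ltW.
Qed.

Lemma ae_dense (P : R -> Prop) a b : 0 <= a < b ->
  {ae leb, forall r, 0 < r -> P r} -> exists2 c, a < c < b & P c.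
Proof.
move=> /andP[a0 ab] [N [mN N0 PN]]; apply: contrapT => nP.
have : (leb `]a, b[ <= leb N)%E.
  apply: le_measure; rewrite ?inE//.
  move=> r /=; rewrite in_itv/= => rab; apply: PN => /= Pr; apply: nP.
  by exists r => //; apply: Pr; case/andP: rab => + _; exact: le_lt_trans.
by rewrite N0 lebesgue_measure_itv/= lte_fin ab -EFinB lee_fin subr_le0 leNgt ab.
Qed.

Lemma ramp_cvg t : ramp (n.+1%:R * t) @[n --> \oo] --> Num.sg t / 2.
Proof.
have H (s : R) : 0 < s -> \forall n \near \oo, 1 <= n.+1%:R * s.
  move=> s0; have /cvgrPdist_lt /(_ _ s0) := @cvg_harmonic R.
  apply: filterS => n; rewrite sub0r normrN /harmonic/= gtr0_norm ?invr_gt0// => /ltW.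
  by rewrite -(mulr1 (_^-1)) ler_pdivrMl.
have [t0|t0|->] := ltgtP t 0.
- rewrite ltr0_sg// mulN1r; apply: cvg_near_cst.
  have := H (- t); rewrite oppr_gt0 => /(_ t0); apply: filterS => n.
  by rewrite mulrN lerNr => /ramp_leN1.
- rewrite gtr0_sg// mul1r; apply: cvg_near_cst.
  by have := H _ t0; apply: filterS => n /ramp_ge1.
- by rewrite sgr0 mul0r; apply: cvg_near_cst; apply: nearW => n; rewrite mulr0 ramp0.
Qed.

(** The test function is a C^1 cut-off to [a, b] whose derivative is the difference of two
    approximate identities, at a and at b. One side tends to u(a) - u(b), the other by dominated
    convergence to minus the integral of v. *)
Lemma weak_radial_derivative_lebesgue_pt u v al a b be :
  weak_radial_derivative u v -> 0 < al -> al < a -> a < b -> b < be ->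
  lebesgue_pt (u \_ `[al, be]) a -> lebesgue_pt (u \_ `[al, be]) b ->
  u b - u a = \int[leb]_(r in `[a, b]) v r.
Proof.
move=> uv al0 ala ab bbe La Lb; have [ui vi _] := uv.
have {}ui := radial_loc_integrable_itv be al0 ui.
have {}vi := radial_loc_integrable_itv be al0 vi.
set I : set MR := `[al, be]%classic.
have mI : measurable I by exact: measurable_itv.
have cvga : \int[leb]_(r in I) (u r * (n.+1%:R * tent (n.+1%:R * (r - a))))
    @[n --> \oo] --> u a.
  by apply: tent_integral_cvg => //; rewrite ala (lt_trans ab).
have cvgb : \int[leb]_(r in I) (u r * (n.+1%:R * tent (n.+1%:R * (r - b))))
    @[n --> \oo] --> u b.
  by apply: tent_integral_cvg => //; rewrite bbe (lt_trans ala).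
pose zeta n r : R := ramp (n.+1%:R * (r - a)) - ramp (n.+1%:R * (r - b)).
(* The limit of the cut-offs: the indicator function of [a, b], except for the value 1/2 at the two
   end points. *)
pose chi r : R := Num.sg (r - a) / 2 - Num.sg (r - b) / 2.
have zeta1 n r : `|zeta n r| <= 1.
  have := ramp_bound (n.+1%:R * (r - a)); have := ramp_bound (n.+1%:R * (r - b)).
  by rewrite /zeta ler_norml => /andP[? ?] /andP[? ?]; apply/andP; split; lra.
have czeta n : continuous (zeta n).
  move=> r; have := is_derive1B (ramp_scale_derive n.+1%:R a r)
    (ramp_scale_derive n.+1%:R b r).
  exact: is_derive1_continuous.
have mvz n : measurable_fun I (fun r => v r * zeta n r).
  apply: measurable_funM; first by apply/measurable_EFinP; exact: measurable_int vi.
  by apply: measurable_funTS; exact: continuous_measurable_fun.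
have cvz r : I r -> v r * zeta n r @[n --> \oo] --> v r * chi r.
  by move=> _; apply: cvgM; [exact: cvg_cst|apply: cvgB; exact: ramp_cvg].
have nvi : leb.-integrable I (EFin \o (fun r => `|v r|)) by exact: integrable_norm vi.
have lev n r : I r -> `|v r * zeta n r| <= `|v r|.
  by move=> _; rewrite normrM ler_piMr.
have [chii cvgv] := Rintegral_dominated_cvg mI mvz cvz nvi lev.
have abI : `[a, b] `<=` I.
  move=> r; rewrite /I /= !in_itv/= => /andP[ar rb].
  by rewrite (le_trans (ltW ala))// (le_trans rb)// ltW.
have chiE : \int[leb]_(r in I) (v r * chi r) = \int[leb]_(r in `[a, b]) v r.
  rewrite (@Rintegral_sub_support _ MR R leb `[a, b] I _ abI); last first.
    move=> r _; rewrite /= in_itv/= => /negP; rewrite negb_and -!ltNge /chi.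
    move=> /orP[ra|br]; first by rewrite !ltr0_sg ?subr_lt0 ?subrr ?mulr0// (lt_trans ra).
    by rewrite !gtr0_sg ?subr_gt0 ?subrr ?mulr0// (lt_trans ab).
  rewrite -!Rintegral_itv_oo_cc; last 2 first.
  - by apply: integrableS mI _ abI chii.
  - by apply: integrableS mI _ abI vi.
  apply: eq_Rintegral => r; rewrite inE/= in_itv/= => /andP[ar rb].
  by rewrite /chi gtr0_sg ?subr_gt0// ltr0_sg ?subr_lt0//; field.
have E : \forall n \near \oo,
    \int[leb]_(r in I) (u r * (n.+1%:R * tent (n.+1%:R * (r - a)))) -
    \int[leb]_(r in I) (u r * (n.+1%:R * tent (n.+1%:R * (r - b)))) =
    - \int[leb]_(r in I) (v r * zeta n r).
  have Nlt d : 0 < d -> \forall n \near \oo, n.+1%:R^-1 < d :> R.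
    move=> d0; have /cvgrPdist_lt /(_ _ d0) := @cvg_harmonic R.
    by apply: filterS => n'; rewrite sub0r normrN /harmonic/= gtr0_norm// invr_gt0.
  near=> n.
  have N0 : 0 < n.+1%:R :> R by rewrite ltr0n.
  have Na : 1 <= n.+1%:R * (a - al).
    rewrite -ler_pdivrMl// mulr1 ltW//; near: n; apply: Nlt; by rewrite subr_gt0.
  have Nb : 1 <= n.+1%:R * (be - b).
    rewrite -ler_pdivrMl// mulr1 ltW//; near: n; apply: Nlt; by rewrite subr_gt0.
  have zeta0 r : r < al \/ be < r -> zeta n r = 0.
    rewrite /zeta => -[ra|br].
      rewrite !ramp_leN1 ?subrr//; nra.
    by rewrite !ramp_ge1 ?subrr//; nra.
  pose dz r : R := n.+1%:R * tent (n.+1%:R * (r - a)) - n.+1%:R * tent (n.+1%:R * (r - b)).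
  have dzE r : is_derive r 1 (zeta n) (dz r).
    by apply: is_derive1B; exact: ramp_scale_derive.
  have cdz : continuous dz.
    by move=> r; apply: cvgB; exact: tent_scale_continuous.
  have dz0 r : r < al \/ be < r -> dz r = 0.
    rewrite /dz => -[ra|br]; rewrite !tent_out ?mulr0 ?subrr//;
    rewrite ler_normr; apply/orP; nra.
  have := weak_radial_derivative_half_line al0 dzE cdz zeta0 uv.
  have Isub : I `<=` Rpos.
    by move=> r; rewrite /I /= !in_itv/= andbT => /andP[+ _]; exact: lt_le_trans.
  have nI r : ~ I r -> r < al \/ be < r.
    rewrite /I /= in_itv/= => /negP; rewrite negb_and -!ltNge => /orP[]; tauto.
  rewrite (@Rintegral_sub_support _ MR R leb I Rpos _ Isub); last first.
    by move=> r _ /nI /dz0 ->; rewrite mulr0.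
  rewrite (@Rintegral_sub_support _ MR R leb I Rpos _ Isub); last first.
    by move=> r _ /nI /zeta0 ->; rewrite mulr0.
  move=> <-.
  have ki c : leb.-integrable I
      (EFin \o (fun r => u r * (n.+1%:R * tent (n.+1%:R * (r - c))))).
    apply: (@integrable_mulr_bounded _ MR R leb I mI u _ n.+1%:R ui).
      by apply: measurable_funTS; apply: continuous_measurable_fun; exact: tent_scale_continuous.
    move=> r; rewrite ger0_norm; last first.
      by apply: mulr_ge0; [exact: ltW|exact: tent_ge0].
    by apply: ler_piMr; [exact: ltW|exact: tent_le1].
  rewrite -(RintegralB mI (ki a) (ki b)).
  by apply: eq_Rintegral => r _; rewrite /dz [RHS]mulrBr.
have L1 := cvgB cvga cvgb; have {}L1 := L1 eventually_filter.
have L2 := cvgN cvgv; have {}L2 := L2 eventually_filter; rewrite chiE in L2.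
have L3 : u a - u b = - \int[leb]_(r in `[a, b]) v r.
  apply: (@cvg_unique _ (@Rhausdorff R) _ _ _ _ L1).
  apply: cvg_trans L2; apply: near_eq_cvg; apply: filterS E => n /= E.
  exact: esym E.
by lra.
Unshelve. all: by end_near. Qed.

Lemma radial_ae_eq_continuous u v :
  (forall r, 0 < r -> {for r, continuous u}) ->
  (forall r, 0 < r -> {for r, continuous v}) ->
  radial_ae_eq u v -> forall r, 0 < r -> u r = v r.
Proof.
move=> cu cv uv r r0; apply/eqP; rewrite -subr_eq0; apply/negP => /negP nuv.
have c : {for r, continuous (fun s => u s - v s)} by apply: cvgB; [exact: cu|exact: cv].
have /= [e /= e0 H] : \forall s \near r, u s - v s != 0.
  have /cvgrPdist_lt /(_ `|u r - v r|) := c; rewrite normr_gt0 => /(_ nuv).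
  apply: filterS => s; apply: contraTneq => ->; by rewrite subr0 ltxx.
have re : 0 <= r < r + e by rewrite ltW// ltrDl.
have [s /andP[rs se] uvs] := ae_dense re uv.
have /H : ball r e s by rewrite /ball/= ltr_distlC (lt_trans _ rs) ?se// gtrBl.
by rewrite uvs subrr eqxx.
Qed.

Let aeF := ae_filter_ringOfSetsType leb.

Lemma radial_ae_eq_trans u v w : radial_ae_eq u v -> radial_ae_eq v w ->
  radial_ae_eq u w.
Proof. by apply: (@filterS2 _ _ aeF) => r uv vw r0; rewrite uv// vw. Qed.

Lemma radial_ae_eq_sym u v : radial_ae_eq u v -> radial_ae_eq v u.
Proof. by apply: (@filterS _ _ aeF) => r uv r0; rewrite uv. Qed.

(** Stated through increments, since v need not be integrable down to 0. *)
Definition primitive_on_half_line (F v : R -> R) : Prop :=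
  forall a b, 0 < a <= b -> F b - F a = \int[leb]_(r in `[a, b]) v r.

Lemma archi_itv r : 0 < r -> exists n, n.+1%:R^-1 < r < n.+1%:R.
Proof.
move=> r0; exists (maxn (Num.bound r) (Num.bound r^-1)).
have H x : 0 < x -> (Num.bound x <= maxn (Num.bound r) (Num.bound r^-1))%N ->
    x < (maxn (Num.bound r) (Num.bound r^-1)).+1%:R.
  move=> x0 xm; apply: (lt_le_trans (archi_boundP (ltW x0))).
  by rewrite ler_nat ltnW// ltnS.
rewrite H ?leq_maxl// andbT -[ltRHS]invrK ltf_pV2 ?posrE ?invr_gt0//.
by rewrite H ?invr_gt0// leq_maxr.
Qed.

(** The increment formula holds between Lebesgue points, which are almost all points. Anchored at
    one of them, its right-hand side makes sense at every r > 0 and defines F. *)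
Lemma weak_radial_derivative_primitive u v : weak_radial_derivative u v ->
  exists2 F, radial_ae_eq u F & primitive_on_half_line F v.
Proof.
move=> uv; have [ui vi _] := uv.
pose I n : set MR := `[n.+1%:R^-1, n.+1%:R]%classic.
(* The intervals [I n] exhaust the half-line; asking for a Lebesgue point of every truncation costs
   only a countable union of null sets. *)
pose good r := forall n, lebesgue_pt (u \_ (I n)) r.
have aegood : {ae leb, forall r, 0 < r -> good r}.
  have : {ae leb, forall r, good r}.
    apply: ae_foralln => n; apply: lebesgue_differentiation.
    apply: integrable_locally; first exact: measurable_itv.
    by apply: radial_loc_integrable_itv => //; rewrite invr_gt0.
  by apply: (@filterS _ _ aeF).
have [c /andP[c0 c2] gc] := @ae_dense good 0 2 (introT andP (conj (lexx _) (ltr0n _ 2))) aegood.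
have key a b : 0 < a -> a < b -> good a -> good b ->
    u b - u a = \int[leb]_(r in `[a, b]) v r.
  move=> a0 ab ga gb.
  have [n /andP[na _]] := archi_itv a0.
  have [m /andP[_ mb]] := archi_itv (lt_trans a0 ab).
  pose k := maxn n m.
  apply: (@weak_radial_derivative_lebesgue_pt u v k.+1%:R^-1 a b k.+1%:R) => //.
  - apply: le_lt_trans na; rewrite lef_pV2 ?posrE// ler_nat ltnS; exact: leq_maxl.
  - apply: lt_le_trans mb _; rewrite ler_nat ltnS; exact: leq_maxr.
  - exact: ga.
  - exact: gb.
(* This is the oriented integral from c to r: for r other than c, one of the two intervals is
   empty. *)
pose F r := u c + \int[leb]_(s in `[c, r]) v s - \int[leb]_(s in `[r, c]) v s.
have viab a b : 0 < a -> leb.-integrable `[a, b] (EFin \o v).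
  by move=> a0; exact: radial_loc_integrable_itv.
have ltE a b : b < a -> \int[leb]_(s in `[a, b]) v s = 0.
  by move=> ba; rewrite set_itv_ge ?Rintegral_set0// bnd_simp -ltNge.
have eqE a : \int[leb]_(s in `[a, a]) v s = 0.
  by rewrite set_itv1 Rintegral_set1.
exists F.
  move: aegood; apply: (@filterS _ _ aeF) => r gr r0; have {}gr := gr r0.
  rewrite /F; have [rc|rc|->] := ltgtP r c.
  - by rewrite ltE// -(key _ _ r0 rc gr gc); ring.
  - by rewrite [X in _ - X]ltE// -(key _ _ c0 rc gc gr); ring.
  - by rewrite eqE; ring.
move=> a b /andP[a0 ab]; have b0 := lt_le_trans a0 ab; rewrite /F.
have [bc|cb] := leP b c.
  rewrite (@Rintegral_itv_add v a b c) ?ab ?bc//; last exact: viab.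
  have [E1 E2] : \int[leb]_(s in `[c, b]) v s = 0 /\ \int[leb]_(s in `[c, a]) v s = 0.
    move: bc; rewrite le_eqVlt => /predU1P[bc|bc].
      subst c; split; first exact: eqE.
      move: ab; rewrite le_eqVlt => /predU1P[->|ab]; [exact: eqE|exact: ltE].
    by split; apply: ltE => //; exact: le_lt_trans bc.
  by rewrite E1 E2; ring.
rewrite [\int[leb]_(s in `[b, c]) v s]ltE//.
have [ac|ca] := leP a c.
  rewrite (@Rintegral_itv_add v a c b) ?ac ?(ltW cb)//; last exact: viab.
  have -> : \int[leb]_(s in `[c, a]) v s = 0.
    by move: ac; rewrite le_eqVlt => /predU1P[->|ac]; [exact: eqE|exact: ltE].
  by ring.
rewrite [\int[leb]_(s in `[a, c]) v s]ltE//.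
rewrite (@Rintegral_itv_add v c a b) ?ab ?(ltW ca)//; last exact: viab.
by ring.
Qed.

Lemma primitive_on_half_line_continuous F v : radial_loc_integrable v ->
  primitive_on_half_line F v -> forall r, 0 < r -> {for r, continuous F}.
Proof.
move=> vi Fv r r0; pose a := r / 2; pose b := r + 1.
have a0 : 0 < a by rewrite divr_gt0.
have ar : a < r by rewrite /a; lra.
have rb : r < b by rewrite /b; lra.
have ab : a < b by exact: lt_trans rb.
have ci := parameterized_integral_continuous (ltW ab) (radial_loc_integrable_itv b a0 vi).
have [{}ci _ _] := (continuous_within_itvP _ ab).1 (fun x => @ci x).
have {}ci : {for r, continuous (fun x => parameterized_integral leb a x v)}.
  by apply: ci; rewrite in_itv/= ar.
have cG : {for r, continuous (fun x => F a + parameterized_integral leb a x v)}.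
  by apply: cvgD; [exact: cvg_cst|exact: ci].
have E : \forall x \near r, F a + parameterized_integral leb a x v = F x.
  near=> x; rewrite /parameterized_integral -Fv ?a0/=; first by rewrite addrC subrK.
  by rewrite ltW//; near: x; exact: lt_nbhsr.
rewrite /prop_for /continuous_at -(nbhs_singleton E).
by apply: cvg_trans cG; apply: near_eq_cvg.
Unshelve. all: by end_near. Qed.

Lemma primitive_on_half_line_derive F v :
  (forall r, 0 < r -> {for r, continuous v}) -> primitive_on_half_line F v ->
  forall r, 0 < r -> is_derive r 1 F (v r).
Proof.
move=> cv Fv r r0; pose a := r / 2; pose b := r + 1.
have a0 : 0 < a by rewrite divr_gt0.
have ar : a < r by rewrite /a; lra.
have rb : r < b by rewrite /b; lra.
have vi : leb.-integrable `[a, b] (EFin \o v).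
  apply: continuous_compact_integrable; first exact: segment_compact.
  apply: continuous_in_subspaceT => x; rewrite inE/= in_itv/= => /andP[ax _].
  by apply: cv; exact: lt_le_trans ax.
have [d1 d2] := continuous_FTC1_closed rb vi ar (cv r r0).
set G := (fun x => _) in d1 d2.
have dG : is_derive r 1 G (v r) by rewrite -d2 derive1E; exact/derivableP.
apply: (@is_derive1_near _ (fun x => F a + G x)).
  near=> x; rewrite /G -Fv ?a0/=; first by rewrite addrC subrK.
  by rewrite ltW//; near: x; exact: lt_nbhsr.
by have := is_derive1D (is_derive_cst (F a) r (1 : R)) dG; rewrite add0r.
Unshelve. all: by end_near. Qed.

Lemma primitive_on_half_line_ae F v w : measurable_fun (Rpos : set MR) v ->
  measurable_fun (Rpos : set MR) w -> radial_ae_eq v w ->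
  primitive_on_half_line F v -> primitive_on_half_line F w.
Proof.
move=> mv mw vw Fv a b /andP[a0 ab]; rewrite Fv ?a0//.
have sub : `[a, b] `<=` Rpos.
  by move=> r /=; rewrite !in_itv/= andbT => /andP[+ _]; exact: lt_le_trans.
rewrite /Rintegral; congr fine; apply: ae_eq_integral.
- exact: measurable_itv.
- by apply/measurable_EFinP; exact: measurable_funS mv.
- by apply/measurable_EFinP; exact: measurable_funS mw.
- move: vw; apply: (@filterS _ _ aeF) => r vw /sub /=; rewrite in_itv/= andbT => r0.
  by rewrite vw.
Qed.

(** The primitives of v and w agree almost everywhere, hence everywhere by continuity. So v - w has
    integral 0 over every interval, and it vanishes almost everywhere by differentiating its
    integral. This is what identifies the chosen [rderiv] with an explicit function. *)
Lemma weak_radial_derivative_unique u v w :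
  weak_radial_derivative u v -> weak_radial_derivative u w -> radial_ae_eq v w.
Proof.
move=> uv uw; have [ui vi _] := uv; have [_ wi _] := uw.
have [F uF Fv] := weak_radial_derivative_primitive uv.
have [G uG Gw] := weak_radial_derivative_primitive uw.
have FG : forall r, 0 < r -> F r = G r.
  apply: radial_ae_eq_continuous.
  - exact: primitive_on_half_line_continuous vi Fv.
  - exact: primitive_on_half_line_continuous wi Gw.
  - exact: radial_ae_eq_trans (radial_ae_eq_sym uF) uG.
have vwE a b : 0 < a -> \int[leb]_(r in `[a, b]) (v r - w r) = 0.
  move=> a0; have [ba|ab] := ltP b a.
    by rewrite set_itv_ge ?Rintegral_set0// bnd_simp -ltNge.
  rewrite RintegralB//; try exact: radial_loc_integrable_itv.
  by rewrite -Fv ?a0// -Gw ?a0// !FG ?subrr// (lt_le_trans a0).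
pose I n : set MR := `[n.+1%:R^-1, n.+1%:R]%classic.
pose z n : R -> R := (fun r => v r - w r) \_ (I n).
have mI n : measurable (I n) by exact: measurable_itv.
have I0 n : 0 < n.+1%:R^-1 :> R by rewrite invr_gt0.
have zi n : leb.-integrable (I n) (EFin \o (fun r => v r - w r)).
  by apply: integrable_sub; [exact: measurable_itv|exact: radial_loc_integrable_itv..].
have ziT n : leb.-integrable setT (EFin \o z n).
  have := (@integrable_mkcond _ MR R leb _ (EFin \o (fun r => v r - w r)) (mI n)).1 (zi n).
  by rewrite restrict_EFin.
pose J n (x : R) : R := \int[leb]_(t in `[n.+1%:R^-1, x]) z n t.
have : {ae leb, forall r, forall n, n.+1%:R^-1 < r ->
    derivable (J n) r 1 /\ derive1 (J n) r = z n r}.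
  apply: ae_foralln => n.
  have H y : leb.-integrable `[n.+1%:R^-1, y] (EFin \o z n).
    by apply: integrableS (ziT n) => //; exact: measurable_itv.
  have := @FTC1 _ (z n) (BLeft n.+1%:R^-1) H.
  move=> /(_ (integrable_locally (mI n) (zi n))).
  move=> /=; apply: (@filterS _ _ aeF) => x xP nx; apply: xP.
  by rewrite lte_fin.
apply: (@filterS _ _ aeF) => r rP r0.
have [n /andP[nr rn]] := archi_itv r0.
have [_] := rP n nr.
rewrite /z /patch mem_set; last by rewrite /I /= in_itv/= !ltW.
move=> E; apply/eqP; rewrite -subr_eq0 -E; apply/eqP.
apply: derive1_is_derive; apply: (@is_derive1_near _ (cst 0)) => //.
near=> x; rewrite /cst; symmetry.
rewrite -[RHS](vwE n.+1%:R^-1 x)//; apply: eq_Rintegral => t.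
rewrite inE/= in_itv/= => /andP[nt tx].
rewrite /z /patch mem_set// /I /= in_itv/= nt (le_trans tx)// ltW//.
by near: x; exact: lt_nbhsl.
Unshelve. all: by end_near. Qed.

End weak_derivative_primitive.

(** * Differential inequalities *)

Section radial_ode.
Context {R : realType}.
Implicit Types (F G J a b h dF dJ Phi dPhi : R -> R) (r s x : R).

Lemma le_of_le_addMr (x y M r : R) : 0 < r ->
  (forall s, 0 < s <= r -> x <= y + M * s) -> x <= y.
Proof.
move=> r0 xy; rewrite leNgt; apply/negP => yx.
pose s := Num.min r ((x - y) / (2 * (`|M| + 1))).
have M0 : 0 < 2 * (`|M| + 1) by rewrite mulr_gt0// ltr_wpDl.
have s0 : 0 < s by rewrite lt_min r0 divr_gt0// subr_gt0.
have := xy s; rewrite s0 ge_min lexx => /(_ isT).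
have sle : s * (2 * (`|M| + 1)) <= x - y.
  by rewrite -ler_pdivlMr// ge_min lexx orbT.
have : M * s <= `|M| * s by rewrite ler_pM2r// ler_norm.
by have := normr_ge0 M; nra.
Qed.

(** Young's inequality for the exponents 4/3 and 4; the difference of the two sides is an explicit
    sum of squares. *)
Lemma pow4_young x y : `|4 * x ^+ 3 * y| <= 3 * x ^+ 4 + y ^+ 4.
Proof.
have H (u v : R) : 4 * u ^+ 3 * v <= 3 * u ^+ 4 + v ^+ 4.
  rewrite -subr_ge0.
  have -> : 3 * u ^+ 4 + v ^+ 4 - 4 * u ^+ 3 * v =
    (v - u) ^+ 2 * ((u + v) ^+ 2 + 2 * u ^+ 2) by ring.
  apply: mulr_ge0; first exact: sqr_ge0.
  by apply: addr_ge0; [exact: sqr_ge0|apply: mulr_ge0 => //; exact: sqr_ge0].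
rewrite ler_norml H andbT lerNl.
by have := H x (- y); rewrite mulrN; congr (_ <= _); ring.
Qed.

(* F(r)^4 <= J(r + 1) - J(r), because (r + 1 - s) F(s)^4 + J(s) is
   nondecreasing in s on [r, r + 1]. *)
Lemma cvg0_of_bounded_primitive F dF J dJ M :
  (forall r, 1 <= r -> is_derive r 1 F (dF r)) ->
  (forall r, 1 <= r -> is_derive r 1 J (dJ r)) ->
  (forall r, 1 <= r -> 4 * F r ^+ 4 + dF r ^+ 4 <= dJ r) ->
  (forall r, 1 <= r -> J r <= M) ->
  forall d, 0 < d -> exists2 r0, 1 <= r0 & forall r, r0 <= r -> `|F r| <= d.
Proof.
move=> FdF JdJ FJ JM d d0.
have p4 x : 0 <= x ^+ 4 by rewrite (_ : 4 = 2 * 2)%N// exprM sqr_ge0.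
have Jnd r s : 1 <= r -> r <= s -> J r <= J s.
  move=> r1 rs; apply: (is_derive_ge0_le rs) => x /andP[rx _].
    exact/JdJ/(le_trans r1).
  apply: le_trans (FJ _ (le_trans r1 rx)).
  by rewrite addr_ge0// mulr_ge0.
have FJ1 r : 1 <= r -> F r ^+ 4 <= J (r + 1) - J r.
  move=> r1.
  pose k s := (r + 1 - s) * F s ^+ 4 + J s.
  pose dk s := (0 - 1) * F s ^+ 4 + (r + 1 - s) * (4 * F s ^+ 3 * dF s) + dJ s.
  have : k r <= k (r + 1).
    have rr1 : r <= r + 1 by rewrite lerDl.
    apply: (is_derive_ge0_le (df := dk) rr1) => s /andP[rs sr].
      have s1 := le_trans r1 rs.
      exact: (is_derive1D (is_derive1M
        (is_derive1B (is_derive_cst (r + 1) s 1) (is_derive_id s (1 : R)))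
        (is_derive1X 4 (FdF _ s1))) (JdJ _ s1)).
    have := FJ _ (le_trans r1 rs); have := pow4_young (F s) (dF s).
    rewrite ler_norml => /andP[+ _]; rewrite /dk.
    move: (4 * F s ^+ 3 * dF s) (p4 (F s)) (p4 (dF s)) => A.
    by move: (F s ^+ 4) (dF s ^+ 4) (dJ s) => B C D; nra.
  have e1 : r + 1 - r = 1 by lra.
  by rewrite /k e1 subrr mul0r mul1r => H; lra.
(* J is nondecreasing and bounded; once it is within d^4 of its supremum, its later increments stay
   below d^4. *)
pose E := [set J r | r in [set r | 1 <= r]].
have supE : has_sup E.
  split; first by exists (J 1); exists 1 => //=.
  by exists M => _ [r /= r1 <-]; exact: JM.
have d40 : 0 < d ^+ 4 by rewrite exprn_gt0.
have [_ [r0 /= r01 <-] Jr0] := sup_adherent d40 supE.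
exists r0 => // r r0r; have r1 := le_trans r01 r0r.
rewrite -(@ler_pXn2r _ 4) ?nnegrE ?(ltW d0)//.
have -> : `|F r| ^+ 4 = F r ^+ 4 by rewrite -normrX ger0_norm.
apply: le_trans (FJ1 _ r1) _.
have : J (r + 1) <= sup E.
  apply: sup_upper_bound => //; exists (r + 1) => //=.
  by rewrite (le_trans r1)// lerDl.
by have := Jnd _ _ r01 r0r; lra.
Qed.

(** The bound |F'| <= r^2 F'^4 + r^(-2/3) compares F with [H], the sum of J and 3 r^(1/3), which is
    bounded on ]0, 1]. With a general exponent p in place of 4 the last power would be r^(-2/(p-1)),
    integrable at 0 exactly for p > 3. *)
Lemma bounded_near0_of_bounded_primitive F dF J dJ M :
  (forall r, 0 < r <= 1 -> is_derive r 1 F (dF r)) ->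
  (forall r, 0 < r <= 1 -> is_derive r 1 J (dJ r)) ->
  (forall r, 0 < r <= 1 -> r ^+ 2 * dF r ^+ 4 <= dJ r) ->
  (forall r, 0 < r <= 1 -> `|J r| <= M) ->
  exists M', forall r, 0 < r <= 1 -> `|F r| <= M'.
Proof.
move=> FdF JdJ FJ JM; pose p : R := 3^-1.
pose H r := J r + 3 * r `^ p; pose dH r := dJ r + 3 * (p * r `^ (p - 1)).
have HdH r : 0 < r <= 1 -> is_derive r 1 H (dH r).
  move=> r01; apply: is_derive1D; first exact: JdJ.
  by apply: is_derive1Z; apply: is_derive1_powR; case/andP: r01.
have dFdH r : 0 < r <= 1 -> `|dF r| <= dH r.
  move=> /[dup] r01 /andP[r0 _]; pose t := r `^ p.
  have t0 : 0 < t by rewrite powR_gt0.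
  have t3 : t ^+ 3 = r.
    by rewrite -powR_mulrn ?(ltW t0)// -powRrM /p mulVf// powRr1// ltW.
  have pE : r * r `^ (p - 1) = t by rewrite mulr_powRB1// ?ltW// /p invr_gt0.
  have {}pE : 3 * (p * r `^ (p - 1)) = t ^- 2.
    rewrite mulrA /p divff// mul1r; apply: (@mulfI _ r); first by rewrite gt_eqF.
    have -> : r / t ^+ 2 = t by rewrite -[X in X / _]t3; field; rewrite gt_eqF.
    exact: pE.
  rewrite /dH pE; apply: le_trans (lerD (FJ _ r01) (lexx _)).
  (* With r = t^3 and X = |D| t^2 the claim becomes X <= X^4 + 1. *)
  move: (dF r) => D; rewrite -t3 -(@ler_pM2r _ (t ^+ 2)) ?exprn_gt0//.
  rewrite mulrDl mulVf ?gt_eqF ?exprn_gt0//.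
  have -> : (t ^+ 3) ^+ 2 * D ^+ 4 * t ^+ 2 = (`|D| * t ^+ 2) ^+ 4.
    have -> : D ^+ 4 = `|D| ^+ 4.
      by rewrite -normrX ger0_norm// (_ : 4 = 2 * 2)%N// exprM sqr_ge0.
    by ring.
  have : 0 <= `|D| * t ^+ 2 by rewrite mulr_ge0// sqr_ge0.
  move: (_ * _) => X X0; have X4 : 0 <= X ^+ 4 by rewrite exprn_ge0.
  have [X1|X1] := leP X 1; first by lra.
  have : X <= X ^+ 4 by rewrite ler_eXnr// ltW.
  by lra.
exists (`|F 1| + (2 * M + 3)) => r /andP[r0 r1].
have sub1 x : r <= x <= 1 -> 0 < x <= 1.
  by move=> /andP[rx ->]; rewrite (lt_le_trans r0 rx).
have P1 : F 1 - F r <= H 1 - H r.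
  apply: (is_derive_le r1 (fun x xr => FdF x (sub1 x xr))
    (fun x xr => HdH x (sub1 x xr))) => x xr.
  by rewrite (le_trans (ler_norm _))// dFdH// sub1.
have P2 : - F 1 - - F r <= H 1 - H r.
  apply: (is_derive_le r1 (fun x xr => is_derive1N (FdF x (sub1 x xr)))
    (fun x xr => HdH x (sub1 x xr))) => x xr.
  by rewrite (le_trans (ler_norm _))// normrN dFdH// sub1.
have : H 1 - H r <= 2 * M + 3.
  have := JM 1; rewrite ltr01 lexx => /(_ isT).
  have := JM r; rewrite r0 r1 => /(_ isT).
  rewrite !ler_norml => /andP[? _] /andP[_ ?].
  by rewrite /H powR1; have := powR_ge0 r p; lra.
have := ler_norm (F 1); have := ler_norm (- F 1).
rewrite normrN => N1 N2 HM; rewrite ler_norml.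
by apply/andP; split; lra.
Qed.

Lemma le_pow3_of_derive_le_pow2 Phi dPhi (K M r : R) : 0 < r <= 1 -> 0 <= M ->
  (forall s, 0 < s <= r -> is_derive s 1 Phi (dPhi s)) ->
  (forall s, 0 < s <= r -> `|dPhi s| <= K * s ^+ 2) ->
  (forall s, 0 < s <= r -> `|Phi s| <= M * s) ->
  `|Phi r| <= K * r ^+ 3 / 3.
Proof.
move=> /andP[r0 r1] M0 PhidPhi dPhiK PhiM.
apply: (@le_of_le_addMr _ _ (M + `|K|) r r0) => s /andP[s0 sr].
have sub x : s <= x <= r -> 0 < x <= r.
  by move=> /andP[sx ->]; rewrite (lt_le_trans s0 sx).
pose Psi x := K / 3 * x ^+ 3.
have dPsi x : s <= x <= r -> is_derive x 1 Psi (K * x ^+ 2).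
  move=> _; have := is_derive1Z (K / 3) (is_derive1X 3 (is_derive_id x (1 : R))).
  by move=> /is_derive_eq; apply; rewrite /=; field.
have P1 : Phi r - Phi s <= Psi r - Psi s.
  apply: (is_derive_le sr (fun x xr => PhidPhi x (sub x xr)) dPsi) => x xr.
  by rewrite (le_trans (ler_norm _))// dPhiK// sub.
have P2 : - Phi r - - Phi s <= Psi r - Psi s.
  apply: (is_derive_le sr (fun x xr => is_derive1N (PhidPhi x (sub x xr))) dPsi) => x xr.
  by rewrite (le_trans (ler_norm _))// normrN dPhiK// sub.
have := PhiM s; rewrite s0 sr => /(_ isT); rewrite ler_norml => /andP[PM1 PM2].
have Ks : - (K * s ^+ 3) / 3 <= `|K| * s.
  have K1 : - K <= `|K| by rewrite -normrN ler_norm.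
  have s31 : 0 <= s ^+ 3 <= s.
    rewrite exprn_ge0 ?(ltW s0)//=.
    have : 0 <= s * ((1 - s) * (1 + s)) by rewrite !mulr_ge0//; lra.
    have -> : s ^+ 3 = s - s * ((1 - s) * (1 + s)) by ring.
    by lra.
  move: s31 K1 (normr_ge0 K); move: (s ^+ 3) `|K| => s3 k /andP[s30 s3s] K1 k0.
  by nra.
move: P1 P2; rewrite /Psi => P1 P2.
rewrite ler_norml; apply/andP; split; lra.
Qed.

(** The cubic Taylor term of the exponential, (k r)^3 / 6, already beats the quadratic. *)
Lemma cube_lt_expR (k A B r1 : R) : 0 < k -> 0 < A -> 0 <= B ->
  exists2 r, r1 <= r & B * r ^+ 2 < A * expR (k * r).
Proof.
move=> k0 A0 B0.
have c0 : 0 < A * k ^+ 3 by rewrite mulr_gt0// exprn_gt0.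
pose r := `|r1| + 6 * B / (A * k ^+ 3) + 1.
have q0 : 0 <= 6 * B / (A * k ^+ 3) by rewrite divr_ge0 ?mulr_ge0// ltW.
have r0 : 0 < r by rewrite /r ltr_wpDl// addr_ge0.
exists r; first by rewrite /r; have := ler_norm r1; lra.
have := @expR_ge1Dxn R (k * r) 2 (ltW (mulr_gt0 k0 r0)).
have f3 : (3`!)%:R = 6 :> R by [].
rewrite f3 exprMn => ex.
apply: (@le_lt_trans _ _ (A * (k ^+ 3 * r ^+ 3 / 6))); last first.
  by rewrite ltr_pM2l//; lra.
have : 6 * B <= (A * k ^+ 3) * r.
  by rewrite -ler_pdivrMl// mulrC /r; have := normr_ge0 r1; lra.
have : 0 <= r ^+ 2 by exact: sqr_ge0.
rewrite (exprS r 2); move: (k ^+ 3) (r ^+ 2) => k3 r2 r20 H.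
have : 6 * B * r2 <= A * k3 * r * r2 by rewrite ler_wpM2r.
by lra.
Qed.

(* y = r^2 (F G - delta (F^2 + G^2)) satisfies y' <= - (c / 2) |y|; if it were
   negative somewhere it would grow exponentially, so y >= 0 and y decays. *)
Lemma hyperbolic_lyapunov F G a b (c delta R0 : R) :
  0 < c <= 1 -> 1 <= R0 -> 0 < delta <= c / 14 ->
  (forall r, R0 <= r -> is_derive r 1 F (a r * G r - 2 / r * F r)) ->
  (forall r, R0 <= r -> is_derive r 1 G (b r * F r)) ->
  (forall r, R0 <= r -> [/\ a r <= - c, b r <= - c & `|a r + b r| <= 1]) ->
  (forall r, R0 <= r -> F r ^+ 2 + G r ^+ 2 <= 1) ->
  let y r := r ^+ 2 * (F r * G r - delta * (F r ^+ 2 + G r ^+ 2)) in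
  forall r, R0 <= r -> 0 <= y r <= y R0 * expR (c / 2 * (R0 - r)).
Proof.
move=> /andP[c0 c1] R01 /andP[delta0 deltac] FdF GdG ab N1 y.
pose N r := F r ^+ 2 + G r ^+ 2.
have N0 r : 0 <= N r by rewrite addr_ge0 ?sqr_ge0.
pose dy r := 2 * r * (F r * G r - delta * N r) + r ^+ 2 *
  ((a r * G r - 2 / r * F r) * G r + F r * (b r * F r) -
   delta * (2 * F r * (a r * G r - 2 / r * F r) + 2 * G r * (b r * F r))).
have ydy r : R0 <= r -> is_derive r 1 y (dy r).
  move=> Rr; have dF := FdF _ Rr; have dG := GdG _ Rr.
  have := is_derive1M (is_derive1X 2 (is_derive_id r (1 : R)))
    (is_derive1B (is_derive1M dF dG)
      (is_derive1Z delta (is_derive1D (is_derive1X 2 dF) (is_derive1X 2 dG)))).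
  by move=> /is_derive_eq; apply; rewrite /dy /N /=; ring.
have yN r : R0 <= r -> `|y r| <= r ^+ 2 * N r.
  move=> Rr; rewrite /y normrM ger0_norm ?sqr_ge0// ler_wpM2l ?sqr_ge0//.
  rewrite -/(N r) ler_norml.
  have := N0 r; have := sqr_ge0 (F r - G r); have := sqr_ge0 (F r + G r).
  rewrite /N => h1 h2 h3.
  have : delta * (F r ^+ 2 + G r ^+ 2) <= 1 / 2 * (F r ^+ 2 + G r ^+ 2).
    by rewrite ler_wpM2r//; lra.
  have : 0 <= delta * (F r ^+ 2 + G r ^+ 2) by rewrite mulr_ge0// ltW.
  by move=> h4 h5; apply/andP; split; lra.
have dyN r : R0 <= r -> dy r <= - (c / 2) * (r ^+ 2 * N r).
  move=> Rr; have [ac bc abr] := ab _ Rr; have r1 := le_trans R01 Rr.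
  have r0 : 0 < r by exact: lt_le_trans r1.
  (* The factor r^2 in y cancels the damping - 2 F / r in the derivative of F G. What delta
     contributes is at most 5 delta r^2 N <= (5 c / 14) r^2 N, less than half of the gain c r^2
     N. *)
  have -> : dy r = r ^+ 2 * (a r * G r ^+ 2 + b r * F r ^+ 2)
     - delta * (2 * r * N r + r ^+ 2 * (2 * F r * G r * (a r + b r))
        - 4 * r * F r ^+ 2).
    by rewrite /dy /N; field; rewrite gt_eqF.
  have t1 : a r * G r ^+ 2 + b r * F r ^+ 2 <= - c * N r.
    by rewrite /N; have := sqr_ge0 (F r); have := sqr_ge0 (G r); nra.
  have t2 : - (2 * F r * G r * (a r + b r)) <= N r.
    apply: (le_trans (ler_norm _)); rewrite normrN normrM.
    have : `|2 * F r * G r| <= N r.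
      rewrite ler_norml /N.
      have := sqr_ge0 (F r - G r); have := sqr_ge0 (F r + G r).
      by move=> h1 h2; apply/andP; split; lra.
    move: abr (normr_ge0 (a r + b r)) (normr_ge0 (2 * F r * G r)).
    by move: `|a r + b r| `|_ * G r| => u v; nra.
  have t3 : 4 * r * F r ^+ 2 <= 4 * (r ^+ 2 * N r).
    rewrite /N; have := sqr_ge0 (F r); have := sqr_ge0 (G r).
    have : r <= r ^+ 2 by rewrite ler_eXnr.
    by move: (r ^+ 2) (F r ^+ 2) (G r ^+ 2) => r2 f2 g2; nra.
  have t4 : 0 <= r * N r by rewrite mulr_ge0// ltW.
  have t5 : r ^+ 2 * (a r * G r ^+ 2 + b r * F r ^+ 2) <= - c * (r ^+ 2 * N r).
    by have := ler_wpM2l (sqr_ge0 r) t1; lra.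
  have t6 : r ^+ 2 * - (2 * F r * G r * (a r + b r)) <= r ^+ 2 * N r.
    by rewrite ler_wpM2l ?sqr_ge0.
  have t7 : 0 <= r ^+ 2 * N r by rewrite mulr_ge0 ?sqr_ge0.
  have t8 : delta * (r ^+ 2 * N r) <= c / 14 * (r ^+ 2 * N r).
    by rewrite ler_wpM2r.
  have t9 : - (2 * r * N r + r ^+ 2 * (2 * F r * G r * (a r + b r))
        - 4 * r * F r ^+ 2) <= 5 * (r ^+ 2 * N r) by lra.
  have t10 : delta * - (2 * r * N r + r ^+ 2 * (2 * F r * G r * (a r + b r))
        - 4 * r * F r ^+ 2) <= delta * (5 * (r ^+ 2 * N r)).
    by rewrite ler_pM2l.
  have t11 : 0 <= c * (r ^+ 2 * N r) by rewrite mulr_ge0// ltW.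
  by lra.
have dyy r : R0 <= r -> dy r <= - (c / 2) * `|y r|.
  move=> Rr; apply: le_trans (dyN _ Rr) _.
  by rewrite !mulNr lerN2 ler_wpM2l ?yN// divr_ge0// ltW.
have k0 : 0 < c / 2 by rewrite divr_gt0.
have dexp (k r : R) : is_derive r 1 (fun s => expR (k * s)) (k * expR (k * r)).
  have := is_derive1_comp (is_derive_expR (k * r)) (is_derive1Z k (is_derive_id r (1 : R))).
  by move=> /is_derive_eq; apply; rewrite mulr1 mulrC.
have y0 r1 : R0 <= r1 -> 0 <= y r1.
  move=> Rr1; rewrite leNgt; apply/negP => yr1.
  have yneg r : r1 <= r -> y r < 0.
    move=> r1r; apply: le_lt_trans yr1; rewrite -lerN2.
    apply: (is_derive_ge0_le (f := fun r => - y r) (df := fun r => - dy r) r1r) => x /andP[rx _].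
      by apply/is_derive1N/ydy/(le_trans Rr1).
    rewrite oppr_ge0 (le_trans (dyy _ (le_trans Rr1 rx)))//.
    by rewrite mulNr oppr_le0 mulr_ge0// ltW.
  have yexp r : r1 <= r -> y r * expR (- (c / 2) * r) <= y r1 * expR (- (c / 2) * r1).
    move=> r1r; rewrite -lerN2.
    apply: (is_derive_ge0_le (f := fun r => - (y r * expR (- (c / 2) * r)))
      (df := fun r => - (dy r * expR (- (c / 2) * r) +
         y r * (- (c / 2) * expR (- (c / 2) * r)))) r1r) => x /andP[rx _].
      by apply/is_derive1N/is_derive1M => //; apply/ydy/(le_trans Rr1).
    have := dyy _ (le_trans Rr1 rx); rewrite ltr0_norm ?yneg// => H.
    have := expR_gt0 (- (c / 2) * x); move: (expR _) H => e H e0.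
    have : 0 <= (- (c / 2) * - y x - dy x) * e by rewrite mulr_ge0 ?subr_ge0// ltW.
    by lra.
  have A0 : 0 < - (y r1 * expR (- (c / 2) * r1)).
    by rewrite oppr_gt0 pmulr_llt0 ?expR_gt0.
  (* Exponential growth contradicts |y| <= r^2 N <= r^2. *)
  have [r r1r] := cube_lt_expR r1 k0 A0 (@ler01 R).
  apply/negP; rewrite -leNgt mul1r.
  have := yN _ (le_trans Rr1 r1r); rewrite ltr0_norm ?yneg// => yNr.
  apply: (@le_trans _ _ (- y r)); last first.
    apply: le_trans yNr _; rewrite -[leRHS]mulr1 ler_wpM2l ?sqr_ge0//.
    exact/N1/(le_trans Rr1).
  have := yexp _ r1r; rewrite -lerN2 -(@ler_pM2r _ (expR (c / 2 * r))) ?expR_gt0//.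
  have e1 : expR (- (c / 2) * r) * expR (c / 2 * r) = 1.
    by rewrite -expRD mulNr addNr expR0.
  have -> : - (y r * expR (- (c / 2) * r)) * expR (c / 2 * r) = - y r.
    by rewrite mulNr -(mulrA (y r)) e1 mulr1.
  exact.
move=> r Rr; rewrite y0//=.
have : y r * expR (c / 2 * r) <= y R0 * expR (c / 2 * R0).
  rewrite -lerN2.
  apply: (is_derive_ge0_le (f := fun r => - (y r * expR (c / 2 * r)))
      (df := fun r => - (dy r * expR (c / 2 * r) +
         y r * (c / 2 * expR (c / 2 * r)))) Rr) => x /andP[rx _].
    by apply/is_derive1N/is_derive1M => //; exact: ydy.
  have := dyy _ rx; rewrite ger0_norm ?y0// => H.
  have := expR_gt0 (c / 2 * x); move: (expR _) H => e H e0.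
  have : 0 <= (- (c / 2) * y x - dy x) * e by rewrite mulr_ge0 ?subr_ge0// ltW.
  by lra.
by rewrite mulrBr expRB mulrA -ler_pdivlMr ?expR_gt0.
Qed.

(** The Lyapunov function is used twice. With delta = c/14 its sign gives F G >= (c/14)(F^2 + G^2);
    hence the one with delta = c/28 is at least (c/28) r^2 (F^2 + G^2), and its decay bounds F^2 +
    G^2. *)
Lemma hyperbolic_decay F G a b (c R0 : R) : 0 < c <= 1 -> 1 <= R0 ->
  (forall r, R0 <= r -> is_derive r 1 F (a r * G r - 2 / r * F r)) ->
  (forall r, R0 <= r -> is_derive r 1 G (b r * F r)) ->
  (forall r, R0 <= r -> [/\ a r <= - c, b r <= - c & `|a r + b r| <= 1]) ->
  (forall r, R0 <= r -> F r ^+ 2 + G r ^+ 2 <= 1) ->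
  exists2 C, 0 < C &
    forall r, R0 <= r -> F r ^+ 2 + G r ^+ 2 <= C * expR (- (c / 2) * r).
Proof.
move=> /[dup] c01 /andP[c0 _] R01 FdF GdG ab N1.
have d1 : 0 < c / 14 <= c / 14 by rewrite lexx divr_gt0.
have d2 : 0 < c / 28 <= c / 14 by rewrite divr_gt0//=; lra.
have L1 := hyperbolic_lyapunov c01 R01 d1 FdF GdG ab N1.
have L2 := hyperbolic_lyapunov c01 R01 d2 FdF GdG ab N1.
set Y := R0 ^+ 2 * (F R0 * G R0 - c / 28 * (F R0 ^+ 2 + G R0 ^+ 2)) in L2.
have Y0 : 0 <= Y by have /andP[] := L2 _ (lexx _).
exists (28 / c * (Y + 1) * expR (c / 2 * R0)).
  by rewrite mulr_gt0 ?expR_gt0// mulr_gt0 ?divr_gt0// ltr_wpDl.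
move=> r Rr; have /andP[y1 _] := L1 _ Rr; have /andP[_ y2] := L2 _ Rr.
have r21 : 1 <= r ^+ 2 by rewrite exprn_ege1// (le_trans R01).
have r20 : 0 < r ^+ 2 by rewrite (lt_le_trans _ r21).
have N0 : 0 <= F r ^+ 2 + G r ^+ 2 by rewrite addr_ge0 ?sqr_ge0.
move: y1; rewrite pmulr_rge0// => y1.
have {y2} : c / 28 * (F r ^+ 2 + G r ^+ 2) <= Y * expR (c / 2 * (R0 - r)).
  apply: le_trans y2.
  move: (F r * G r) (F r ^+ 2 + G r ^+ 2) (r ^+ 2) N0 y1 r21 => A B D B0 y1 D1.
  have cB : 0 <= c * B by rewrite mulr_ge0// ltW.
  have : 0 <= (D - 1) * (A - c / 28 * B) by rewrite mulr_ge0 ?subr_ge0//; lra.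
  by lra.
have -> : c / 2 * (R0 - r) = c / 2 * R0 + - (c / 2) * r by ring.
rewrite expRD; set e1 := expR _; set e2 := expR _ => H.
have e0 : 0 < e1 * e2 by rewrite mulr_gt0 ?expR_gt0.
have H' : c / 28 * (F r ^+ 2 + G r ^+ 2) <= (Y + 1) * (e1 * e2).
  by apply: le_trans H _; rewrite ler_pM2r// lerDl.
have c28 : 0 < c / 28 by rewrite divr_gt0.
rewrite -(@ler_pM2l _ (c / 28))//; apply: le_trans H' _.
rewrite le_eqVlt; apply/orP; left; apply/eqP; field.
by rewrite gt_eqF.
Qed.

End radial_ode.

(** * Weak derivatives of smooth radial profiles *)

Section integral_product0.
Local Open Scope ereal_scope.
Context d1 d2 (T1 : measurableType d1) (T2 : measurableType d2) (R : realType).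
Variable m1 : {sigma_finite_measure set T1 -> \bar R}.
Variable m2 : {sigma_finite_measure set T2 -> \bar R}.
Variable f : T1 * T2 -> \bar R.
Hypothesis fi : (m1 \x m2).-integrable setT f.

Lemma integral_prod0_l : {ae m1, forall x, \int[m2]_y f (x, y) = 0} ->
  \int[m1 \x m2]_z f z = 0.
Proof.
move=> f0; rewrite -integral12_prod_meas1// (ae_eq_integral (cst 0))//.
- exact: integral0.
- exact: measurable_int (integrable_fubini_F fi).
- by apply: (@filterS _ _ (ae_filter_ringOfSetsType m1)) f0 => x + _.
Qed.

Lemma integral_prod0_r : {ae m2, forall y, \int[m1]_x f (x, y) = 0} ->
  \int[m1 \x m2]_z f z = 0.
Proof.
move=> f0; rewrite -integral21_prod_meas1// (ae_eq_integral (cst 0))//.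
- exact: integral0.
- exact (measurable_fubini_G fi).
- by apply: (@filterS _ _ (ae_filter_ringOfSetsType m2)) f0 => x + _.
Qed.

End integral_product0.

Section weak_derivative_of_C1.
Context {R : realType}.
Local Notation MR := (measurableTypeR R).
Local Notation T3 := (MR * MR * MR)%type.
Local Notation leb := (@lebesgue_measure R).
Local Notation Rpos := (`]0, +oo[%classic : set R).
Implicit Types (u v du : R -> R) (x : R * R * R) (r t : R) (i j : 'I_3).

Lemma leb3_cube3_fin (n : R) : 0 <= n -> (@leb3 R (cube3 n) < +oo)%E.
Proof.
move=> n0; rewrite /cube3; set I : set MR := `[- n, n]%classic.
have mI : measurable I by exact: measurable_itv.
have l : leb I = (n + n)%:E.
  rewrite lebesgue_measure_itv/= lte_fin; case: ltgtP => H.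
  - by rewrite -EFinB opprK.
  - have H0 : n < 0 by lra.
    by move: H0; rewrite ltNge n0.
  - by congr EFin; lra.
have mII : measurable (I `*` I) by exact: measurableX.
have E2 : @leb2 R (I `*` I) = (leb I * leb I)%E by exact: product_measure1E.
have -> : @leb3 R ((I `*` I) `*` I) = (@leb2 R (I `*` I) * leb I)%E.
  exact: (@product_measure1E _ _ _ _ _ (@leb2 R) leb).
by rewrite E2 l -!EFinM ltry.
Qed.

Lemma bounded_radial_loc_integrable u (M : R) : measurable_fun Rpos u ->
  (forall r, 0 < r -> `|u r| <= M) -> radial_loc_integrable u.
Proof.
move=> mu uM K cK.
have mru : measurable_fun (setT : set T3) (radial u) by exact: measurable_radial.
have [n n0 Kn] := compact_sub_cube3 cK.
have mK : measurable (K : set T3).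
  rewrite -[K]setCK; apply: measurableC; apply: open3_measurable.
  apply: closed_openC; apply: compact_closed cK; exact: norm_hausdorff.
(* The hypothesis does not cover the origin, where the profile has the arbitrary value [u 0]. *)
pose N : R := `|M| + `|u 0|.
have uN (x : T3) : `|radial u x| <= N.
  rewrite /radial /N; have := enorm3_ge0 x; rewrite le_eqVlt => /predU1P[<-|e0].
    by rewrite lerDr.
  by rewrite (le_trans (uM _ e0))// (le_trans (ler_norm M))// lerDl.
have cn : (@leb3 R).-integrable (cube3 n) (EFin \o cst N).
  apply/integrableP; split; first exact/measurable_EFinP.
  rewrite (_ : (fun x => _) = cst (`|N|)%:E)// integral_cst; last exact: measurable_cube3.
  by rewrite lte_mul_pinfty// ?lee_fin// leb3_cube3_fin.
have cK' : (@leb3 R).-integrable K (EFin \o cst N).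
  by apply: integrableS cn => //; exact: measurable_cube3.
apply: le_integrable cK' => //.
  by apply/measurable_EFinP; exact: measurable_funTS.
have N0 : 0 <= N by rewrite addr_ge0.
by move=> x _ /=; rewrite lee_fin (ger0_norm N0).
Qed.

Lemma null_set1_ae : {ae leb, forall t, t != 0}.
Proof.
exists [set 0]; split => //; first exact: lebesgue_measure_set1.
by move=> t /= /negP; rewrite negbK => /eqP.
Qed.

(** By Fubini's theorem almost all lines parallel to the i-th axis suffice. The conditions on x
    describe lines that miss the origin, where x / |x| is singular. *)
Lemma integral_leb3_lines0 (f : R * R * R -> R) i :
  (@leb3 R).-integrable setT (EFin \o f) ->
  (forall x j, j != i -> coord3 i x = 0 -> coord3 j x != 0 ->
     (\int[leb]_t (f (t *: basis3 i + x))%:E = 0)%E) ->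
  (\int[leb3]_x (f x)%:E = 0)%E.
Proof.
move=> fi f0.
have fi2 : ((@leb2 R) \x leb)%E.-integrable setT (EFin \o f) by [].
have t1 x t : t *: basis3 i + x = (t * (val i == 0%N)%:R + x.1.1,
   t * (val i == 1%N)%:R + x.1.2, t * (val i == 2%N)%:R + x.2) by case: x => [[]].
case: i f0 t1 => [[|[|[|//]]] ?] f0 t1.
- have -> : (\int[leb3]_x (f x)%:E = \int[((@leb2 R) \x leb)%E]_x (EFin \o f) x)%E by [].
  apply: integral_prod0_r => //.
  have := ae_integrable2 fi2; have := null_set1_ae.
  apply: (@filterS2 _ _ (ae_filter_ringOfSetsType leb)) => z z0 fz.
  have {}fz : (leb \x leb)%E.-integrable setT (fun p => (f (p, z))%:E) by [].
  have -> : (\int[@leb2 R]_p (EFin \o f) (p, z) =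
    \int[(leb \x leb)%E]_p (f (p, z))%:E)%E by [].
  apply: integral_prod0_r => //; apply: aeW => y.
  rewrite -[RHS](f0 (0, y, z) ord_max)//; apply: eq_integral => t _.
  by rewrite t1/= mulr1 !mulr0 !add0r addr0.
- have -> : (\int[leb3]_x (f x)%:E = \int[((@leb2 R) \x leb)%E]_x (EFin \o f) x)%E by [].
  apply: integral_prod0_r => //.
  have := ae_integrable2 fi2; have := null_set1_ae.
  apply: (@filterS2 _ _ (ae_filter_ringOfSetsType leb)) => z z0 fz.
  have {}fz : (leb \x leb)%E.-integrable setT (fun p => (f (p, z))%:E) by [].
  have -> : (\int[@leb2 R]_p (EFin \o f) (p, z) =
    \int[(leb \x leb)%E]_p (f (p, z))%:E)%E by [].
  apply: integral_prod0_l => //; apply: aeW => y.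
  rewrite -[RHS](f0 (y, 0, z) ord_max)//; apply: eq_integral => t _.
  by rewrite t1/= mulr1 !mulr0 !add0r addr0.
- have -> : (\int[leb3]_x (f x)%:E = \int[((@leb2 R) \x leb)%E]_x (EFin \o f) x)%E by [].
  apply: integral_prod0_l => //.
  (* Here the lines are indexed by the plane of the first two coordinates, and only its point (0, 0)
     is exceptional; for the other two directions the slice z = 0 was discarded instead. *)
  exists ([set 0] `*` [set 0]); split; first exact: measurableX.
    have E2 : @leb2 R ([set 0] `*` [set 0]) = (leb [set 0%R] * leb [set 0%R])%E.
      exact: product_measure1E.
    by apply: (etrans E2); rewrite lebesgue_measure_set1 mule0.
  move=> [a b] /= nab; have [a0|a0] := eqVneq a 0; last first.
    exfalso; apply: nab; rewrite -[RHS](f0 (a, b, 0) ord0)//.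
    by apply: eq_integral => t _; rewrite t1/= mulr1 !mulr0 !add0r addr0.
  have [b0|b0] := eqVneq b 0; first by [].
  exfalso; apply: nab; rewrite -[RHS](f0 (a, b, 0) 1)//.
  by apply: eq_integral => t _; rewrite t1/= mulr1 !mulr0 !add0r addr0.
Qed.

Lemma enorm3_axis_line i x t : coord3 i x = 0 ->
  enorm3 (t *: basis3 i + x) = Num.sqrt (enorm3 x ^+ 2 + t ^+ 2).
Proof.
move=> xi0; rewrite -[LHS]ger0_norm ?enorm3_ge0// -sqrtr_sqr enorm3_line xi0.
by rewrite mulr0 addr0.
Qed.

(** Boundedness of u and du makes all integrands integrable on R^3, so the origin matters only on
    the line through it. On every other parallel line the integrand is the continuous derivative of
    a compactly supported function, and its integral is 0. *)
Lemma weak_radial_derivative_C1 u du (M : R) :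
  (forall r, 0 < r -> is_derive r 1 u (du r)) ->
  (forall r, 0 < r -> {for r, continuous du}) ->
  (forall r, 0 < r -> `|u r| <= M) -> (forall r, 0 < r -> `|du r| <= M) ->
  weak_radial_derivative u du.
Proof.
move=> ud cdu uM duM.
have cm v : (forall r, 0 < r -> {for r, continuous v}) -> measurable_fun Rpos v.
  move=> cv; apply: open_continuous_measurable_fun; first exact: interval_open.
  by move=> r; rewrite inE/= in_itv/= andbT => r0; exact: cv.
have mu : measurable_fun Rpos u.
  by apply: cm => r r0; exact: is_derive1_continuous (ud r r0).
have ui := bounded_radial_loc_integrable mu uM.
have dui := bounded_radial_loc_integrable (cm _ cdu) duM.
split=> // phi i tphi; have [dphi cdphi _] := tphi.
have [n [N [n0 phiN dphiN phi0 dphi0]]] := test_function3_bounds tphi.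
have cphi : continuous phi by move=> x; exact: differentiable_continuous.
pose dir (x : R * R * R) : R := coord3 i x / enorm3 x.
have i1 := integrable_loc_mul ui (continuous3_measurable (cdphi i)) (dphiN i) (dphi0 i).
have mdir : measurable_fun setT ((fun x => dir x * phi x) : T3 -> R).
  apply: measurable_funM; first exact: measurable_direction3.
  exact: continuous3_measurable.
have dirN (x : R * R * R) : `|dir x * phi x| <= N.
  rewrite normrM -[leRHS]mul1r ler_pM//; exact: direction3_le1.
have dir0 (x : R * R * R) : ~ cube3 n x -> dir x * phi x = 0.
  by move=> /phi0 ->; rewrite mulr0.
have i2 := integrable_loc_mul dui mdir dirN dir0.
pose f (x : R * R * R) := radial u x * pderiv3 i phi x + radial du x * (dir x * phi x).
have fi : (@leb3 R).-integrable setT (EFin \o f).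
  exact: (integrable_add measurableT i1 i2).
suff f0 : \int[leb3]_x f x = 0.
  apply/eqP; rewrite -subr_eq0 opprK; apply/eqP; rewrite -[RHS]f0 /f.
  rewrite (RintegralD measurableT i1 i2); congr (_ + _).
  by apply: eq_Rintegral => x _; rewrite -(mulrA (radial du x)).
rewrite /Rintegral (integral_leb3_lines0 (i := i))// => x j ji xi0 xj0.
have e0 : 0 < enorm3 x ^+ 2.
  rewrite exprn_gt0// (lt_le_trans _ (coord3_le_enorm3 j x))// normr_gt0//.
have et t : 0 < enorm3 (t *: basis3 i + x).
  by rewrite enorm3_axis_line// sqrtr_gt0 ltr_wpDr// sqr_ge0.
have ft t : is_derive t 1
   (fun s => radial u (s *: basis3 i + x) * phi (s *: basis3 i + x))
   (f (t *: basis3 i + x)).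
  have d1 : is_derive t 1 (fun s : R => enorm3 x ^+ 2 + s ^+ 2) (2 * t).
    have /is_derive_eq := is_derive1D (is_derive_cst (enorm3 x ^+ 2) t (1 : R))
      (is_derive1X 2 (is_derive_id t (1 : R))); apply.
    by rewrite /= expr1 add0r mulr1.
  have s0 : 0 < enorm3 x ^+ 2 + t ^+ 2 by rewrite ltr_wpDr// sqr_ge0.
  have d2 := @is_derive1_comp _ Num.sqrt (fun s : R => enorm3 x ^+ 2 + s ^+ 2)
    _ _ _ (is_derive1_sqrt s0) d1.
  have eE : (fun s => enorm3 (s *: basis3 i + x)) =
      Num.sqrt \o (fun s : R => enorm3 x ^+ 2 + s ^+ 2).
    by apply/funext => s; rewrite /= enorm3_axis_line.
  have d3 : is_derive t 1 (fun s => enorm3 (s *: basis3 i + x)) (dir (t *: basis3 i + x)).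
    rewrite eE; apply: is_derive_eq d2 _.
    rewrite /dir coord3_line xi0 eqxx mulr1 addr0 enorm3_axis_line//.
    by field; rewrite gt_eqF// sqrtr_gt0.
  have d4 := @is_derive1_comp _ u (fun s => enorm3 (s *: basis3 i + x)) _ _ _ (ud _ (et t)) d3.
  have d5 : is_derive t 1 (fun s => phi (s *: basis3 i + x)) (pderiv3 i phi (t *: basis3 i + x)).
    by apply/is_derive_line; apply: DeriveDef => //; exact: diff_derivable.
  by have /is_derive_eq := is_derive1M d4 d5; apply; rewrite /f /radial /=; ring.
have cline : continuous (fun s : R => s *: basis3 i + x).
  by move=> s; apply: cvgD; [apply: cvgZl; exact: cvg_id|exact: cvg_cst].
have cnorm : continuous (fun s : R => enorm3 (s *: basis3 i + x)).
  by move=> s; apply: continuous_comp (cline s) _; exact: enorm3_continuous.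
have cf : continuous (fun s : R => f (s *: basis3 i + x)).
  move=> s; apply: cvgD; apply: cvgM.
  - apply: (@continuous_comp _ _ _ (fun s : R => enorm3 (s *: basis3 i + x)) u).
      exact: cnorm.
    exact: is_derive1_continuous (ud _ (et s)).
  - by apply: continuous_comp (cline s) _; exact: cdphi.
  - apply: (@continuous_comp _ _ _ (fun s : R => enorm3 (s *: basis3 i + x)) du).
      exact: cnorm.
    exact: cdu.
  - apply: cvgM; last by apply: continuous_comp (cline s) _; exact: cphi.
    apply: cvgM; first by apply: continuous_comp (cline s) _; exact: coord3_continuous.
    by apply: cvgV; [rewrite gt_eqF|exact: cnorm].
have out (s : R) : n < `|s| -> ~ cube3 n (s *: basis3 i + x).
  move=> ns /cube3P[]; move: xi0; rewrite /coord3.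
  case: (i) => [[|[|[|//]]] ?] /= xi0; rewrite ?mulr1 ?mulr0 xi0 addr0 => H1 H2 H3;
  move: H1 H2 H3; rewrite /GRing.scale/= mulr1 => H1 H2 H3;
  by move: ns; rewrite ltNge ?H1 ?H2 ?H3.
have f_out (s : R) : n < `|s| -> f (s *: basis3 i + x) = 0.
  by move=> /out so; rewrite /f dphi0// dir0// !mulr0 addr0.
(* The end points are n + 1 and not n, so that they lie strictly outside the cube, where phi
   vanishes. *)
pose I : set MR := `[- (n + 1), n + 1]%classic.
have -> : (\int[leb]_t (f (t *: basis3 i + x))%:E =
    \int[leb]_(t in I) (f (t *: basis3 i + x))%:E)%E.
  rewrite [RHS]integral_mkcond; apply: eq_integral => t _.
  rewrite patchE; case: ifPn => // /negP tI; rewrite f_out//.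
  rewrite ltNge; apply: contra_notN tI => tn; rewrite inE /I /= in_itv/= -ler_norml.
  by rewrite (le_trans tn)// lerDl.
have nn : - (n + 1) <= n + 1 by lra.
have := integral_is_derive nn (fun t _ => ft t) (continuous_subspaceT cf).
rewrite /I => ->.
have n1 : n < `|n + 1| by rewrite ger0_norm ?ltrDl// addr_ge0.
by rewrite !phi0 ?mulr0 ?subrr//; apply: out => //; rewrite normrN.
Qed.

End weak_derivative_of_C1.

(** * Bounded pointwise limits of weak derivatives *)

Section weak_derivative_limits.
Context {R : realType}.
Local Notation MR := (measurableTypeR R).
Local Notation T3 := (MR * MR * MR)%type.
Local Notation leb := (@lebesgue_measure R).
Local Notation Rpos := (`]0, +oo[%classic : set R).
Implicit Types (u v : R -> R).

Lemma Rintegral_radial_ae u u' (g : R * R * R -> R) :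
  measurable_fun (setT : set T3) (radial u) ->
  measurable_fun (setT : set T3) (radial u') ->
  measurable_fun (setT : set T3) g -> radial_ae_eq u u' ->
  \int[leb3]_x (radial u x * g x) = \int[leb3]_x (radial u' x * g x).
Proof.
move=> mu mu' mg uu'; rewrite /Rintegral; congr fine; apply: ae_eq_integral => //.
- by apply/measurable_EFinP; exact: measurable_funM.
- by apply/measurable_EFinP; exact: measurable_funM.
- have := radial_ae_eq_leb3 uu'.
  by apply: (@filterS _ _ (ae_filter_ringOfSetsType (@leb3 R))) => x ux _; rewrite ux.
Qed.

Lemma weak_radial_derivative_ae u u' v v' :
  radial_ae_eq u u' -> radial_ae_eq v v' ->
  radial_loc_integrable u' -> radial_loc_integrable v' ->
  weak_radial_derivative u v -> weak_radial_derivative u' v'.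
Proof.
move=> uu' vv' ui' vi' [ui vi uv]; split => // phi i tphi.
have [dphi cdphi _] := tphi.
have cphi : continuous phi by move=> x; exact: differentiable_continuous.
have mu := radial_loc_integrable_measurable ui.
have mv := radial_loc_integrable_measurable vi.
have mu' := radial_loc_integrable_measurable ui'.
have mv' := radial_loc_integrable_measurable vi'.
have A (w : R -> R) : \int[leb3]_x (radial w x * (coord3 i x / enorm3 x) * phi x) =
    \int[leb3]_x (radial w x * ((coord3 i x / enorm3 x) * phi x)).
  by apply: eq_Rintegral => x _; rewrite -(mulrA (radial w x)).
have md := @measurable_direction3 R i.
rewrite -(@Rintegral_radial_ae u u')//; last exact: continuous3_measurable.
rewrite uv// !A (@Rintegral_radial_ae v v')//.
by apply: measurable_funM => //; exact: continuous3_measurable.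
Qed.

(** Bounds and limits are known for r > 0 only. With the value 0 elsewhere they hold everywhere, and
    the class up to [radial_ae_eq] is unchanged. *)
Let patch0 u (r : R) : R := if 0 < r then u r else 0.

Let patch0_ae u : radial_ae_eq u (patch0 u).
Proof.
by exists set0; split => // r /= nH; apply: nH => r0; rewrite /patch0 r0.
Qed.

Let patch0_measurable u : measurable_fun Rpos u -> measurable_fun Rpos (patch0 u).
Proof.
apply: eq_measurable_fun => r; rewrite inE/= in_itv/= andbT => r0.
by rewrite /patch0 r0.
Qed.

Let patch0_bound u (M : R) : (forall r, 0 < r -> `|u r| <= M) ->
  forall r, `|patch0 u r| <= `|M|.
Proof.
move=> uM r; rewrite /patch0; case: ifPn => r0; last by rewrite normr0.
by rewrite (le_trans (uM r r0))// ler_norm.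
Qed.

Let Rintegral_radial_cvg (u_ : nat -> R -> R) u (g : R * R * R -> R) (M N n : R) :
  (forall k, measurable_fun (setT : set T3) (radial (u_ k))) ->
  (forall k r, `|u_ k r| <= M) ->
  (forall r, u_ k r @[k --> \oo] --> u r) ->
  0 <= n -> measurable_fun (setT : set T3) g ->
  (forall x, `|g x| <= N) -> (forall x, ~ cube3 n x -> g x = 0) ->
  \int[leb3]_x (radial (u_ k) x * g x) @[k --> \oo] --> \int[leb3]_x (radial u x * g x).
Proof.
move=> mu uM cu n0 mg gN g0.
have M0 : 0 <= M by exact: le_trans (uM 0%N 0).
have cM : radial_loc_integrable (fun=> M).
  by apply: (@bounded_radial_loc_integrable _ _ M) => // r _; rewrite ger0_norm.
have gi := integrable_loc_mul cM mg gN g0.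
have [||||//] := @Rintegral_dominated_cvg _ T3 R leb3 setT
  (fun k x => radial (u_ k) x * g x) (fun x => radial u x * g x)
  (fun x => `|M * g x|) measurableT.
- by move=> k; apply: measurable_funM => //; exact: mu.
- by move=> x _; apply: cvgM; [exact: cu|exact: cvg_cst].
- exact: integrable_norm gi.
- by move=> k x _; rewrite !normrM ler_wpM2r// (ger0_norm M0); exact: uM.
Qed.

Lemma weak_radial_derivative_cvg (u_ v_ : nat -> R -> R) u v (M : R) :
  (forall k, weak_radial_derivative (u_ k) (v_ k)) ->
  (forall k r, 0 < r -> `|u_ k r| <= M) -> (forall k r, 0 < r -> `|v_ k r| <= M) ->
  (forall r, 0 < r -> u_ k r @[k --> \oo] --> u r) ->
  (forall r, 0 < r -> v_ k r @[k --> \oo] --> v r) ->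
  weak_radial_derivative u v.
Proof.
move=> uv uM vM cu cv.
have lim (w_ : nat -> R -> R) w : (forall r, 0 < r -> w_ k r @[k --> \oo] --> w r) ->
    (forall k r, 0 < r -> `|w_ k r| <= M) ->
    (forall k, radial_loc_integrable (w_ k)) ->
    [/\ radial_loc_integrable w, forall k, radial_loc_integrable (patch0 (w_ k)),
      radial_loc_integrable (patch0 w),
      forall k, measurable_fun (setT : set T3) (radial (patch0 (w_ k))) &
      forall r, patch0 (w_ k) r @[k --> \oo] --> patch0 w r].
  move=> cw wM wi.
  have mw_ k : measurable_fun Rpos (w_ k).
    by apply: measurable_profile_pos; exact: radial_loc_integrable_measurable.
  have mw : measurable_fun Rpos w.
    apply: (measurable_fun_cvg mw_) => r /=; rewrite in_itv/= andbT; exact: cw.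
  have wM' r : 0 < r -> `|w r| <= M.
    move=> r0; have c : (fun k => `|w_ k r|) @ \oo --> `|w r| by exact: cvg_norm (cw r r0).
    apply: (@closed_cvg _ _ \oo _ (fun k => `|w_ k r|) (fun x : R => x <= M) _ _ _ c).
      exact: closed_le.
    by apply: nearW => k; exact: wM.
  split.
  - exact: bounded_radial_loc_integrable mw wM'.
  - move=> k; apply: (bounded_radial_loc_integrable (patch0_measurable (mw_ k))).
    by move=> r _; exact: patch0_bound (wM k) r.
  - apply: (bounded_radial_loc_integrable (patch0_measurable mw)).
    by move=> r _; exact: patch0_bound wM' r.
  - by move=> k; apply: measurable_radial; exact: patch0_measurable.
  - move=> r; rewrite /patch0; case: ifPn => r0; first exact: cw.
    exact: cvg_cst.
have [ui ui_ pui mu_ cu'] := lim u_ u cu uM (fun k => let: And3 a _ _ := uv k in a).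
have [vi vi_ pvi mv_ cv'] := lim v_ v cv vM (fun k => let: And3 _ a _ := uv k in a).
suff : weak_radial_derivative (patch0 u) (patch0 v).
  by apply: weak_radial_derivative_ae => //; apply: radial_ae_eq_sym; exact: patch0_ae.
split=> // phi i tphi; have [dphi cdphi _] := tphi.
have [n [N [n0 phiN dphiN phi0 dphi0]]] := test_function3_bounds tphi.
have cphi : continuous phi by move=> x; exact: differentiable_continuous.
have mdphi : measurable_fun (setT : set T3) (pderiv3 i phi) by exact: continuous3_measurable.
pose g (x : R * R * R) := coord3 i x / enorm3 x * phi x.
have mg : measurable_fun (setT : set T3) g.
  by apply: measurable_funM; [exact: measurable_direction3|exact: continuous3_measurable].
have gN (x : R * R * R) : `|g x| <= N.
  rewrite normrM -[leRHS]mul1r ler_pM//; exact: direction3_le1.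
have g0 (x : R * R * R) : ~ cube3 n x -> g x = 0.
  by move=> /phi0; rewrite /g => ->; rewrite mulr0.
have L1 := Rintegral_radial_cvg mu_ (fun k => patch0_bound (uM k)) cu' n0 mdphi
  (dphiN i) (dphi0 i).
have L2 := Rintegral_radial_cvg mv_ (fun k => patch0_bound (vM k)) cv' n0 mg gN g0.
have A (w : R -> R) : \int[leb3]_x (radial w x * (coord3 i x / enorm3 x) * phi x) =
    \int[leb3]_x (radial w x * g x).
  by apply: eq_Rintegral => x _; rewrite -(mulrA (radial w x)).
rewrite A.
have {}L2 := cvgN L2; have {}L2 := L2 eventually_filter.
apply: (@cvg_unique _ (@Rhausdorff R) _ _ _ _ L1).
apply: cvg_trans L2; apply: near_eq_cvg; apply: nearW => k /=.
have [_ _ H] : weak_radial_derivative (patch0 (u_ k)) (patch0 (v_ k)).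
  by apply: weak_radial_derivative_ae (uv k) => //; exact: patch0_ae.
by rewrite H// A.
Qed.

End weak_derivative_limits.

(** * Radial Lebesgue spaces *)

Section radial_Lebesgue_spaces.
Context {R : realType}.
Local Notation MR := (measurableTypeR R).
Local Notation T3 := (MR * MR * MR)%type.
Local Notation leb := (@lebesgue_measure R).
Local Notation Rpos := (`]0, +oo[%classic : set R).
Implicit Types (u v F : R -> R).

Let mRpos : measurable (Rpos : set MR). Proof. exact: measurable_itv. Qed.

Lemma measurable_continuous_half_line u :
  (forall r, 0 < r -> {for r, continuous u}) -> measurable_fun Rpos u.
Proof.
move=> cu; apply: open_continuous_measurable_fun; first exact: interval_open.
by move=> r; rewrite inE/= in_itv/= andbT => r0; exact: cu.
Qed.

Lemma integrable_half_line_le u v : measurable_fun (Rpos : set MR) u ->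
  (forall r, 0 < r -> `|u r| <= v r) ->
  leb.-integrable Rpos (EFin \o v) -> leb.-integrable Rpos (EFin \o u).
Proof.
move=> mu uv; apply: le_integrable => //; first exact/measurable_EFinP.
move=> r; rewrite /= in_itv/= andbT => r0; rewrite lee_fin.
by rewrite (le_trans (uv r r0))// ler_norm.
Qed.

Lemma integrable_expR (k : R) : 0 < k ->
  leb.-integrable Rpos (EFin \o (fun r => expR (- k * r))).
Proof.
move=> k0; have := integrable_exponential_pdf k0 => ki.
have kiP : leb.-integrable (Rpos : set MR) (EFin \o (fun r => k^-1 * exponential_pdf k r)).
  by apply: (integrable_scale mRpos); apply: integrableS ki.
apply: integrable_half_line_le kiP.
  apply: measurable_continuous_half_line => r _.
  apply: (@continuous_comp _ _ _ (fun r => - k * r) (@expR R)).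
    by apply: cvgM; [exact: cvg_cst|exact: cvg_id].
  exact: continuous_expR.
move=> r r0; rewrite ger0_norm ?expR_ge0// exponential_pdfE ?(ltW r0)//.
by rewrite mulrA mulVf ?gt_eqF// mul1r.
Qed.

Lemma sqr_le_expR (k r : R) : 0 < k -> 0 <= r -> r ^+ 2 <= 2 / k ^+ 2 * expR (k * r).
Proof.
move=> k0 r0; have := @expR_ge1Dxn R (k * r) 1 (mulr_ge0 (ltW k0) r0).
have -> : (2`!)%:R = 2 :> R by [].
move=> H; have k2 : 0 < k ^+ 2 by rewrite exprn_gt0.
have {}H : (k * r) ^+ 2 / 2 <= expR (k * r) by lra.
rewrite mulrAC ler_pdivlMr// -ler_pdivrMl//.
by apply: le_trans H; rewrite exprMn; lra.
Qed.

Lemma radial_weight_expR_integrable (k : R) : 0 < k ->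
  leb.-integrable Rpos (EFin \o (fun r => expR (- k * r) * radial_weight r)).
Proof.
(* Half of the exponential rate is spent on absorbing the r^2 of the weight. *)
move=> k0; pose h := k / 2; have h0 : 0 < h by rewrite divr_gt0.
pose C : R := 3 * ball3_measure * (2 / h ^+ 2).
have /(integrable_scale mRpos C) Ci := integrable_expR h0.
apply: integrable_half_line_le Ci.
  apply: measurable_funM.
    by apply/measurable_EFinP; exact: measurable_int (integrable_expR k0).
  by apply: measurable_funTS; exact: measurable_radial_weight.
move=> r r0; rewrite ger0_norm; last first.
  by apply: mulr_ge0; [exact: expR_ge0|exact: radial_weight_ge0].
rewrite radial_weightE ?(ltW r0)// /C.
have -> : expR (- h * r) = expR (- k * r) * expR (h * r).
  by rewrite -expRD; congr expR; rewrite /h; lra.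
have := sqr_le_expR h0 (ltW r0); have := expR_gt0 (- k * r) => e0 H.
have b0 := @ball3_measure_gt0 R.
have c0 : 0 <= 3 * ball3_measure * expR (- k * r) by rewrite !mulr_ge0 ?expR_ge0 ?(ltW b0)//.
have := ler_wpM2l c0 H; move: (h ^+ 2) (expR (h * r)) => h2 eh.
by congr (_ <= _); ring.
Qed.

Lemma integral_half_line_ae u v : measurable_fun (Rpos : set MR) u ->
  measurable_fun (Rpos : set MR) v -> radial_ae_eq u v ->
  (\int[leb]_(r in Rpos) (u r)%:E = \int[leb]_(r in Rpos) (v r)%:E)%E.
Proof.
move=> mu mv uv; apply: ae_eq_integral => //; try exact/measurable_EFinP.
move: uv; apply: (@filterS _ _ (ae_filter_ringOfSetsType leb)) => r uv.
by rewrite /= in_itv/= andbT => r0; rewrite uv.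
Qed.

Lemma integral_radial_powR u (p : R) :
  measurable_fun (setT : set T3) (radial u) ->
  (\int[leb3]_x `|(radial u x)%:E| `^ p =
   \int[leb]_(r in Rpos) (`|u r| `^ p * radial_weight r)%:E)%E.
Proof.
move=> mu; rewrite -integral_radial//.
have : measurable_fun (setT : set T3) (fun x : T3 => `|radial u x| `^ p).
  by apply: (measurableT_comp (measurable_powR _)); exact: measurableT_comp.
by [].
Qed.

(** The p-th power of the bound is again an exponential, of rate p sigma, so all exponents are
    treated alike. *)
Lemma radial_Lp_expR u F (p C sigma : R) : 1 <= p -> 0 < sigma ->
  radial_loc_integrable u -> radial_ae_eq u F ->
  measurable_fun (Rpos : set MR) F ->
  (forall r, 0 < r -> `|F r| <= C * expR (- sigma * r)) ->
  radial_Lp p u.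
Proof.
move=> p1 s0 ui uF mF FC.
have p0 : 0 < p by rewrite (lt_le_trans _ p1).
have mu := radial_loc_integrable_measurable ui.
have mup := measurable_profile_pos mu.
have mw : measurable_fun (Rpos : set MR) (@radial_weight R).
  by apply: measurable_funTS; exact: measurable_radial_weight.
have mpow (w : R -> R) : measurable_fun (Rpos : set MR) w ->
    measurable_fun (Rpos : set MR) (EFin \o (fun r : R => `|w r| `^ p * radial_weight r)).
  move=> mw'; apply/measurable_EFinP; apply: measurable_funM => //.
  by apply: (measurableT_comp (measurable_powR _)); exact: measurableT_comp.
apply/andP; split; first by rewrite inE.
rewrite inE /finite_norm unlock; apply: poweR_lty.
rewrite integral_radial_powR//.
rewrite (@integral_half_line_ae _ (fun r => `|F r| `^ p * radial_weight r)).
- have ki : 0 < p * sigma by rewrite mulr_gt0.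
  have /(integrable_scale mRpos (`|C| `^ p)) := radial_weight_expR_integrable ki.
  move=> /integrableP[mi]; apply: le_lt_trans; apply: ge0_le_integral => //.
  + by move=> r _; rewrite lee_fin; apply: mulr_ge0; [exact: powR_ge0|exact: radial_weight_ge0].
  + exact: mpow.
  + exact: measurableT_comp.
  + move=> r; rewrite /= in_itv/= andbT => r0; rewrite lee_fin.
    apply: le_trans (ler_norm _); rewrite mulrA.
    apply: ler_wpM2r; first exact: radial_weight_ge0.
    have -> : `|C| `^ p * expR (- (p * sigma) * r) = (`|C| * expR (- sigma * r)) `^ p.
      rewrite powRM ?expR_ge0// -expRM.
      by congr (_ * _); congr expR; ring.
    apply: ge0_ler_powR; rewrite ?nnegrE ?mulr_ge0 ?expR_ge0 ?(ltW p0)//.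
    apply: le_trans (FC r r0) _.
    by rewrite ler_wpM2r ?expR_ge0// ler_norm.
- by apply/measurable_EFinP; exact: mpow.
- by apply/measurable_EFinP; exact: mpow.
- move: uF; apply: (@filterS _ _ (ae_filter_ringOfSetsType leb)) => r uF.
  by move=> r0; rewrite uF.
Qed.

(** The exponent 4 is even, so the absolute value drops out and the integrand is a polynomial in F
    and r. *)
Lemma radial_Lp4_integrable u F : radial_Lp 4 u -> radial_ae_eq u F ->
  measurable_fun (Rpos : set MR) F ->
  leb.-integrable Rpos (EFin \o (fun r => F r ^+ 4 * r ^+ 2)).
Proof.
move=> uL uF mF.
have mu : measurable_fun (setT : set T3) (radial u).
  by move: uL => /andP[]; rewrite inE.
have mup := measurable_profile_pos mu.
have p1 : (1 : R) <= 4 by lra.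
have := Lfun_integrable p1 uL => /integrableP[_].
have mpow (w : R -> R) : measurable_fun (Rpos : set MR) w ->
    measurable_fun (Rpos : set MR) (fun r : R => `|w r| `^ 4 * radial_weight r).
  move=> mw; apply: measurable_funM => //; last first.
    by apply: measurable_funTS; exact: measurable_radial_weight.
  by apply: (measurableT_comp (measurable_powR _)); exact: measurableT_comp.
have -> : (\int[leb3]_x `|(`|radial u x| `^ 4)%:E| =
    \int[leb3]_x `|(radial u x)%:E| `^ 4)%E.
  by apply: eq_integral => x _; rewrite /= ger0_norm// powR_ge0.
rewrite integral_radial_powR//.
rewrite (@integral_half_line_ae _ (fun r => `|F r| `^ 4 * radial_weight r)); last 3 first.
- exact: mpow.
- exact: mpow.
- move: uF; apply: (@filterS _ _ (ae_filter_ringOfSetsType leb)) => r uF.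
  by move=> r0; rewrite uF.
move=> foo.
have Fi : leb.-integrable Rpos (EFin \o (fun r => `|F r| `^ 4 * radial_weight r)).
  apply/integrableP; split; first by apply/measurable_EFinP; exact: mpow.
  apply: le_lt_trans foo; rewrite le_eqVlt; apply/orP; left; apply/eqP.
  apply: eq_integral => r _; rewrite /= ger0_norm//.
  by apply: mulr_ge0; [exact: powR_ge0|exact: radial_weight_ge0].
have b0 := @ball3_measure_gt0 R.
have /(integrable_scale mRpos (3 * ball3_measure)^-1) := Fi.
apply: integrable_half_line_le.
  apply: measurable_funM; first exact: measurable_funX.
  exact: exprn_measurable.
move=> r r0; rewrite radial_weightE ?(ltW r0)//.
have F4 : 0 <= F r ^+ 4 by rewrite (_ : 4 = 2 * 2)%N// exprM sqr_ge0.
rewrite powR_mulrn// -normrX (ger0_norm F4) (ger0_norm (mulr_ge0 F4 (sqr_ge0 r))).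
by rewrite le_eqVlt; apply/orP; left; apply/eqP; field; rewrite gt_eqF.
Qed.

(** Turns an integrability statement into a bounded function with known derivative, the form in
    which the differential inequalities take it. *)
Lemma bounded_primitive (j : R -> R) :
  (forall r : R, 0 < r -> {for r, continuous j}) ->
  (forall r : R, 0 < r -> 0 <= j r) -> leb.-integrable Rpos (EFin \o j) ->
  exists (J : R -> R) (M : R), (forall r : R, 0 < r -> is_derive r 1 J (j r)) /\
    (forall r, 0 < r -> `|J r| <= M).
Proof.
move=> cj j0 ji; pose J (r : R) : R := \int[leb]_(t in `]0, r]) j t.
have sub r : `]0, r] `<=` Rpos.
  by move=> t /=; rewrite !in_itv/= andbT => /andP[].
have Ji r : leb.-integrable `]0, r] (EFin \o j).
  exact: (@integrableS _ MR R leb Rpos _ _ mRpos (measurable_itv _) (@sub r) ji).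
exists J, (\int[leb]_(t in Rpos) j t); split => r r0.
  have rr : r < r + 1 by rewrite ltrDl.
  have r0' : (BRight 0 < BRight r :> itv_bound R)%O by rewrite bnd_simp.
  have [d1 d2] := @continuous_FTC1 _ j (BRight 0) r (r + 1) rr (Ji _) r0' (cj r r0).
  by rewrite -d2 derive1E; exact/derivableP.
have pos A : measurable (A : set MR) -> A `<=` Rpos -> 0 <= \int[leb]_(t in A) j t.
  by move=> mA AR; apply: Rintegral_ge0 => t /AR /=; rewrite in_itv/= andbT => /j0.
rewrite ger0_norm; last by apply: pos; [exact: measurable_itv|exact: sub].
rewrite /J /Rintegral; apply: fine_le.
- by rewrite integrable_fin_num//; exact: Ji.
- by rewrite integrable_fin_num.
apply: (@ge0_subset_integral _ MR R leb _ _ (measurable_itv _) mRpos).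
- exact: measurable_int ji.
- by move=> t /=; rewrite in_itv/= andbT => t0; rewrite lee_fin j0.
- exact: sub.
Qed.

End radial_Lebesgue_spaces.

(** * Exponentially small profiles *)

Section exponentially_small.
Context {R : realType}.
Implicit Types (u v : R -> R) (r : R).

Definition bounded_half_line u : Prop := exists M : R, forall r, 0 < r -> `|u r| <= M.

(** Constants and rate are existential, so the class is closed under sums, bounded factors and
    dilations without tracking rates. It includes boundedness near 0. *)
Definition exp_small u : Prop :=
  exists C sigma : R, 0 < sigma /\ forall r, 0 < r -> `|u r| <= C * expR (- sigma * r).

Lemma exp_smallP u : exp_small u ->
  exists C sigma : R, [/\ 0 < C, 0 < sigma &
    forall r, 0 < r -> `|u r| <= C * expR (- sigma * r)].
Proof.
move=> [C [sigma [s0 uC]]]; exists (`|C| + 1), sigma; split=> // r r0.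
apply: (le_trans (uC r r0)); apply: ler_wpM2r; first exact: expR_ge0.
by rewrite (le_trans (ler_norm C))// lerDl.
Qed.

Lemma exp_small_bounded u : exp_small u -> bounded_half_line u.
Proof.
move=> /exp_smallP[C [s [C0 s0 uC]]]; exists C => r r0.
apply: (le_trans (uC r r0)); rewrite ler_piMr ?(ltW C0)//.
by rewrite -expR0 ler_expR mulNr oppr_le0 mulr_ge0// ltW.
Qed.

Lemma exp_small_add u v : exp_small u -> exp_small v ->
  exp_small (fun r => u r + v r).
Proof.
move=> /exp_smallP[C [s [C0 s0 uC]]] /exp_smallP[D [t [D0 t0 vD]]].
exists (C + D), (Num.min s t); split; first by rewrite lt_min s0.
move=> r r0; apply: (le_trans (ler_normD _ _)); rewrite mulrDl.
have e (k : R) : Num.min s t <= k -> expR (- k * r) <= expR (- Num.min s t * r).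
  by move=> sk; rewrite ler_expR ler_pM2r// lerN2.
apply: lerD.
  by apply: (le_trans (uC r r0)); rewrite ler_pM2l// e// ge_min lexx.
by apply: (le_trans (vD r r0)); rewrite ler_pM2l// e// ge_min lexx orbT.
Qed.

Lemma exp_small_mulr u v : exp_small u -> bounded_half_line v ->
  exp_small (fun r => v r * u r).
Proof.
move=> /exp_smallP[C [s [C0 s0 uC]]] [M vM].
exists (`|M| * C), s; split=> // r r0; rewrite normrM -mulrA.
apply: ler_pM => //; last exact: uC.
by rewrite (le_trans (vM r r0))// ler_norm.
Qed.

Lemma bounded_half_line_cst (k : R) : bounded_half_line (fun=> k).
Proof. by exists `|k|. Qed.

Lemma bounded_half_line_add u v : bounded_half_line u -> bounded_half_line v ->
  bounded_half_line (fun r => u r + v r).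
Proof.
move=> [M uM] [N vN]; exists (M + N) => r r0.
by rewrite (le_trans (ler_normD _ _))// lerD ?uM ?vN.
Qed.

Lemma bounded_half_line_mul u v : bounded_half_line u -> bounded_half_line v ->
  bounded_half_line (fun r => u r * v r).
Proof.
move=> [M uM] [N vN]; exists (M * N) => r r0.
by rewrite normrM ler_pM ?uM ?vN.
Qed.

Lemma exp_small_scale (k : R) u : exp_small u -> exp_small (fun r => k * u r).
Proof. by move=> us; apply: (@exp_small_mulr u (fun=> k)) => //; exact: bounded_half_line_cst. Qed.

Lemma exp_small_opp u : exp_small u -> exp_small (fun r => - u r).
Proof.
by move=> [C [s [s0 uC]]]; exists C, s; split=> // r r0; rewrite normrN uC.
Qed.

Lemma eq_exp_small u v : (forall r, 0 < r -> u r = v r) -> exp_small u -> exp_small v.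
Proof.
by move=> uv [C [s [s0 uC]]]; exists C, s; split=> // r r0; rewrite -uv// uC.
Qed.

Lemma exp_small_dilate u (k : R) : 0 < k -> exp_small u -> exp_small (fun r => u (k * r)).
Proof.
move=> k0 [C [s [s0 uC]]]; exists C, (s * k); split; first exact: mulr_gt0.
by move=> r r0; rewrite -mulNr -mulrA uC// mulr_gt0.
Qed.

Lemma exp_small_tail u (R0 M C sigma : R) : 0 < sigma ->
  (forall r, 0 < r <= R0 -> `|u r| <= M) ->
  (forall r, R0 <= r -> `|u r| <= C * expR (- sigma * r)) -> exp_small u.
Proof.
move=> s0 uM uC; exists (`|C| + `|M| * expR (sigma * R0)), sigma; split=> // r r0.
rewrite mulrDl -mulrA -expRD.
have [rR|Rr] := leP r R0.
  apply: (@le_trans _ _ (`|M| * expR (sigma * R0 + - sigma * r))); last first.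
    by rewrite lerDr mulr_ge0 ?expR_ge0.
  apply: (@le_trans _ _ M); first by rewrite uM// r0.
  apply: (le_trans (ler_norm M)); rewrite ler_peMr// -expR0 ler_expR.
  by rewrite mulNr subr_ge0 ler_pM2l.
apply: (@le_trans _ _ (`|C| * expR (- sigma * r))); last first.
  by rewrite lerDl mulr_ge0 ?expR_ge0.
by apply: (le_trans (uC r (ltW Rr))); rewrite ler_wpM2r ?expR_ge0// ler_norm.
Qed.

Lemma exp_small_div u (M : R) : exp_small u ->
  (forall r, 0 < r <= 1 -> `|u r / r| <= M) -> exp_small (fun r => u r / r).
Proof.
move=> [C [s [s0 uC]]] uM; apply: (@exp_small_tail _ 1 M C s) => // r r1.
have r0 : 0 < r by rewrite (lt_le_trans _ r1).
apply: le_trans (uC r r0); rewrite normrM ler_piMr//.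
by rewrite normfV gtr0_norm// invf_le1.
Qed.

(** Three regions: the given bound up to 1, compactness on [1, R0], and the decay beyond R0. *)
Lemma exp_small_continuous u (R0 M C sigma : R) : 0 < sigma ->
  (forall r, 0 < r -> {for r, continuous u}) ->
  (forall r, 0 < r <= 1 -> `|u r| <= M) ->
  (forall r, R0 <= r -> `|u r| <= C * expR (- sigma * r)) -> exp_small u.
Proof.
move=> s0 cu uM uC.
have /compact_bounded[B [Br BM]] : compact (u @` `[1, R0]).
  apply: continuous_compact; last exact: segment_compact.
  apply: continuous_in_subspaceT => r; rewrite inE/= in_itv/= => /andP[r1 _].
  by apply: cu; exact: lt_le_trans r1.
apply: (@exp_small_tail u R0 (Num.max M (`|B| + 1)) C sigma) => // r /andP[r0 rR].
rewrite le_max; have [r1|r1] := leP r 1; first by rewrite uM ?r0.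
apply/orP; right; apply: (BM (`|B| + 1)).
  by rewrite (le_lt_trans (ler_norm B))// ltrDl.
by exists r => //=; rewrite in_itv/= (ltW r1).
Qed.

End exponentially_small.

(** * Regularisation of the power nonlinearity *)

Section regularized_power.
Context {R : realType}.
Variable theta : R.
Hypothesis theta1 : 1 <= theta.
Implicit Types (x y U : R) (n : nat).

Definition reg_pow n x : R := (x ^+ 2 + n.+1%:R^-1) `^ (theta / 2).
Definition dreg_pow n x : R := theta * x * (x ^+ 2 + n.+1%:R^-1) `^ (theta / 2 - 1).
(** The derivative theta x |x|^(theta - 2) of |x|^theta. The factor x gives it the value 0 at 0,
    even for theta = 1, where no derivative exists; this is the limit of the regularised
    derivatives, all of which vanish at 0. *)
Definition dabs_pow x : R := theta * x * (x ^+ 2) `^ (theta / 2 - 1).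
Definition lip_pow U : R := theta * (U ^+ 2 + 1) `^ ((theta - 1) / 2).

Let reg_gt0 n x : 0 < x ^+ 2 + n.+1%:R^-1.
Proof. by rewrite ltr_wpDl ?sqr_ge0// invr_gt0. Qed.

Let base_derive n x : is_derive x 1 (fun t => t ^+ 2 + n.+1%:R^-1) (2 * x).
Proof.
have /is_derive_eq := is_derive1D (is_derive1X 2 (is_derive_id x (1 : R)))
  (is_derive_cst (n.+1%:R^-1 : R) x (1 : R)); apply.
by rewrite /= expr1 mulr1 addr0.
Qed.

Let base_powR_derive n (p x : R) :
  is_derive x 1 (fun t => (t ^+ 2 + n.+1%:R^-1) `^ p)
    (p * (x ^+ 2 + n.+1%:R^-1) `^ (p - 1) * (2 * x)).
Proof.
exact: (@is_derive1_comp _ (fun t => t `^ p) (fun t => t ^+ 2 + n.+1%:R^-1)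
  _ _ _ (is_derive1_powR _ (reg_gt0 n x)) (base_derive n x)).
Qed.

Lemma reg_pow_derive n x : is_derive x 1 (reg_pow n) (dreg_pow n x).
Proof.
have /is_derive_eq := base_powR_derive n (theta / 2) x; apply.
by rewrite /dreg_pow; field.
Qed.

Lemma dreg_pow_continuous n : continuous (dreg_pow n).
Proof.
move=> x; apply: cvgM.
  by apply: cvgM; [exact: cvg_cst|exact: cvg_id].
exact: is_derive1_continuous (base_powR_derive n (theta / 2 - 1) x).
Qed.

(** With B = x^2 + 1/(n+1) one has |x| <= B^(1/2), so the derivative is at most theta
    B^((theta-1)/2). As theta >= 1 this increases with B <= U^2 + 1, which makes the bound uniform
    in n. *)
Lemma dreg_pow_bound n U x : `|x| <= U -> `|dreg_pow n x| <= lip_pow U.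
Proof.
move=> xU; have th0 : 0 <= theta by rewrite (le_trans _ theta1).
set B := x ^+ 2 + n.+1%:R^-1; have B0 : 0 < B by exact: reg_gt0.
have xB : `|x| <= B `^ 2^-1.
  rewrite powR12_sqrt; last exact: ltW.
  rewrite -sqrtr_sqr ler_sqrt ?(ltW B0)//.
  by rewrite /B lerDl invr_ge0.
rewrite /dreg_pow -/B normrM normrM (ger0_norm th0) (ger0_norm (powR_ge0 _ _)).
rewrite /lip_pow -mulrA ler_wpM2l//.
apply: (@le_trans _ _ (B `^ 2^-1 * B `^ (theta / 2 - 1))).
  by rewrite ler_wpM2r ?powR_ge0.
rewrite -powRD; last by rewrite (gt_eqF B0) implybT.
have -> : 2^-1 + (theta / 2 - 1) = (theta - 1) / 2 by field.
apply: ge0_ler_powR; rewrite ?nnegrE ?(ltW B0)//.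
- by rewrite divr_ge0// subr_ge0.
- by rewrite addr_ge0// sqr_ge0.
- apply: lerD; last by rewrite invf_le1// ler1n.
  have U0 : 0 <= U by rewrite (le_trans _ xU).
  by rewrite -(real_normK (num_real x)) ler_pXn2r ?nnegrE.
Qed.

Let base_cvg x : (x ^+ 2 + n.+1%:R^-1) @[n --> \oo] --> x ^+ 2.
Proof.
rewrite -[X in _ --> X]addr0; apply: cvgD; first exact: cvg_cst.
exact: cvg_harmonic.
Qed.

Let powR_cvg (p x : R) : x != 0 ->
  (x ^+ 2 + n.+1%:R^-1) `^ p @[n --> \oo] --> (x ^+ 2) `^ p.
Proof.
move=> x0; have x2 : 0 < x ^+ 2 by rewrite lt_neqAle sqr_ge0 eq_sym expf_neq0.
apply: (@cvg_comp _ _ _ (fun n => x ^+ 2 + n.+1%:R^-1) (fun t : R => t `^ p)).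
  exact: base_cvg.
exact: is_derive1_continuous (is_derive1_powR p x2).
Qed.

Lemma abs_powE x : `|x| `^ theta = (x ^+ 2) `^ (theta / 2).
Proof.
by rewrite -(real_normK (num_real x)) -powR_mulrn// -powRrM mulrC divfK.
Qed.

Lemma reg_pow_cvg x : reg_pow n x @[n --> \oo] --> `|x| `^ theta.
Proof.
have [->|x0] := eqVneq x 0; last by rewrite abs_powE; exact: powR_cvg.
have th0 : theta != 0 by rewrite gt_eqF// (lt_le_trans _ theta1).
rewrite normr0 powR0//; apply/cvgrPdist_lt => e e0.
(* For a base below 1 the power theta/2 is at most the square root, and for a base below e^2 the
   square root is below e. *)
have /cvgrPdist_lt/(_ (Num.min 1 (e ^+ 2))) := @cvg_harmonic R.
rewrite lt_min ltr01 exprn_gt0// => /(_ isT); apply: filterS => n.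
rewrite !sub0r !normrN /harmonic/= gtr0_norm ?invr_gt0// lt_min => /andP[n1 ne].
rewrite /reg_pow expr0n/= add0r ger0_norm ?powR_ge0//.
apply: (@le_lt_trans _ _ (n.+1%:R^-1 `^ 2^-1)).
  apply: ger_powR; first by rewrite invr_gt0 ltr0n ltW.
  by rewrite ler_pdivlMr// mulVf.
rewrite powR12_sqrt// -[ltRHS](gtr0_norm e0) -sqrtr_sqr ltr_sqrt// exprn_gt0//.
Qed.

Lemma dreg_pow_cvg x : dreg_pow n x @[n --> \oo] --> dabs_pow x.
Proof.
have [->|x0] := eqVneq x 0.
  rewrite /dabs_pow mulr0 mul0r; apply: cvg_near_cst; apply: nearW => n.
  by rewrite /dreg_pow mulr0 mul0r.
by apply: cvgM; [exact: cvg_cst|exact: powR_cvg].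
Qed.

(** The mean value bound of the regularisations passes to the limit, so intervals containing 0 need
    no separate treatment. *)
Lemma abs_pow_lipschitz U x y : `|x| <= U -> `|y| <= U ->
  `| `|x| `^ theta - `|y| `^ theta| <= lip_pow U * `|x - y|.
Proof.
have H a b : `|a| <= U -> `|b| <= U -> a <= b ->
    `| `|b| `^ theta - `|a| `^ theta| <= lip_pow U * (b - a).
  move=> aU bU ab.
  have c : (fun n => `|reg_pow n b - reg_pow n a|) @ \oo -->
      `| `|b| `^ theta - `|a| `^ theta|.
    by apply: cvg_norm; apply: cvgB; exact: reg_pow_cvg.
  apply: (@closed_cvg _ _ \oo _ _ (fun z : R => z <= lip_pow U * (b - a)) _ _ _ c).
    exact: closed_le.
  apply: nearW => n; apply: (is_derive_lipschitz ab) => t tab.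
    exact: reg_pow_derive.
  apply: dreg_pow_bound; move: aU bU tab; rewrite !ler_norml.
  by move=> /andP[? ?] /andP[? ?] /andP[? ?]; apply/andP; split; lra.
move=> xU yU; have [xy|yx] := leP x y.
  by rewrite distrC (distrC x) (ger0_norm (_ : 0 <= y - x)) ?subr_ge0// H.
by rewrite (gtr0_norm (_ : 0 < x - y)) ?subr_gt0// H// ltW.
Qed.

Lemma abs_pow_continuous : continuous (fun x : R => `|x| `^ theta).
Proof.
move=> x; apply/cvgrPdist_lt => e e0; pose U := `|x| + 1.
have U1 : 0 < U ^+ 2 + 1 by rewrite ltr_wpDl ?sqr_ge0.
have th0 : 0 < theta by rewrite (lt_le_trans _ theta1).
have K0 : 0 < lip_pow U by rewrite mulr_gt0// powR_gt0.
near=> y.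
have yx : `|x - y| < Num.min 1 (e / lip_pow U).
  near: y; apply: (@cvgr_dist_lt _ _ _ _ _ id); first exact: cvg_id.
  by rewrite lt_min ltr01 divr_gt0.
move: yx; rewrite lt_min => /andP[y1 ye].
have xU : `|x| <= U by rewrite lerDl.
have yU : `|y| <= U.
  have := ler_normB x (x - y).
  by rewrite opprB addrC subrK /U => H; lra.
apply: (le_lt_trans (abs_pow_lipschitz xU yU)).
by rewrite mulrC -ltr_pdivlMr.
Unshelve. all: by end_near. Qed.

Lemma abs_pow_le x : `|x| <= 1 -> `|x| `^ theta <= `|x|.
Proof.
move=> x1; have [->|x0] := eqVneq x 0.
  by rewrite normr0 powR0// gt_eqF// (lt_le_trans _ theta1).
by apply: ge1r_powR => //; rewrite normr_gt0 x0.
Qed.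

End regularized_power.

(** * Profiles solving the system *)

Section soler_right_hand_side.
Context {R : realType}.
Variables (theta : R) (F G : R -> R).
Hypothesis theta1 : 1 <= theta.
Implicit Types (k r : R).

Definition soler_dF k r : R :=
  (`|G r ^+ 2 - F r ^+ 2| `^ theta - k) * G r - 2 / r * F r.

Definition soler_dG k r : R := (`|G r ^+ 2 - F r ^+ 2| `^ theta - k) * F r.

Hypothesis cF : forall r, 0 < r -> {for r, continuous F}.
Hypothesis cG : forall r, 0 < r -> {for r, continuous G}.

Lemma soler_potential_continuous r : 0 < r ->
  {for r, continuous (fun s => `|G s ^+ 2 - F s ^+ 2| `^ theta)}.
Proof.
move=> r0; apply: (@continuous_comp _ _ _ (fun s => G s ^+ 2 - F s ^+ 2)
  (fun x => `|x| `^ theta)); last exact: abs_pow_continuous.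
have c2 (X : R -> R) : {for r, continuous X} -> {for r, continuous (fun s => X s ^+ 2)}.
  by move=> cX; apply: (@continuous_comp _ _ _ X (fun x => x ^+ 2)) => //; exact: exprn_continuous.
by apply: cvgB; apply: c2; [exact: cG|exact: cF].
Qed.

Lemma soler_dF_continuous k r : 0 < r -> {for r, continuous (soler_dF k)}.
Proof.
move=> r0; apply: cvgB; apply: cvgM.
- by apply: cvgB; [exact: soler_potential_continuous|exact: cvg_cst].
- exact: cG.
- apply: cvgM; first exact: cvg_cst.
  by apply: inv_continuous; rewrite gt_eqF.
- exact: cF.
Qed.

Lemma soler_dG_continuous k r : 0 < r -> {for r, continuous (soler_dG k)}.
Proof.
move=> r0; apply: cvgM; last exact: cF.
by apply: cvgB; [exact: soler_potential_continuous|exact: cvg_cst].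
Qed.

End soler_right_hand_side.

(** * Decay and second derivatives of a profile *)

Section soler_profile.
Context {R : realType}.
Local Notation MR := (measurableTypeR R).
Local Notation leb := (@lebesgue_measure R).
Local Notation Rpos := (`]0, +oo[%classic : set R).
(** Here alpha and beta stand for m - omega and m + omega, whose sum is 2 m = 1. *)
Variables (theta alpha beta : R) (F G : R -> R).
Hypotheses (theta1 : 1 <= theta) (alpha0 : 0 < alpha) (beta0 : 0 < beta).
Hypothesis alphabeta : alpha + beta = 1.
Implicit Types (r s : R).

Let V r : R := `|G r ^+ 2 - F r ^+ 2| `^ theta.
Let h r : R := (V r - alpha) * G r.

Local Notation dF := (soler_dF theta F G alpha).
Local Notation dG := (soler_dG theta F G beta).

Hypothesis Fd : forall r, 0 < r -> is_derive r 1 F (dF r).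
Hypothesis Gd : forall r, 0 < r -> is_derive r 1 G (dG r).
Hypothesis Fi : leb.-integrable Rpos (EFin \o (fun r => F r ^+ 4 * r ^+ 2)).
Hypothesis Gi : leb.-integrable Rpos (EFin \o (fun r => G r ^+ 4 * r ^+ 2)).
Hypothesis dFi : leb.-integrable Rpos (EFin \o (fun r => dF r ^+ 4 * r ^+ 2)).
Hypothesis dGi : leb.-integrable Rpos (EFin \o (fun r => dG r ^+ 4 * r ^+ 2)).

Let u r : R := G r ^+ 2 - F r ^+ 2.
Let du r : R := 2 * G r * dG r - 2 * F r * dF r.

Let cF r : 0 < r -> {for r, continuous F}.
Proof. by move=> r0; exact: is_derive1_continuous (Fd r0). Qed.

Let cG r : 0 < r -> {for r, continuous G}.
Proof. by move=> r0; exact: is_derive1_continuous (Gd r0). Qed.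

Let ud r : 0 < r -> is_derive r 1 u (du r).
Proof.
move=> r0; have /is_derive_eq := is_derive1B (is_derive1X 2 (Gd r0)) (is_derive1X 2 (Fd r0)).
by apply; rewrite /du /= !expr1.
Qed.

Let cu r : 0 < r -> {for r, continuous u}.
Proof. by move=> r0; exact: is_derive1_continuous (ud r0). Qed.

Let cV r : 0 < r -> {for r, continuous V}.
Proof. exact: soler_potential_continuous. Qed.

Let cinv r : 0 < r -> {for r, continuous (fun s : R => s^-1)}.
Proof. by move=> r0; apply: inv_continuous; rewrite gt_eqF. Qed.

Let cdF r : 0 < r -> {for r, continuous dF}.
Proof. exact: soler_dF_continuous. Qed.

Let cdG r : 0 < r -> {for r, continuous dG}.
Proof. exact: soler_dG_continuous. Qed.

Let pow4_ge0 (x : R) : 0 <= x ^+ 4.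
Proof. by rewrite (_ : 4 = 2 * 2)%N// exprM sqr_ge0. Qed.

(** One primitive serves both ends: beyond r = 1 the weight r^2 is at least 1, and near 0 only the
    derivative term is kept. The coefficient 4 pays for the 3 of Young's inequality and the 1 from
    differentiating the affine factor r + 1 - s. *)
Let primitive (X dX : R -> R) :
  (forall r, 0 < r -> {for r, continuous X}) ->
  (forall r, 0 < r -> {for r, continuous dX}) ->
  leb.-integrable Rpos (EFin \o (fun r => X r ^+ 4 * r ^+ 2)) ->
  leb.-integrable Rpos (EFin \o (fun r => dX r ^+ 4 * r ^+ 2)) ->
  exists (J dJ : R -> R) (M : R), [/\ forall r, 0 < r -> is_derive r 1 J (dJ r),
    forall r, 1 <= r -> 4 * X r ^+ 4 + dX r ^+ 4 <= dJ r,
    forall r, 0 < r <= 1 -> r ^+ 2 * dX r ^+ 4 <= dJ r &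
    forall r, 0 < r -> `|J r| <= M].
Proof.
move=> cX cdX Xi dXi.
pose j r : R := 4 * (X r ^+ 4 * r ^+ 2) + dX r ^+ 4 * r ^+ 2.
have mRpos : measurable (Rpos : set MR) by exact: measurable_itv.
have ji : leb.-integrable Rpos (EFin \o j).
  by apply: integrable_add => //; exact: integrable_scale.
have c4 (Y : R -> R) r : {for r, continuous Y} -> {for r, continuous (fun s => Y s ^+ 4)}.
  by move=> cY; apply: (@continuous_comp _ _ _ Y (fun x => x ^+ 4)) => //; exact: exprn_continuous.
have cj r : 0 < r -> {for r, continuous j}.
  move=> r0; apply: cvgD.
    apply: cvgM; first exact: cvg_cst.
    by apply: cvgM; [exact: c4 (cX _ r0)|exact: exprn_continuous].
  by apply: cvgM; [exact: c4 (cdX _ r0)|exact: exprn_continuous].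
have j0 r : 0 < r -> 0 <= j r.
  move=> _; apply: addr_ge0; last exact: mulr_ge0 (pow4_ge0 _) (sqr_ge0 _).
  by apply: mulr_ge0 => //; exact: mulr_ge0 (pow4_ge0 _) (sqr_ge0 _).
have [J [M [Jd JM]]] := bounded_primitive cj j0 ji.
exists J, j, M; split => // r.
  move=> r1; have r2 : 1 <= r ^+ 2 by rewrite expr_ge1// (le_trans _ r1).
  rewrite /j mulrA -mulrDl ler_peMr//; apply: addr_ge0 => //; exact: mulr_ge0.
move=> _; rewrite /j mulrC lerDr; apply: mulr_ge0 => //.
by apply: mulr_ge0 => //; exact: sqr_ge0.
Qed.

Let near0 : exists M : R, forall r, 0 < r <= 1 -> `|F r| <= M /\ `|G r| <= M.
Proof.
have [J [dJ [M [Jd _ J0 JM]]]] := primitive cF cdF Fi dFi.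
have [K [dK [N [Kd _ K0 KN]]]] := primitive cG cdG Gi dGi.
have pos r : 0 < r <= 1 -> 0 < r by case/andP.
have [A AF] := bounded_near0_of_bounded_primitive (fun r r01 => Fd (pos r r01))
  (fun r r01 => Jd r (pos r r01)) J0 (fun r r01 => JM r (pos r r01)).
have [B BG] := bounded_near0_of_bounded_primitive (fun r r01 => Gd (pos r r01))
  (fun r r01 => Kd r (pos r r01)) K0 (fun r r01 => KN r (pos r r01)).
by exists (Num.max A B) => r r01; rewrite !le_max AF ?BG ?orbT.
Qed.

Let decay : exists R0 C kappa : R, [/\ 1 <= R0, 0 < C, 0 < kappa &
  forall r, R0 <= r -> F r ^+ 2 + G r ^+ 2 <= C * expR (- kappa * r)].
Proof.
have [J [dJ [M [Jd J1 _ JM]]]] := primitive cF cdF Fi dFi.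
have [K [dK [N [Kd K1 _ KN]]]] := primitive cG cdG Gi dGi.
have pos r : 1 <= r -> 0 < r by exact: lt_le_trans.
(* Once 0 <= V <= c, both V - alpha and V - beta are at most c - 2 c = - c, and their sum 2 V - 1
   lies in [-1, 1]: the hypotheses of [hyperbolic_decay]. *)
pose c : R := Num.min alpha beta / 2.
have c0 : 0 < c by rewrite divr_gt0// lt_min alpha0.
have ca : 2 * c <= alpha by rewrite /c mulrC divfK// ge_min lexx.
have cb : 2 * c <= beta by rewrite /c mulrC divfK// ge_min lexx orbT.
have c1 : c <= 1.
  by move: c0 ca cb alphabeta beta0; clearbody c; lra.
have d0 : 0 < c / 2 by rewrite divr_gt0.
have upper (X : R -> R) (A : R) : (forall r, 0 < r -> `|X r| <= A) -> forall r, 1 <= r -> X r <= A.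
  by move=> XA r r1; rewrite (le_trans (ler_norm _))// XA// pos.
have [RF RF1 FR] := @cvg0_of_bounded_primitive _ F dF J dJ M (fun r ge1 => Fd (pos r ge1))
  (fun r ge1 => Jd r (pos r ge1)) J1 (upper _ _ JM) _ d0.
have [RG RG1 GR] := @cvg0_of_bounded_primitive _ G dG K dK N (fun r ge1 => Gd (pos r ge1))
  (fun r ge1 => Kd r (pos r ge1)) K1 (upper _ _ KN) _ d0.
pose R0 := Num.max RF RG.
have R01 : 1 <= R0 by rewrite le_max RF1.
have small r : R0 <= r -> F r ^+ 2 + G r ^+ 2 <= c.
  rewrite ge_max => /andP[/FR + /GR]; rewrite !ler_norml => /andP[? ?] /andP[? ?]; nra.
have smallV r : R0 <= r -> 0 <= V r <= c.
  move=> rR; rewrite powR_ge0/=.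
  have uc : `|u r| <= c.
    by have := small r rR; have := sqr_ge0 (F r); have := sqr_ge0 (G r);
      rewrite /u ler_norml => *; apply/andP; split; lra.
  exact: le_trans (abs_pow_le theta1 (le_trans uc c1)) uc.
have cc : 0 < c <= 1 by rewrite c0.
have ab r : R0 <= r -> [/\ V r - alpha <= - c, V r - beta <= - c &
    `|(V r - alpha) + (V r - beta)| <= 1].
  move=> /smallV/andP[V0 Vc]; move: alphabeta; clearbody c; split; [lra|lra|].
  by rewrite ler_norml; apply/andP; split; lra.
have FG1 r : R0 <= r -> F r ^+ 2 + G r ^+ 2 <= 1.
  by move=> /small rc; exact: le_trans c1.
have [C C0 FG] := @hyperbolic_decay R F G (fun r => V r - alpha) (fun r => V r - beta)
  c R0 cc R01 (fun r rR => Fd (pos r (le_trans R01 rR)))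
  (fun r rR => Gd (pos r (le_trans R01 rR))) ab FG1.
by exists R0, C, (c / 2).
Qed.

Let sqrt_decay (X C kappa r : R) : 0 < C -> 
  X ^+ 2 <= C * expR (- kappa * r) -> `|X| <= (C + 1) * expR (- (kappa / 2) * r).
Proof.
move=> C0 XC; have e0 := expR_ge0 (- (kappa / 2) * r).
rewrite -(@ler_pXn2r _ 2) ?nnegrE ?mulr_ge0 ?addr_ge0 ?(ltW C0)//.
rewrite real_normK ?num_real//; apply: (le_trans XC).
have -> : expR (- kappa * r) = expR (- (kappa / 2) * r) ^+ 2.
  by rewrite -expRM_natl; congr expR; field.
rewrite exprMn; apply: ler_wpM2r; first exact: sqr_ge0.
(* C + 1 serves as an upper bound for the square root of C. *)
by nra.
Qed.

Lemma soler_exp_small : exp_small F /\ exp_small G.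
Proof.
have [M FG0] := near0; have [R0 [C [k [R01 C0 k0 FGR]]]] := decay.
have k2 : 0 < k / 2 by rewrite divr_gt0.
split.
- apply: (@exp_small_continuous _ F R0 M (C + 1) _ k2 cF (fun r r01 => (FG0 r r01).1)).
  move=> r rR; apply: sqrt_decay C0 _; apply: le_trans (FGR r rR).
  by rewrite lerDl sqr_ge0.
- apply: (@exp_small_continuous _ G R0 M (C + 1) _ k2 cG (fun r r01 => (FG0 r r01).2)).
  move=> r rR; apply: sqrt_decay C0 _; apply: le_trans (FGR r rR).
  by rewrite lerDr sqr_ge0.
Qed.

Let Fs := soler_exp_small.1.
Let Gs := soler_exp_small.2.

Let u_bounded : bounded_half_line u.
Proof.
have [A FA] := exp_small_bounded Fs; have [B GB] := exp_small_bounded Gs.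
exists (B ^+ 2 + A ^+ 2) => r r0.
apply: le_trans (ler_normB _ _) _; rewrite !normrX.
have A0 := le_trans (normr_ge0 _) (FA r r0); have B0 := le_trans (normr_ge0 _) (GB r r0).
by apply: lerD; rewrite ler_pXn2r ?nnegrE ?FA ?GB.
Qed.

Let V_bounded : bounded_half_line V.
Proof.
have [U uU] := u_bounded; exists (U `^ theta) => r r0.
rewrite ger0_norm ?powR_ge0//; apply: ge0_ler_powR; rewrite ?nnegrE//.
- by rewrite (le_trans _ theta1).
- exact: le_trans (uU r r0).
- exact: uU.
Qed.

Let Va_bounded (k : R) : bounded_half_line (fun r => V r - k).
Proof. by apply: bounded_half_line_add => //; exact: bounded_half_line_cst. Qed.

Let hs : exp_small h.
Proof. exact: exp_small_mulr. Qed.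

Let dGs : exp_small dG.
Proof. exact: exp_small_mulr. Qed.

(* (s^2 F)' = s^2 h(s), so that F(r) = r^-2 \int_0^r s^2 h(s) ds. *)
Let sqrF_derive (k s : R) : 0 < s ->
  is_derive s 1 (fun t => t ^+ 2 * F t - k / 3 * t ^+ 3) (s ^+ 2 * (h s - k)).
Proof.
move=> s0.
have d1 := is_derive1M (is_derive1X 2 (is_derive_id s (1 : R))) (Fd s0).
have d2 := is_derive1Z (k / 3) (is_derive1X 3 (is_derive_id s (1 : R))).
have /is_derive_eq := is_derive1B d1 d2; apply.
by rewrite /soler_dF /h /V /=; field; rewrite gt_eqF.
Qed.

Let sqrF_bound (k M s : R) : 0 < s <= 1 -> `|F s| <= M ->
  `|s ^+ 2 * F s - k / 3 * s ^+ 3| <= (M + `|k|) * s.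
Proof.
move=> /andP[s0 s1] FM; have M0 : 0 <= M by exact: le_trans FM.
have s2 : s ^+ 2 <= s by rewrite expr2 ger_pMl.
have s3 : s ^+ 3 <= s by rewrite exprS -[leRHS]mulr1 ler_pM2l// (le_trans s2).
apply: (le_trans (ler_normB _ _)); rewrite mulrDl; apply: lerD.
  by rewrite normrM (ger0_norm (sqr_ge0 s)) mulrC ler_pM// sqr_ge0.
rewrite normrM normrM normfV (ger0_norm (_ : 0 <= 3))// (ger0_norm (exprn_ge0 _ (ltW s0))).
apply: ler_pM => //; first by rewrite exprn_ge0// ltW.
by rewrite ler_pdivrMr//; have := normr_ge0 k; lra.
Qed.

(** The case k = 0 of [sqrF_derive]: as h is bounded, r^2 F is O(r^3) at the origin, that is, F / r
    is bounded there. *)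
Let Fr_small : exp_small (fun r => F r / r).
Proof.
have [M FM] := exp_small_bounded Fs; have [K hK] := exp_small_bounded hs.
apply: (@exp_small_div _ _ (K / 3) Fs) => r /andP[r0 r1].
have M0 : 0 <= M + `|0 : R|.
  by rewrite normr0 addr0; exact: le_trans (FM 1 ltr01).
have r01 : 0 < r <= 1 by rewrite r0.
have H1 s : 0 < s <= r -> 0 < s by case/andP.
have H0 : `|r ^+ 2 * F r - 0 / 3 * r ^+ 3| <= K * r ^+ 3 / 3.
  apply: (@le_pow3_of_derive_le_pow2 _ (fun t => t ^+ 2 * F t - 0 / 3 * t ^+ 3)
    (fun s => s ^+ 2 * (h s - 0)) K (M + `|0|) r r01 M0
    (fun s sr => sqrF_derive 0 (H1 s sr))).
  - move=> s /H1 s0; rewrite subr0 normrM (ger0_norm (sqr_ge0 s)) mulrC.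
    by rewrite ler_wpM2r ?sqr_ge0// hK.
  - move=> s /andP[s0 sr]; apply: sqrF_bound; last exact: FM.
    by rewrite s0 (le_trans sr).
have H : `|r ^+ 2 * F r| <= K * r ^+ 3 / 3 by move: H0; rewrite !mul0r subr0.
have r2 : 0 < r ^+ 3 by rewrite exprn_gt0.
rewrite -(ler_pM2l r2) -{1}(gtr0_norm r2) -normrM.
have -> : r ^+ 3 * (F r / r) = r ^+ 2 * F r by field; rewrite gt_eqF.
by apply: le_trans H _; rewrite le_eqVlt; apply/orP; left; apply/eqP; ring.
Qed.

Let dFs : exp_small dF.
Proof.
apply: (@eq_exp_small _ (fun r => h r + (- 2) * (F r / r))).
  by move=> r r0; rewrite /soler_dF /h /V; field; rewrite gt_eqF.
by apply: exp_small_add => //; exact: exp_small_scale.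
Qed.

Let du_bounded : bounded_half_line du.
Proof.
have bF := exp_small_bounded Fs; have bG := exp_small_bounded Gs.
have bdF := exp_small_bounded dFs; have bdG := exp_small_bounded dGs.
have [M duM] : bounded_half_line (fun r => (2 * G r) * dG r + (- 2 * F r) * dF r).
  by apply: bounded_half_line_add; apply: bounded_half_line_mul => //;
    apply: bounded_half_line_mul => //; exact: bounded_half_line_cst.
exists M => r r0; apply: le_trans (duM r r0).
by rewrite /du !mulNr.
Qed.

Let lipschitz_half_line (X dX : R -> R) (M r s : R) : 0 < s <= r ->
  (forall t : R, 0 < t -> is_derive t 1 X (dX t)) ->
  (forall t : R, 0 < t -> `|dX t| <= M) ->
  `|X s - X r| <= M * (r - s).
Proof.
move=> /andP[s0 sr] Xd dXM; rewrite distrC; apply: (is_derive_lipschitz sr) => t /andP[st _].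
  by apply: Xd; exact: lt_le_trans st.
by apply: dXM; exact: lt_le_trans st.
Qed.

(** A Lipschitz bound stands in for a derivative of h, which may fail to exist where G^2 = F^2 if
    theta = 1. It rests on the boundedness of [dF], hence on that of F / r. *)
Let h_lipschitz : exists2 L, 0 <= L & forall r s, 0 < s <= r -> `|h s - h r| <= L * (r - s).
Proof.
have [U uU] := u_bounded; have [D duD] := du_bounded.
have [A dGA] := exp_small_bounded dGs; have [B GB] := exp_small_bounded Gs.
have [E VE] := Va_bounded alpha.
have E0 := le_trans (normr_ge0 _) (VE 1 ltr01).
have B0 := le_trans (normr_ge0 _) (GB 1 ltr01).
have A0 := le_trans (normr_ge0 _) (dGA 1 ltr01).
have D0 := le_trans (normr_ge0 _) (duD 1 ltr01).
have K0 : 0 <= lip_pow theta U.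
  by rewrite mulr_ge0 ?powR_ge0// (le_trans _ theta1).
exists (lip_pow theta U * D * B + E * A).
  apply: addr_ge0; last exact: mulr_ge0.
  by apply: mulr_ge0 => //; exact: mulr_ge0.
move=> r s sr; have /andP[s0 sr'] := sr.
have r0 := lt_le_trans s0 sr'.
have rs0 : 0 <= r - s by rewrite subr_ge0.
have -> : h s - h r = (V s - V r) * G s + (V r - alpha) * (G s - G r).
  by rewrite /h; ring.
apply: (le_trans (ler_normD _ _)); rewrite !normrM mulrDl; apply: lerD.
  rewrite mulrAC; apply: ler_pM => //; last exact: GB.
  apply: (le_trans (abs_pow_lipschitz theta1 (uU s s0) (uU r r0))).
  rewrite -(mulrA (lip_pow theta U)); apply: ler_wpM2l => //.
  exact: lipschitz_half_line sr ud duD.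
rewrite -mulrA; apply: ler_pM => //; first exact: VE.
exact: lipschitz_half_line sr Gd dGA.
Qed.

(** This is (F / r)': the equation for F turns F' / r - F / r^2 into (h - 3 F / r) / r. *)
Let p r : R := (h r - 3 * (F r / r)) / r.

(** The case k = h(r) of [sqrF_derive], with h frozen at the end point: |h(s) - h(r)| <= L r gains
    one power of r, so r^2 F - h(r) r^3 / 3 is O(r^4) and the quotient by r stays bounded. *)
Let p_small : exp_small p.
Proof.
have [L L0 hL] := h_lipschitz; have [M FM] := exp_small_bounded Fs.
apply: (@exp_small_div _ (fun r => h r - 3 * (F r / r)) L).
  have := exp_small_add hs (exp_small_scale (- 3) Fr_small).
  by apply: eq_exp_small => r _; rewrite mulNr.
move=> r /andP[r0 r1].
have r01 : 0 < r <= 1 by rewrite r0.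
have M0 : 0 <= M + `|h r|.
  by rewrite addr_ge0//; exact: le_trans (FM 1 ltr01).
have H1 s : 0 < s <= r -> 0 < s by case/andP.
have H : `|r ^+ 2 * F r - h r / 3 * r ^+ 3| <= L * r * r ^+ 3 / 3.
  apply: (@le_pow3_of_derive_le_pow2 _ (fun t => t ^+ 2 * F t - h r / 3 * t ^+ 3)
    (fun s => s ^+ 2 * (h s - h r)) (L * r) (M + `|h r|) r r01 M0
    (fun s sr => sqrF_derive (h r) (H1 s sr))).
  - move=> s sr; have s0 := H1 s sr.
    rewrite normrM (ger0_norm (sqr_ge0 s)) mulrC ler_wpM2r ?sqr_ge0//.
    apply: (le_trans (hL r s sr)); rewrite ler_wpM2l//.
    by rewrite gerBl ltW.
  - move=> s /andP[s0 sr]; apply: sqrF_bound; last exact: FM.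
    by rewrite s0 (le_trans sr).
have r4 : 0 < r ^+ 4 / 3 by rewrite divr_gt0// exprn_gt0.
rewrite -(ler_pM2l r4) -{1}(gtr0_norm r4) -normrM.
have -> : r ^+ 4 / 3 * ((h r - 3 * (F r / r)) / r) = - (r ^+ 2 * F r - h r / 3 * r ^+ 3).
  by field; rewrite gt_eqF.
rewrite normrN; apply: (le_trans H).
by rewrite le_eqVlt; apply/orP; left; apply/eqP; ring.
Qed.

(** The chain rule for V, read as 0 where G^2 = F^2; it is the pointwise limit of the regularised
    derivatives [dVn]. *)
Let dV r : R := dabs_pow theta (u r) * du r.

(** Obtained from F' = h - 2 F / r with F / r differentiated as [p], so that no separately unbounded
    terms in 1 / r^2 appear. *)
Definition soler_ddF r : R := dV r * G r + (V r - alpha) * dG r - 2 * p r.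
Definition soler_ddG r : R := dV r * F r + (V r - beta) * dF r.
Local Notation ddF := soler_ddF.
Local Notation ddG := soler_ddG.

Let Vn n r : R := reg_pow theta n (u r).
Let dVn n r : R := dreg_pow theta n (u r) * du r.

Let dVn_bounded : exists M : R, forall n r, 0 < r -> `|dVn n r| <= M.
Proof.
have [U uU] := u_bounded; have [D duD] := du_bounded.
exists (lip_pow theta U * D) => n r r0; rewrite normrM.
by apply: ler_pM => //; [exact: dreg_pow_bound (uU r r0)|exact: duD].
Qed.

Let dVn_cvg r : dVn n r @[n --> \oo] --> dV r.
Proof. by apply: cvgM; [exact: dreg_pow_cvg|exact: cvg_cst]. Qed.

Let dV_bounded : bounded_half_line dV.
Proof.
have [M dVM] := dVn_bounded; exists M => r r0.
have c : (fun n => `|dVn n r|) @ \oo --> `|dV r| by apply: cvg_norm; exact: dVn_cvg.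
apply: (@closed_cvg _ _ \oo _ _ (fun z : R => z <= M) _ _ _ c); first exact: closed_le.
by apply: nearW => n; exact: dVM.
Qed.

Let Vn_bounded : exists M : R, forall n r, 0 < r -> `|Vn n r| <= M.
Proof.
have [U uU] := u_bounded; exists ((U ^+ 2 + 1) `^ (theta / 2)) => n r r0.
have U0 := le_trans (normr_ge0 _) (uU r r0).
rewrite ger0_norm ?powR_ge0//; apply: ge0_ler_powR; rewrite ?nnegrE.
- by rewrite divr_ge0// (le_trans _ theta1).
- by rewrite addr_ge0 ?sqr_ge0.
- by rewrite addr_ge0 ?sqr_ge0.
- apply: lerD; last by rewrite invf_le1// ler1n.
  by rewrite -(real_normK (num_real (u r))) ler_pXn2r ?nnegrE// uU.
Qed.

Let Vn_derive n r : 0 < r -> is_derive r 1 (Vn n) (dVn n r).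
Proof.
by move=> r0; exact: (@is_derive1_comp _ (reg_pow theta n) u _ _ _
  (reg_pow_derive theta n (u r)) (ud r0)).
Qed.

Let cdu r : 0 < r -> {for r, continuous du}.
Proof.
move=> r0; apply: cvgB; apply: cvgM.
- by apply: cvgM; [exact: cvg_cst|exact: cG].
- exact: cdG.
- by apply: cvgM; [exact: cvg_cst|exact: cF].
- exact: cdF.
Qed.

Let cVn n r : 0 < r -> {for r, continuous (Vn n)}.
Proof. by move=> r0; exact: is_derive1_continuous (Vn_derive n r0). Qed.

Let cdVn n r : 0 < r -> {for r, continuous (dVn n)}.
Proof.
move=> r0; apply: cvgM; last exact: cdu.
apply: (@continuous_comp _ _ _ u (dreg_pow theta n)); first exact: cu.
exact: dreg_pow_continuous.
Qed.

Lemma soler_derivatives_exp_small :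
  [/\ exp_small dF, exp_small dG, exp_small ddF & exp_small ddG].
Proof.
split=> //.
  have s1 := exp_small_add (exp_small_mulr Gs dV_bounded)
    (exp_small_mulr dGs (Va_bounded alpha)).
  have := exp_small_add s1 (exp_small_scale (- 2) p_small).
  by apply: eq_exp_small => r _; rewrite /soler_ddF mulNr.
exact: exp_small_add (exp_small_mulr Fs dV_bounded) (exp_small_mulr dFs (Va_bounded beta)).
Qed.

Lemma soler_ddG_weak : weak_radial_derivative dG ddG.
Proof.
have [A VA] := Vn_bounded; have [B dVB] := dVn_bounded.
have [K FK] := exp_small_bounded Fs; have [L dFL] := exp_small_bounded dFs.
pose gn n r := (Vn n r - beta) * F r.
pose dgn n r := dVn n r * F r + (Vn n r - beta) * dF r.
pose M := Num.max ((A + beta) * K) (B * K + (A + beta) * L).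
have A' n r : 0 < r -> `|Vn n r - beta| <= A + beta.
  move=> r0; apply: (le_trans (ler_normB _ _)).
  by rewrite (gtr0_norm beta0) lerD2r VA.
have gM n r : 0 < r -> `|gn n r| <= M.
  by move=> r0; rewrite le_max normrM ler_pM ?A' ?FK.
have dgM n r : 0 < r -> `|dgn n r| <= M.
  move=> r0; rewrite le_max; apply/orP; right.
  apply: (le_trans (ler_normD _ _)).
  rewrite (normrM (dVn n r)) (normrM (Vn n r - beta)).
  by apply: lerD; apply: ler_pM => //; [exact: dVB|exact: FK|exact: A'|exact: dFL].
apply: (@weak_radial_derivative_cvg _ gn dgn _ _ M) => //.
- move=> n; apply: (@weak_radial_derivative_C1 _ _ _ M) => //.
  + move=> r r0; have d := is_derive1B (Vn_derive n r0) (is_derive_cst beta r (1 : R)).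
    have /is_derive_eq := is_derive1M d (Fd r0); apply.
    by rewrite subr0.
  + move=> r r0; apply: cvgD; apply: cvgM.
    * exact: cdVn.
    * exact: cF.
    * by apply: cvgB; [exact: cVn|exact: cvg_cst].
    * exact: cdF.
  + exact: gM.
  + exact: dgM.
- move=> r r0; apply: cvgM; last exact: cvg_cst.
  by apply: cvgB; [exact: reg_pow_cvg|exact: cvg_cst].
- move=> r r0; apply: cvgD; apply: cvgM; try exact: cvg_cst; first exact: dVn_cvg.
  by apply: cvgB; [exact: reg_pow_cvg|exact: cvg_cst].
Qed.

Lemma soler_ddF_weak : weak_radial_derivative dF ddF.
Proof.
have [A VA] := Vn_bounded; have [B dVB] := dVn_bounded.
have [K GK] := exp_small_bounded Gs; have [L dGL] := exp_small_bounded dGs.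
have [N FrN] := exp_small_bounded Fr_small; have [P pP] := exp_small_bounded p_small.
pose gn n r := (Vn n r - alpha) * G r - 2 * (F r / r).
pose dgn n r := dVn n r * G r + (Vn n r - alpha) * dG r - 2 * p r.
pose M := Num.max ((A + alpha) * K + 2 * N) (B * K + (A + alpha) * L + 2 * P).
have A' n r : 0 < r -> `|Vn n r - alpha| <= A + alpha.
  move=> r0; apply: (le_trans (ler_normB _ _)).
  by rewrite (gtr0_norm alpha0) lerD2r VA.
have n2 : `|2 : R| = 2 by rewrite ger0_norm.
have gM n r : 0 < r -> `|gn n r| <= M.
  move=> r0; rewrite le_max; apply/orP; left.
  apply: (le_trans (ler_normB _ _)); rewrite normrM [X in _ + X]normrM n2.
  by apply: lerD; [rewrite ler_pM ?A' ?GK|rewrite ler_pM2l// FrN].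
have dgM n r : 0 < r -> `|dgn n r| <= M.
  move=> r0; rewrite le_max; apply/orP; right.
  apply: (le_trans (ler_normB _ _)); apply: lerD; last first.
    by rewrite normrM n2 ler_pM2l// pP.
  apply: (le_trans (ler_normD _ _)).
  rewrite (normrM (dVn n r)) (normrM (Vn n r - alpha)).
  by apply: lerD; apply: ler_pM => //; [exact: dVB|exact: GK|exact: A'|exact: dGL].
have cp r : 0 < r -> {for r, continuous p}.
  move=> r0; apply: cvgM; last exact: cinv.
  apply: cvgB.
    apply: cvgM; last exact: cG.
    by apply: cvgB; [exact: cV|exact: cvg_cst].
  apply: cvgM; first exact: cvg_cst.
  by apply: cvgM; [exact: cF|exact: cinv].
have Frd r : 0 < r -> is_derive r 1 (fun s => F s / s) (p r).
  move=> r0; have rn : r != 0 by rewrite gt_eqF.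
  have /is_derive_eq := is_derive1M (Fd r0) (is_derive1V rn (is_derive_id r (1 : R))).
  by apply; rewrite /p /soler_dF /h /V; field.
(* For r > 0 this function is [dF]; written in this form it is visibly the limit of [gn]. *)
suff W : weak_radial_derivative (fun r => h r - 2 * (F r / r)) ddF.
  have [_ ddFi _] := W; apply: weak_radial_derivative_ae W => //.
  - by apply: aeW => r r0; rewrite /soler_dF /h /V; field; rewrite gt_eqF.
  - exact: aeW.
  - have [D DM] := exp_small_bounded dFs.
    apply: bounded_radial_loc_integrable DM.
    exact: measurable_continuous_half_line cdF.
apply: (@weak_radial_derivative_cvg _ gn dgn _ _ M) => //.
- move=> n; apply: (@weak_radial_derivative_C1 _ _ _ M) => //.
  + move=> r r0; have d := is_derive1B (Vn_derive n r0) (is_derive_cst alpha r (1 : R)).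
    have /is_derive_eq := is_derive1B (is_derive1M d (Gd r0)) (is_derive1Z 2 (Frd r r0)).
    by apply; rewrite subr0.
  + move=> r r0; apply: cvgB.
      apply: cvgD; apply: cvgM.
      * exact: cdVn.
      * exact: cG.
      * by apply: cvgB; [exact: cVn|exact: cvg_cst].
      * exact: cdG.
    by apply: cvgM; [exact: cvg_cst|exact: cp].
  + exact: gM.
  + exact: dgM.
- move=> r r0; apply: cvgB; last exact: cvg_cst.
  apply: cvgM; last exact: cvg_cst.
  by apply: cvgB; [exact: reg_pow_cvg|exact: cvg_cst].
- move=> r r0; apply: cvgB; last exact: cvg_cst.
  apply: cvgD; apply: cvgM; try exact: cvg_cst; first exact: dVn_cvg.
  by apply: cvgB; [exact: reg_pow_cvg|exact: cvg_cst].
Qed.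

End soler_profile.

(** * Regularity of the solutions *)

Section weak_solution_regularity.
Context {R : realType}.
Local Notation MR := (measurableTypeR R).
Local Notation leb := (@lebesgue_measure R).
Local Notation Rpos := (`]0, +oo[%classic : set R).
Implicit Types (u v F dF ddF : R -> R) (r s : R).

Lemma rderivP u : (exists v, weak_radial_derivative u v) ->
  weak_radial_derivative u (rderiv u).
Proof. by move=> uv; exact: (xgetPex (cst 0) uv). Qed.

(** At each level the chosen derivative is first identified almost everywhere with an explicit
    exponentially small function, and membership in L^p is then read off from the latter. *)
Lemma radial_Sobolev2_exp_small (p : R) u F dF ddF : 1 <= p ->
  (exists v, weak_radial_derivative u v) ->
  radial_ae_eq u F -> radial_ae_eq (rderiv u) dF ->
  measurable_fun (Rpos : set MR) F -> measurable_fun (Rpos : set MR) dF ->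
  weak_radial_derivative dF ddF ->
  exp_small F -> exp_small dF -> exp_small ddF ->
  radial_Sobolev 2 p u.
Proof.
move=> p1 uv uF udF mF mdF W [C1 [s1 [s10 FC]]] [C2 [s2 [s20 dFC]]] [C3 [s3 [s30 ddFC]]].
have U := rderivP uv; have [ui dui _] := U; have [dFi ddFi _] := W.
have W1 : weak_radial_derivative (rderiv u) ddF.
  by apply: weak_radial_derivative_ae W => //; [exact: radial_ae_eq_sym|exact: aeW].
have ex : exists v, weak_radial_derivative (rderiv u) v by exists ddF.
have W2 := rderivP ex; have [_ ddui _] := W2.
split => //; first exact: radial_Lp_expR s10 ui uF mF FC.
split => //; first exact: radial_Lp_expR s20 dui udF mdF dFC.
apply: (radial_Lp_expR p1 s30 ddui (weak_radial_derivative_unique W2 W1) _ ddFC).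
exact: measurable_profile_pos (radial_loc_integrable_measurable ddFi).
Qed.

Section solution.
Variables (theta m omega : R) (f g : R -> R).
Hypotheses (theta1 : 1 <= theta) (alpha0 : 0 < m - omega) (beta0 : 0 < m + omega).
Hypothesis m2 : (m - omega) + (m + omega) = 1.
Hypotheses (fS : radial_Sobolev 1 4 f) (gS : radial_Sobolev 1 4 g).
Hypothesis fg : weak_solution theta m omega f g.

(** A bootstrap: primitives F and G are continuous, so the system makes the weak derivatives almost
    everywhere equal to continuous functions of r; being primitives of these as well, F and G are
    C^1. *)
Lemma weak_solution_profile : exists F G : R -> R,
  [/\ [/\ radial_ae_eq f F, radial_ae_eq g G,
      radial_ae_eq (rderiv f) (soler_dF theta F G (m - omega)) &
      radial_ae_eq (rderiv g) (soler_dG theta F G (m + omega))],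
    forall r, 0 < r -> is_derive r 1 F (soler_dF theta F G (m - omega) r) &
    forall r, 0 < r -> is_derive r 1 G (soler_dG theta F G (m + omega) r)].
Proof.
have [_ fex _] := fS; have [_ gex _] := gS.
have fW := rderivP fex; have gW := rderivP gex.
have [_ dfi _] := fW; have [_ dgi _] := gW.
have [F fF Fdf] := weak_radial_derivative_primitive fW.
have [G gG Gdg] := weak_radial_derivative_primitive gW.
have cF := primitive_on_half_line_continuous dfi Fdf.
have cG := primitive_on_half_line_continuous dgi Gdg.
have cdF r (r0 : 0 < r) := @soler_dF_continuous R theta F G theta1 cF cG (m - omega) r r0.
have cdG r (r0 : 0 < r) := @soler_dG_continuous R theta F G theta1 cF cG (m + omega) r r0.
have aeF := ae_filter_ringOfSetsType leb.
have dfE : radial_ae_eq (rderiv f) (soler_dF theta F G (m - omega)).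
  apply: (@filterS3 _ _ aeF _ _ _ _ _ fF gG fg) => r fFr gGr fgr r0.
  have [E _] := fgr r0; move: E; rewrite fFr// gGr// => E.
  by rewrite /soler_dF -E addrK.
have dgE : radial_ae_eq (rderiv g) (soler_dG theta F G (m + omega)).
  apply: (@filterS3 _ _ aeF _ _ _ _ _ fF gG fg) => r fFr gGr fgr r0.
  by have [_ ->] := fgr r0; rewrite fFr// gGr.
have mpos v : radial_loc_integrable v -> measurable_fun (Rpos : set MR) v.
  by move=> vi; exact: measurable_profile_pos (radial_loc_integrable_measurable vi).
exists F, G; split => //.
- apply: primitive_on_half_line_derive => //.
  apply: (primitive_on_half_line_ae (mpos _ dfi) _ dfE Fdf).
  exact: measurable_continuous_half_line cdF.
- apply: primitive_on_half_line_derive => //.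
  apply: (primitive_on_half_line_ae (mpos _ dgi) _ dgE Gdg).
  exact: measurable_continuous_half_line cdG.
Qed.

Lemma weak_solution_regularity : exists F G : R -> R,
  [/\ radial_ae_eq f F, radial_ae_eq g G &
    [/\ forall r, 0 < r -> is_derive r 1 F (soler_dF theta F G (m - omega) r),
      forall r, 0 < r -> is_derive r 1 G (soler_dG theta F G (m + omega) r),
      classical_solution theta m omega F G,
      [/\ exp_small F, exp_small G, exp_small (soler_dF theta F G (m - omega)) &
        exp_small (soler_dG theta F G (m + omega))] &
      forall p, 2 <= p -> radial_Sobolev 2 p f /\ radial_Sobolev 2 p g]].
Proof.
have [F [G [[fF gG dfE dgE] Fd Gd]]] := weak_solution_profile.
have [fL fex dfL] := fS; have [gL gex dgL] := gS.
have cF r (r0 : 0 < r) : {for r, continuous F} by exact: is_derive1_continuous (Fd r r0).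
have cG r (r0 : 0 < r) : {for r, continuous G} by exact: is_derive1_continuous (Gd r r0).
have cdF r (r0 : 0 < r) := @soler_dF_continuous R theta F G theta1 cF cG (m - omega) r r0.
have cdG r (r0 : 0 < r) := @soler_dG_continuous R theta F G theta1 cF cG (m + omega) r r0.
have mF := measurable_continuous_half_line cF; have mG := measurable_continuous_half_line cG.
have mdF := measurable_continuous_half_line cdF; have mdG := measurable_continuous_half_line cdG.
have Fi := radial_Lp4_integrable fL fF mF; have Gi := radial_Lp4_integrable gL gG mG.
have dFi := radial_Lp4_integrable dfL dfE mdF; have dGi := radial_Lp4_integrable dgL dgE mdG.
have [Fs Gs] := soler_exp_small theta1 alpha0 beta0 m2 Fd Gd Fi Gi dFi dGi.
have [dFs dGs ddFs ddGs] := soler_derivatives_exp_small theta1 alpha0 beta0 m2 Fd Gd Fi Gi dFi dGi.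
have dFW := soler_ddF_weak theta1 alpha0 beta0 m2 Fd Gd Fi Gi dFi dGi.
have dGW := soler_ddG_weak theta1 alpha0 beta0 m2 Fd Gd Fi Gi dFi dGi.
exists F, G; split; [exact: fF|exact: gG|].
split; [exact: Fd|exact: Gd| |by split|]; last first.
  move=> p p2; have p1 : 1 <= p by rewrite (le_trans _ p2)// ler1n.
  split; first exact: radial_Sobolev2_exp_small fF dfE mF mdF dFW Fs dFs ddFs.
  exact: radial_Sobolev2_exp_small gG dgE mG mdG dGW Gs dGs ddGs.
move=> r r0; have FE := derive1_is_derive (Fd r r0); have GE := derive1_is_derive (Gd r r0).
have cd (X dX : R -> R) : (forall s, 0 < s -> is_derive s 1 X (dX s)) ->
    {for r, continuous dX} -> {for r, continuous (derive1 X)}.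
  move=> XdX cdX; rewrite /prop_for /continuous_at (derive1_is_derive (XdX r r0)).
  apply: cvg_trans cdX; apply: near_eq_cvg; near=> s.
  by rewrite (derive1_is_derive (XdX s _))//; near: s; exact: lt_nbhsr.
split.
- by have [dF1 _] := Fd r r0; have [dG1 _] := Gd r r0.
- by split; [exact: cd Fd (cdF r r0)|exact: cd Gd (cdG r r0)].
- by rewrite /soler_system FE GE /soler_dF /soler_dG subrK.
Unshelve. all: by end_near. Qed.

End solution.

End weak_solution_regularity.

(** * Decay of the ground state *)

Section ground_state_profile.
Context {R : realType}.
Variables (theta : R) (Q : R -> R).
Hypothesis QG : ground_state theta Q.
Implicit Types r : R.

(** On the first axis the iterated partial derivative in direction 0 is the ordinary k-th
    derivative, so smoothness and decay on R^3 descend to the profile. The summand 0 matches the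
    shape expected by [is_derive_line]. *)
Let q (k : nat) r : R :=
  pderivs3 (nseq k (ord0 : 'I_3)) (radial Q) (r *: basis3 ord0 + 0).

Let line r : r *: basis3 ord0 + 0 = (r, 0, 0) :> R * R * R.
Proof.
have -> : r *: basis3 ord0 = (r * 1, r * 0, r * 0) by [].
by rewrite addr0 mulr1 mulr0.
Qed.

Let q_derive k r : is_derive r 1 (q k) (q k.+1 r).
Proof.
have [_ sQ _ _] := QG.
apply/is_derive_line; apply: DeriveDef => //; apply: diff_derivable; exact: sQ.
Qed.

Let q0E r : 0 < r -> q 0 r = Q r.
Proof. by move=> r0; rewrite /q/= line /radial enorm3_axis gtr0_norm. Qed.

Let q_small k : exp_small (q k).
Proof.
have [_ _ _ dQ] := QG; have [C [s [C0 s0 QC]]] := dQ (nseq k ord0).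
exists C, s; split=> // r r0; apply: (le_trans (QC _)).
by rewrite line enorm3_axis gtr0_norm.
Qed.

Lemma ground_state_exp_small : exists Q1 Q2 : R -> R,
  [/\ forall r, 0 < r -> is_derive r 1 Q (Q1 r),
    forall r, 0 < r -> is_derive r 1 (derive1 Q) (Q2 r),
    forall r, 0 < r -> derive1 Q r = Q1 r &
    [/\ exp_small Q, exp_small Q1 & exp_small Q2]].
Proof.
have Qd r : 0 < r -> is_derive r 1 Q (q 1 r).
  move=> r0; apply: (@is_derive1_near _ (q 0)); last exact: q_derive.
  by near=> s; rewrite q0E//; near: s; exact: lt_nbhsr.
have dQE r : 0 < r -> derive1 Q r = q 1 r by move=> r0; exact: derive1_is_derive (Qd r r0).
exists (q 1), (q 2); split; [exact: Qd| |exact: dQE|].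
  move=> r r0; apply: (@is_derive1_near _ (q 1)); last exact: q_derive.
  by near=> s; rewrite dQE//; near: s; exact: lt_nbhsr.
split; [|exact: q_small..].
by apply: eq_exp_small (q_small 0).
Unshelve. all: by end_near. Qed.

End ground_state_profile.

Lemma radial_ae_scale (R : realType) (k : R) (P : R -> Prop) : 0 < k ->
  {ae @lebesgue_measure R, forall r : R, 0 < r -> P r} ->
  {ae @lebesgue_measure R, forall r : R, 0 < r -> P (k * r)}.
Proof.
move=> k0 [N [mN N0 PN]].
exists ((fun r : measurableTypeR R => k * r) @^-1` N); split.
- by rewrite -[X in measurable X]setTI; exact: mulrl_measurable.
- by rewrite lebesgue_measure_scale// N0 mule0.
- move=> r /= nP; apply: PN => /= H; apply: nP => r0; apply: H; exact: mulr_gt0.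
Qed.

Lemma exp_small_norm (R : realType) (u : R -> R) : exp_small u ->
  exp_small (fun r => `|u r|).
Proof.
by move=> [C [s [s0 uC]]]; exists C, s; split=> // r r0; rewrite normr_id uC.
Qed.

(* Rescaling back: if X(r) = c (Y(k r) + e(k r)) then e(s) = X(s / k) / c - Y(s). *)
Lemma remainder_exp_small (R : realType) (c k : R) (x e X dX Y dY : R -> R) :
  0 < c -> 0 < k ->
  radial_ae_eq x X -> radial_ae_eq x (fun r => c * (Y (k * r) + e (k * r))) ->
  (forall r : R, 0 < r -> is_derive r 1 X (dX r)) ->
  (forall r : R, 0 < r -> is_derive r 1 Y (dY r)) ->
  exp_small X -> exp_small dX -> exp_small Y -> exp_small dY ->
  exists E dE : R -> R, [/\ radial_ae_eq e E,
    forall r : R, 0 < r -> is_derive r 1 E (dE r), exp_small E & exp_small dE].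
Proof.
move=> c0 k0 xX xY Xd Yd Xs dXs Ys dYs.
have k'0 : 0 < k^-1 by rewrite invr_gt0.
exists (fun s => c^-1 * X (k^-1 * s) - Y s).
exists (fun s => c^-1 * k^-1 * dX (k^-1 * s) - dY s); split.
- have := radial_ae_scale k'0 (radial_ae_eq_trans (radial_ae_eq_sym xX) xY).
  apply: (@filterS _ _ (ae_filter_ringOfSetsType (@lebesgue_measure R))) => s H s0.
  rewrite H// mulVKf ?gt_eqF// mulKf ?gt_eqF//.
  by rewrite addrC addKr.
- move=> s s0; have ks0 : 0 < k^-1 * s by rewrite mulr_gt0.
  have d0 : is_derive s 1 (fun t : R => k^-1 * t) k^-1.
    by have := is_derive1Z k^-1 (is_derive_id s (1 : R)); rewrite mulr1.
  have d1 := @is_derive1_comp _ X (fun t : R => k^-1 * t) _ _ _ (Xd _ ks0) d0.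
  have /is_derive_eq := is_derive1B (is_derive1Z c^-1 d1) (Yd s s0); apply.
  by ring.
- apply: exp_small_add (exp_small_opp Ys).
  by apply: exp_small_scale; exact: exp_small_dilate.
- apply: exp_small_add (exp_small_opp dYs).
  by apply: exp_small_scale; exact: exp_small_dilate.
Qed.

Theorem theorem1p2 (R : realType) (theta m eps0 : R) (Q : R -> R)
    (f g e1 e2 : R -> R -> R)
    (htheta : 1 <= theta < 2) (hm : m = 1 / 2)
    (heps0 : 0 < eps0 <= 2 * m)
    (hQ : ground_state theta Q)
    (hfam : solitary_family theta m eps0 Q f g e1 e2)
    (omega eps : R) (hepsE : eps = m - omega) (heps : 0 < eps < eps0) :
  (exists C sigma : R, [/\ 0 < C, 0 < sigma,
     exists2 E1 : R -> R, radial_ae_eq (e1 eps) E1 & exp_decay C sigma E1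
   & exists2 E2 : R -> R, radial_ae_eq (e2 eps) E2 & exp_decay C sigma E2]) /\
  (exists F G : R -> R, [/\ radial_ae_eq (f eps) F, radial_ae_eq (g eps) G
   & classical_solution theta m omega F G]) /\
  (forall p : R, 2 <= p ->
     radial_Sobolev 2 p (f eps) /\ radial_Sobolev 2 p (g eps)).
Proof.
have /andP[theta1 _] := htheta; have /andP[e0 ee0] := heps.
have m1 : 2 * m = 1 by rewrite hm; lra.
(* The bound on eps0 keeps eps below 2 m = 1; so m - omega = eps and m + omega = 1 - eps are both
   positive, and the linear part at infinity is hyperbolic. *)
have eps1 : eps < 1 by have /andP[_] := heps0; rewrite m1; exact: lt_le_trans.
have omegaE : m - eps = omega by rewrite hepsE; lra.
have [fam sol rep [C _ rem]] := hfam.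
have [fS gS _ _] := fam eps heps.
have fg := sol eps heps; rewrite omegaE in fg.
have [frep grep] := rep eps heps.
have al0 : 0 < m - omega by rewrite -hepsE.
have be0 : 0 < m + omega by rewrite -omegaE; lra.
have ab : (m - omega) + (m + omega) = 1 by lra.
have [F [G [fF gG [Fd Gd FG [Fs Gs dFs dGs] Sob]]]] :=
  weak_solution_regularity theta1 al0 be0 ab fS gS fg.
have [Q1 [Q2 [Qd Q1d QE [Qs Q1s Q2s]]]] := ground_state_exp_small hQ.
have k0 : 0 < Num.sqrt eps by rewrite sqrtr_gt0.
have cG0 : 0 < eps `^ (1 / (2 * theta)) by exact: powR_gt0.
have cF0 : 0 < eps `^ ((theta + 1) / (2 * theta)) by exact: powR_gt0.
have [E1 [dE1 [eE1 E1d E1s dE1s]]] :=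
  remainder_exp_small cG0 k0 gG grep Gd Qd Gs dGs Qs Q1s.
have NQd (r : R) : 0 < r -> is_derive r 1 (fun r => - derive1 Q r) (- Q2 r).
  by move=> r0; exact: is_derive1N (Q1d r r0).
have NQs : exp_small (fun r => - derive1 Q r).
  by apply: eq_exp_small (exp_small_opp Q1s) => r r0; rewrite QE.
have [E2 [dE2 [eE2 E2d E2s dE2s]]] :=
  remainder_exp_small cF0 k0 fF frep Fd NQd Fs dFs NQs (exp_small_opp Q2s).
split; last by split => //; exists F, G.
(* Adding up the absolute values of all four functions yields one pair of constants valid for both
   remainders and their derivatives. *)
have sum1 := exp_small_add (exp_small_norm E1s) (exp_small_norm dE1s).
have sum2 := exp_small_add (exp_small_norm E2s) (exp_small_norm dE2s).
have [D [sigma [D0 s0 sumD]]] := exp_smallP (exp_small_add sum1 sum2).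
have decay (E dE : R -> R) : (forall r : R, 0 < r -> is_derive r 1 E (dE r)) ->
    (forall r, `|E r| + `|dE r| <= `|E1 r| + `|dE1 r| + (`|E2 r| + `|dE2 r|)) ->
    exp_decay D sigma E.
  move=> Ed ED r r0; split; first by case: (Ed r r0).
  rewrite (derive1_is_derive (Ed r r0)); apply: (le_trans (ED r)).
  exact: le_trans (ler_norm _) (sumD r r0).
exists D, sigma; split=> //.
- by exists E1 => //; apply: decay E1d _ => r; rewrite lerDl addr_ge0.
- by exists E2 => //; apply: decay E2d _ => r; rewrite lerDr addr_ge0.
Qed.
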